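(* Let $1\leq n\in\mathbb N$. Then the set of Skolem functions $<2^{(n+1)^{\mathbf{x}}}$ has order type $\leq\omega_{n+2}$. Moreover, the set of archimedean classes (classes modulo $\asymp$) of the set of Skolem functions $<2^{(n+1)^{\mathbf{x}}}$ has order type $\leq\omega_{n+1}$.
   Context: $Sk$ is the smallest set of functions $\mathbb R^{>0}\to\mathbb R^{>0}$ containing the constant function $1$ and the identity function $\mathbf{x}$, and closed under $f+g$, $fg$ and $f^g$. It is ordered by $f<g$ iff $f(x)<g(x)$ for all sufficiently large $x$; this is a well order. For Skolem functions, $f\preceq g$ means $f\leq ng$ for some $n\in\mathbb N$, and $f\asymp g$ means $f\preceq g$ and $g\preceq f$; the archimedean classes are ordered by the order of their elements. Ordinals: $\omega_0=1$ and $\omega_{k+1}=\omega^{\omega_k}$. *)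

(* Defs.v *)
From mathcomp Require Import all_boot all_order all_algebra.
From mathcomp Require Import all_classical all_reals all_analysis.

Set Implicit Arguments.
Unset Strict Implicit.
Unset Printing Implicit Defensive.

Import Order.TTheory GRing.Theory Num.Theory.

Local Open Scope classical_set_scope.
Local Open Scope ring_scope.

(** * Ordinals, represented by well-ordered types *)

Record ordinal_rep := OrdinalRep {
  ord_sort :> Type;
  ord_le : rel ord_sort;
  ord_wo : wochoice.well_order ord_le }.

Arguments ord_le {o}.

Definition ord_lt (W : ordinal_rep) (x y : W) : Prop := ord_le x y /\ x <> y.

(* The order type of [A] under the strict order [lt] is the ordinal
   represented by [W]. *)
Definition has_order_type (T : Type) (lt : T -> T -> Prop) (A : set T)
    (W : ordinal_rep) : Prop :=
  exists2 phi : A -> W, bijective phi &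
    forall x y : A, lt (val x) (val y) <-> ord_lt (phi x) (phi y).

(* Isomorphism onto an initial segment. *)
Definition ordinal_le (V W : ordinal_rep) : Prop :=
  exists phi : V -> W,
    (forall x y, ord_lt x y <-> ord_lt (phi x) (phi y)) /\
    (forall x w, ord_le w (phi x) -> exists y, phi y = w).

Definition order_type_le (T : Type) (lt : T -> T -> Prop) (A : set T)
    (W : ordinal_rep) : Prop :=
  exists2 V : ordinal_rep, has_order_type lt A V & ordinal_le V W.

Section WellOrderTheory.
Variable W : ordinal_rep.
Implicit Types (x y z : W) (P : set W).

Lemma ord_min P : P !=set0 -> exists z, P z /\ forall x, P x -> ord_le z x.
Proof.
move=> [x Px].
have [|z [[zP zmin] _]] := @ord_wo W [pred x | `[< P x >]].
  by exists x; apply/asboolP.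
exists z; split; first exact/asboolP.
by move=> y Py; apply: zmin; apply/asboolP.
Qed.

Lemma ord_total x y : ord_le x y \/ ord_le y x.
Proof.
have [|z [[->|->] zmin]] := @ord_min [set u | u = x \/ u = y].
- by exists x; left.
- by left; apply: zmin; right.
- by right; apply: zmin; left.
Qed.

Lemma ord_refl x : ord_le x x.
Proof. by case: (ord_total x x). Qed.

Lemma ord_anti x y : ord_le x y -> ord_le y x -> x = y.
Proof.
move=> xy yx; have [|z [_ zu]] := @ord_wo W [pred u | `[< u = x \/ u = y >]].
  by exists x; apply/asboolP; left.
have zx : z = x.
  apply: zu; split; first by apply/asboolP; left.
  by move=> u /asboolP[]->; rewrite ?ord_refl.
rewrite -zx; apply: zu; split; first by apply/asboolP; right.
by move=> u /asboolP[]->; rewrite ?ord_refl.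
Qed.

Lemma ord_trans y x z : ord_le x y -> ord_le y z -> ord_le x z.
Proof.
move=> xy yz.
have [|w [[->|[->|->]] wmin]] := @ord_min [set u | u = x \/ u = y \/ u = z].
- by exists x; left.
- by apply: wmin; right; right.
- have <- : y = x by apply: ord_anti => //; apply: wmin; left.
  by [].
- have zy : ord_le z y by apply: wmin; right; left.
  by have -> : z = y by exact: ord_anti.
Qed.

Lemma ord_ltNge x y : ord_lt x y <-> ~ ord_le y x.
Proof.
split=> [[xy nxy] yx|nyx]; first exact/nxy/ord_anti.
have [xy|//] := ord_total x y.
by split=> // exy; apply: nyx; rewrite exy ord_refl.
Qed.

Lemma ord_lt_trans y x z : ord_lt x y -> ord_lt y z -> ord_lt x z.
Proof.
move=> [xy nxy] [yz nyz]; split; first exact: ord_trans yz.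
by move=> exz; apply: nxy; apply: ord_anti => //; rewrite exz.
Qed.

Lemma ord_cmp x y : ord_lt x y \/ x = y \/ ord_lt y x.
Proof.
have [exy|nxy] := pselect (x = y); first by right; left.
have [xy|yx] := ord_total x y; first by left.
by right; right; split=> // eyx; apply: nxy.
Qed.

Lemma ord_ltxx x : ~ ord_lt x x. Proof. by case. Qed.

Lemma ord_ind (Q : W -> Prop) :
  (forall x, (forall y, ord_lt y x -> Q y) -> Q x) -> forall x, Q x.
Proof.
move=> IH x; apply: contrapT => nQx.
have [|z [nQz zmin]] := @ord_min [set u | ~ Q u]; first by exists x.
apply: nQz; apply: IH => y /ord_ltNge yz; apply: contrapT => nQy.
exact/yz/zmin.
Qed.

Lemma ord_finite_max P : finite_set P -> P !=set0 ->
  exists z, P z /\ forall x, P x -> ord_le x z.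
Proof.
move=> finP; have /finite_seqP[s Ps] : finite_set (P : set {classic W}) by [].
rewrite {finP}Ps; elim: s => [|a s IH]; first by case=> x; rewrite /= in_nil.
move=> _; have [[x xs]|s0] := pselect (exists x : {classic W}, x \in s).
  have [|z [zs zmax]] := IH; first by exists x.
  have [az|za] := ord_total a z.
    exists z; split; first by rewrite /= inE; apply/orP; right.
    by move=> y /=; rewrite inE => /orP[/eqP->//|]; exact: zmax.
  exists a; split; first by rewrite /= mem_head.
  move=> y /=; rewrite inE => /orP[/eqP->|/zmax yz]; first exact: ord_refl.
  exact: ord_trans za.
exists a; split; first by rewrite /= mem_head.
move=> y /=; rewrite inE => /orP[/eqP->|ys]; first exact: ord_refl.
by case: s0; exists y.
Qed.

End WellOrderTheory.

(** ** The ordinal power [omega ^ W]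

   Finitely supported functions [W -> nat], compared at the largest argument
   where they differ. *)

Section OmegaExp.
Variable W : ordinal_rep.

Definition omega_exp_sort : Type :=
  {f : W -> nat | finite_set [set a | f a <> 0%N]}.

Definition omega_exp_lt (f g : omega_exp_sort) : Prop :=
  exists a : W, (sval f a < sval g a)%N /\
    forall b : W, ord_lt a b -> sval f b = sval g b.

Definition omega_exp_le : rel omega_exp_sort :=
  fun f g => `[< f = g \/ omega_exp_lt f g >].

Lemma omega_exp_val_inj (f g : omega_exp_sort) : sval f = sval g -> f = g.
Proof.
by case: f g => [f Pf] [g Pg] /= fg; subst g; congr exist; exact: Prop_irrelevance.
Qed.

Lemma omega_exp_lt_anti f g : omega_exp_lt f g -> ~ omega_exp_lt g f.
Proof.
move=> [a [fga Ha]] [b [gfb Hb]].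
have [ab|[ab|ba]] := ord_cmp a b.
- by move: gfb; rewrite Ha// ltnn.
- by move: gfb; rewrite -ab ltnNge (ltnW fga).
- by move: fga; rewrite Hb// ltnn.
Qed.

Lemma omega_exp_min (D : set W) :
  (forall a b, D b -> ord_lt a b -> D a) ->
  (forall d, D d -> forall (h : W -> nat) (P : set omega_exp_sort),
    P !=set0 -> (forall f b, P f -> ~ ord_lt b d -> sval f b = h b) ->
    exists z, P z /\ forall f, P f -> omega_exp_le z f) ->
  forall (h : W -> nat) (P : set omega_exp_sort),
    P !=set0 -> (forall f b, P f -> ~ D b -> sval f b = h b) ->
    exists z, P z /\ forall f, P f -> omega_exp_le z f.
Proof.
move=> Ddown IH h P [f0 Pf0] Ph.
have supp (f : omega_exp_sort) (E : set W) :
    finite_set [set a | E a /\ sval f a <> 0%N].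
  by apply: sub_finite_set (proj2_sig f) => a [].
have [[b0 Sb0]|S0] := pselect (exists b, D b /\ sval f0 b <> 0%N); last first.
  exists f0; split=> // f Pf; apply/asboolP.
  have [[c Sc]|T0] := pselect (exists b, D b /\ sval f b <> 0%N).
    right; have [|m [[Dm fm] mmax]] := ord_finite_max (supp f D); first by exists c.
    have f00 b : D b -> sval f0 b = 0%N.
      by move=> Db; apply: contrapT => ?; apply: S0; exists b.
    exists m; rewrite f00// lt0n; split; first exact/eqP.
    move=> b mb; have [Db|nDb] := pselect (D b); last by rewrite (Ph f)// (Ph f0).
    rewrite f00//; apply: contrapT => fb; move/ord_ltNge: mb; apply.
    by apply: mmax; split=> // fb0; apply: fb.
  left; apply: omega_exp_val_inj; apply/funext => b.
  have [Db|nDb] := pselect (D b); last by rewrite (Ph f)// (Ph f0).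
  have -> : sval f0 b = 0%N by apply: contrapT => ?; apply: S0; exists b.
  by apply/esym; apply: contrapT => ?; apply: T0; exists b.
have [|b [[Db f0b] bmax]] := ord_finite_max (supp f0 D); first by exists b0.
pose P' := [set f | P f /\ forall c, D c -> ord_lt b c -> sval f c = 0%N].
have P'f0 : P' f0.
  split=> // c Dc /ord_ltNge bc; apply: contrapT => f0c; apply: bc.
  by apply: bmax.
have exm : exists m, `[< exists2 f, P' f & sval f b = m >].
  by exists (sval f0 b); apply/asboolP; exists f0.
have [m /asboolP[f1 P'f1 f1m] mmin] := ex_minnP exm.
have [||z [[P'z zm] zmin]] := @IH b Db (sval f1) [set f | P' f /\ sval f b = m].
- by exists f1.
- move=> f c [[Pf Pf0'] fm] /=; have [bc|[<-|cb]] := ord_cmp b c => //.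
    move=> _; case: P'f1 => Pf1 f10.
    have [Dc|nDc] := pselect (D c); first by rewrite Pf0'// f10.
    by rewrite (Ph f)// (Ph f1).
  by move=> _; rewrite fm f1m.
exists z; split; first by case: P'z.
move=> g Pg; have [P'g|nP'g] := pselect (P' g); last first.
  apply/asboolP; right.
  have [|c [[[Dc bc] gc] cmax]] :=
    ord_finite_max (supp g [set c | D c /\ ord_lt b c]).
    apply: contrapT => ng; apply: nP'g; split=> // c Dc bc.
    by apply: contrapT => gc; apply: ng; exists c.
  exists c; rewrite (P'z.2 _ Dc bc) lt0n; split; first exact/eqP.
  move=> e ce; have [De|nDe] := pselect (D e); last first.
    by rewrite (Ph g)// (Ph z)//; case: P'z.
  have be := ord_lt_trans bc ce; rewrite (P'z.2 _ De be).
  apply: contrapT => ge; move/ord_ltNge: ce; apply; apply: cmax.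
  by split=> // ge0; apply: ge.
have [gm|gm] := pselect (sval g b = m); first exact: zmin.
apply/asboolP; right; exists b; rewrite zm; split.
  rewrite ltn_neqAle; apply/andP; split; first by apply/eqP => /esym.
  by apply: mmin; apply/asboolP; exists g.
move=> c bc; have [Dc|nDc] := pselect (D c).
  by rewrite (P'z.2 _ Dc bc) (P'g.2 _ Dc bc).
by rewrite (Ph g)// (Ph z)//; case: P'z.
Qed.

Lemma omega_exp_wo : wochoice.well_order omega_exp_le.
Proof.
apply: wochoice.antisymmetric_well_order.
  move=> f g /andP[/asboolP[//|fg] /asboolP[//|gf]].
  by case: (omega_exp_lt_anti fg).
have step d (h : W -> nat) (P : set omega_exp_sort) :
    P !=set0 -> (forall f b, P f -> ~ ord_lt b d -> sval f b = h b) ->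
    exists z, P z /\ forall f, P f -> omega_exp_le z f.
  elim/ord_ind: d h P => d IH; apply: (@omega_exp_min [set b | ord_lt b d]).
    by move=> a b /= bd ab; exact: ord_lt_trans bd.
  by move=> e /= ed; exact: IH.
move=> A [f0 Af0].
have min0 := @omega_exp_min setT (fun _ _ _ _ => I) (fun d _ => step d).
have [||z [Az zmin]] := min0 (fun=> 0%N) [set f | f \in A].
- by exists f0.
- by move=> f b _ /(_ I).
- by exists z; split=> // f fA; exact: zmin.
Qed.

Definition omega_exp : ordinal_rep := OrdinalRep omega_exp_wo.

End OmegaExp.

Lemma unit_wo : wochoice.well_order (fun _ _ : unit => true).
Proof. by move=> A [[] A0]; exists tt; split=> // -[]. Qed.

Definition ord_one : ordinal_rep := OrdinalRep unit_wo.

Fixpoint omega_tower (k : nat) : ordinal_rep :=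
  if k is k'.+1 then omega_exp (omega_tower k') else ord_one.

(** * Skolem functions *)

Section Skolem.
Variable R : realType.

(* Working with functions on the type of positive reals makes Leibniz equality
   coincide with equality of functions on the positive reals. *)
Definition pfun : Type := {posnum R} -> {posnum R}.

Implicit Types f g : pfun.

Inductive Skolem : set pfun :=
| Skolem_one : Skolem (fun=> 1%:pos)
| Skolem_id : Skolem (fun x => x)
| Skolem_add f g : Skolem f -> Skolem g ->
    Skolem (fun x => ((f x)%:num + (g x)%:num)%:pos)
| Skolem_mul f g : Skolem f -> Skolem g ->
    Skolem (fun x => ((f x)%:num * (g x)%:num)%:pos)
| Skolem_pow f g : Skolem f -> Skolem g ->
    Skolem (fun x => ((f x)%:num `^ (g x)%:num)%:pos).

Definition pfun_lt f g : Prop :=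
  exists M : R, forall x : {posnum R}, M < x%:num -> (f x)%:num < (g x)%:num.

Definition pfun_le f g : Prop := f = g \/ pfun_lt f g.

(* Multiples by [0] are left out: they are not functions into the positive
   reals, and no positive function is below them. *)
Definition arch_le f g : Prop :=
  exists n : nat, pfun_le f (fun x => (n.+1%:R * (g x)%:num)%:pos).

Definition arch_eq f g : Prop := arch_le f g /\ arch_le g f.

Definition arch_class (A : set pfun) f : set pfun :=
  [set g | A g /\ arch_eq f g].

Definition arch_classes (A : set pfun) : set (set pfun) :=
  [set arch_class A f | f in A].

Definition arch_class_lt (C D : set pfun) : Prop :=
  forall f g, C f -> D g -> pfun_lt f g.

Definition Skolem_below (b : pfun) : set pfun :=
  [set f | Skolem f /\ pfun_lt f b].

Definition two_pow_pow (n : nat) : pfun :=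
  fun x => (2 `^ (n.+1%:R `^ x%:num))%:pos.

End Skolem.

(* Main.v *)
Require Import Defs.
From HB Require Import structures.
From mathcomp Require Import all_boot all_order all_algebra.
From mathcomp Require Import all_classical all_reals all_analysis.
From mathcomp Require Import ring lra zify.

(** Along an ultrafilter at infinity the real field becomes an ordered field [K]
   with [exp], [ln] and an infinite element [X], and every Skolem function has a
   germ in [K]. Skolem functions lie in Hardy fields and are real analytic, so two
   of them are eventually comparable, and equal if eventually equal: the map to [K]
   is an order embedding.

   A Skolem element below [2^((n+1)^X)] is tame: it is built from [1] and [X] by
   sums, products and powers [h^(c^X X^j)], hence is a finite sum of components,
   the products of [X] and of such powers. Let [fragment m k] consist of the tame
   [h] with [ln h = O(m^X X^k ln X)]. The logarithm of a component in [fragment m k]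
   is the sum of the logarithm of a component in some [fragment (m-1) k'] and of
   terms [c^X X^j ln h] with [c] dividing [m] and [h] in [fragment (m/c) (k-j)].
   Bounds on order types are obtained by induction on [(m, k)]: sums of sets cost a
   natural sum of ordinals, while finite sums of components cost one exponentiation.
   What makes the induction work is a gap property: tame [p] and [q] satisfy
   [p = O(q)] or [q X = O(p)], so that refining classes modulo [O(1)] to classes
   modulo [O(X^-i)] splits each class of logarithms into finitely many. The gap
   property follows from expansions of logarithms in exponentials [exp(q X)] with
   coefficients that are Laurent series in [1/X] given by analytic functions, plus
   multiples of [ln X]. *)

Set Implicit Arguments.
Unset Strict Implicit.
Unset Printing Implicit Defensive.

Import Order.TTheory GRing.Theory Num.Theory.
Import numFieldNormedType.Exports.

Local Open Scope classical_set_scope.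
Local Open Scope ring_scope.

(** * Natural sums of ordinals *)

Lemma ord_le_eqVlt (W : ordinal_rep) (x y : W) :
  ord_le x y <-> x = y \/ ord_lt x y.
Proof.
split=> [xy|[->|[]//]]; last exact: ord_refl.
by have [|] := pselect (x = y); [left|right].
Qed.

Lemma ord_le_lt_trans (W : ordinal_rep) (y x z : W) :
  ord_le x y -> ord_lt y z -> ord_lt x z.
Proof. by move=> /ord_le_eqVlt[->//|]; apply: ord_lt_trans. Qed.

Lemma ord_lt_le_trans (W : ordinal_rep) (y x z : W) :
  ord_lt x y -> ord_le y z -> ord_lt x z.
Proof. by move=> xy /ord_le_eqVlt[<-//|]; apply: ord_lt_trans. Qed.

Lemma ord_leNgt (W : ordinal_rep) (x y : W) : ord_le x y <-> ~ ord_lt y x.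
Proof.
split=> [xy /ord_ltNge //|nyx]; apply: contrapT => nxy.
exact/nyx/ord_ltNge.
Qed.

Section OmegaExpArith.
Variable W : ordinal_rep.
Implicit Types (f g h : omega_exp W) (v w : W).

Lemma oexp_ltP f g : ord_lt f g <-> omega_exp_lt f g.
Proof.
split=> [[/asboolP[efg nfg|//]]|fg]; first by case: nfg.
split; first by apply/asboolP; right.
by move=> efg; move: fg; rewrite efg => fg; apply: (omega_exp_lt_anti fg).
Qed.

Lemma oexp_ext f g : (forall v, sval f v = sval g v) -> f = g.
Proof. by move=> fg; apply: omega_exp_val_inj; apply/funext. Qed.

Definition oexp_of (f : W -> nat) (ff : finite_set [set a | f a <> 0%N]) :
  omega_exp W := exist _ f ff.

Fact oexp0_subproof : finite_set [set a : W | (fun=> 0%N) a <> 0%N].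
Proof. by rewrite (_ : mkset _ = set0) // predeqE => a; split. Qed.
Definition oexp0 : omega_exp W := oexp_of oexp0_subproof.

Fact oexp_add_subproof f g :
  finite_set [set a : W | (sval f a + sval g a)%N <> 0%N].
Proof.
apply: (@sub_finite_set _ _
  ([set a | sval f a <> 0%N] `|` [set a | sval g a <> 0%N])).
  move=> a /=; have [->|] := pselect (sval f a = 0%N); last by left.
  by rewrite add0n; right.
by rewrite finite_setU; split; [exact: (proj2_sig f)|exact: (proj2_sig g)].
Qed.
Definition oexp_add f g : omega_exp W :=
  @oexp_of (fun a => (sval f a + sval g a)%N) (oexp_add_subproof f g).

Fact oexp_pow_subproof v : finite_set [set a : W | nat_of_bool `[< a = v >] <> 0%N].
Proof.
apply: (@sub_finite_set _ _ [set v]); last exact: finite_set1.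
by move=> a /=; case: asboolP.
Qed.
Definition oexp_pow v : omega_exp W := oexp_of (oexp_pow_subproof v).

Lemma oexp_addC f g : oexp_add f g = oexp_add g f.
Proof. by apply: oexp_ext => v /=; rewrite addnC. Qed.

Lemma oexp_lt_add2r h f g : ord_lt f g -> ord_lt (oexp_add f h) (oexp_add g h).
Proof.
move=> /oexp_ltP[a [fga Ha]]; apply/oexp_ltP; exists a => /=; split.
  by rewrite ltn_add2r.
by move=> b ab; rewrite Ha.
Qed.

Lemma oexp_lt_add2l h f g : ord_lt f g -> ord_lt (oexp_add h f) (oexp_add h g).
Proof. by rewrite !(oexp_addC h); apply: oexp_lt_add2r. Qed.

Lemma oexp_le_add2r h f g : ord_le f g -> ord_le (oexp_add f h) (oexp_add g h).
Proof.
move=> /ord_le_eqVlt[->|fg]; first exact: ord_refl.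
by apply/ord_le_eqVlt; right; apply: oexp_lt_add2r.
Qed.

Lemma oexp_le_add2l h f g : ord_le f g -> ord_le (oexp_add h f) (oexp_add h g).
Proof. by rewrite !(oexp_addC h); apply: oexp_le_add2r. Qed.

Lemma oexp_ge0 f : ord_le oexp0 f.
Proof. by apply/ord_leNgt => /oexp_ltP[a [/=]]; rewrite ltn0. Qed.

Lemma oexp_add0 f : oexp_add f oexp0 = f.
Proof. by apply: oexp_ext => v /=; rewrite addn0. Qed.

Lemma oexp_le_addr f g : ord_le f (oexp_add f g).
Proof. by rewrite -{1}(oexp_add0 f); apply: oexp_le_add2l; apply: oexp_ge0. Qed.

Lemma oexp_pow_gt0 v : ord_lt oexp0 (oexp_pow v).
Proof.
apply/oexp_ltP; exists v => /=; rewrite asboolT//; split=> // b [vb nvb].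
by rewrite asboolF// => bv; apply: nvb.
Qed.

Lemma oexp_lt_powP v f :
  ord_lt f (oexp_pow v) <-> forall b, sval f b <> 0%N -> ord_lt b v.
Proof.
split=> [/oexp_ltP[a [/=]]|fv]; last first.
  apply/oexp_ltP; exists v => /=; rewrite asboolT//; split.
    by rewrite ltnS leqn0; apply/eqP; apply: contrapT => /fv /ord_ltxx.
  move=> b vb; rewrite asboolF; last by move=> bv; move: vb; rewrite bv => /ord_ltxx.
  by apply: contrapT => /fv /(ord_lt_trans vb) /ord_ltxx.
case: asboolP => [->{a}|//]; rewrite ltnS leqn0 => /eqP fv0 f_above b fb.
have [//|[bv|vb]] := ord_cmp b v; first by case: fb; rewrite bv.
by case: fb; rewrite f_above// asboolF// => bv; move: vb; rewrite bv => /ord_ltxx.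
Qed.

Lemma oexp_pow_mono v w : ord_lt w v -> ord_lt (oexp_pow w) (oexp_pow v).
Proof. by move=> wv; apply/oexp_lt_powP => b /=; case: asboolP => [->|]. Qed.

Lemma oexp_add_lt_pow v f g :
  ord_lt f (oexp_pow v) -> ord_lt g (oexp_pow v) -> ord_lt (oexp_add f g) (oexp_pow v).
Proof.
move=> /oexp_lt_powP fv /oexp_lt_powP gv; apply/oexp_lt_powP => b /= fgb.
have [f0|] := pselect (sval f b = 0%N); last exact: fv.
by apply: gv; move: fgb; rewrite f0.
Qed.

Lemma oexp_lt_pow_exists f : inhabited W -> (forall v : W, exists w, ord_lt v w) ->
  exists v, ord_lt f (oexp_pow v).
Proof.
move=> [v0] exists_gt; have [[b fb]|f0] := pselect (exists b, sval f b <> 0%N).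
  have [|z [_ zmax]] := ord_finite_max (proj2_sig f); first by exists b.
  have [w zw] := exists_gt z; exists w; apply/oexp_lt_powP => c /zmax cz.
  exact: ord_le_lt_trans zw.
by exists v0; apply/oexp_lt_powP => b fb; case: f0; exists b.
Qed.

Lemma oexp_exists_gt f : inhabited W -> exists g, ord_lt f g.
Proof.
move=> [v]; exists (oexp_add f (oexp_pow v)).
by rewrite -{1}(oexp_add0 f); apply: oexp_lt_add2l; apply: oexp_pow_gt0.
Qed.

End OmegaExpArith.

Section StrictlyMonotone.
Variables (V W : ordinal_rep) (phi : V -> W).
Hypothesis phi_mono : {homo phi : x y / ord_lt x y >-> ord_lt x y}.

Lemma ord_homo_lt x y : ord_lt x y <-> ord_lt (phi x) (phi y).
Proof.
split; first exact: phi_mono.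
have [//|[->|/phi_mono yx]] := ord_cmp x y; first by move=> /ord_ltxx.
by move=> /(ord_lt_trans yx) /ord_ltxx.
Qed.

Lemma ord_homo_inj : injective phi.
Proof.
by move=> x y e; have [|[//|]] := ord_cmp x y => /phi_mono; rewrite e => /ord_ltxx.
Qed.

Definition oexp_map_fun (f : omega_exp V) (b : W) : nat :=
  if pselect (exists a, phi a = b) is left e then sval f (projT1 (cid e)) else 0%N.

Lemma oexp_map_funE f a : oexp_map_fun f (phi a) = sval f a.
Proof.
rewrite /oexp_map_fun; case: pselect => [e|[]]; last by exists a.
by congr (sval f _); apply: ord_homo_inj; case: cid.
Qed.

Lemma oexp_map_fun0 f b : ~ (exists a, phi a = b) -> oexp_map_fun f b = 0%N.
Proof. by rewrite /oexp_map_fun; case: pselect. Qed.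

Fact oexp_map_subproof f : finite_set [set b | oexp_map_fun f b <> 0%N].
Proof.
apply: (@sub_finite_set _ _ (phi @` [set a | sval f a <> 0%N])).
  move=> b /=; have [[a <-]|/oexp_map_fun0 -> //] := pselect (exists a, phi a = b).
  by rewrite oexp_map_funE; exists a.
exact: finite_image (proj2_sig f).
Qed.
Definition oexp_map f : omega_exp W := oexp_of (oexp_map_subproof f).

Lemma oexp_map_mono f g : ord_lt f g -> ord_lt (oexp_map f) (oexp_map g).
Proof.
move=> /oexp_ltP[a [fga Ha]]; apply/oexp_ltP; exists (phi a) => /=.
rewrite !oexp_map_funE; split=> // b ab.
have [[c cb]|nb] := pselect (exists a, phi a = b); last by rewrite !oexp_map_fun0.
by rewrite -cb !oexp_map_funE Ha//; apply/ord_homo_lt; rewrite cb.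
Qed.

Lemma oexp_map_lt_pow t f :
  (forall a, ord_lt (phi a) t) -> ord_lt (oexp_map f) (oexp_pow t).
Proof.
move=> phi_t; apply/oexp_lt_powP => b /=.
by have [[a <-]|/oexp_map_fun0 -> //] := pselect (exists a, phi a = b).
Qed.

End StrictlyMonotone.

Definition tower_zero k : omega_tower k :=
  if k is k'.+1 return omega_tower k then oexp0 (omega_tower k') else tt.

Definition tower_one k : omega_tower k.+1 := oexp_pow (tower_zero k).

Lemma tower_inhabited k : inhabited (omega_tower k).
Proof. exact: inhabits (tower_zero k). Qed.

Lemma tower_lift k : exists (iota : omega_tower k -> omega_tower k.+1) t,
  {homo iota : x y / ord_lt x y >-> ord_lt x y} /\ forall x, ord_lt (iota x) t.
Proof.
elim: k => [|k [iota [t [iota_mono iota_t]]]].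
  exists (fun=> oexp0 _), (oexp_pow (W := ord_one) tt); split=> [[] [] /ord_ltxx//|_].
  exact: oexp_pow_gt0.
exists (oexp_map iota_mono), (oexp_pow t); split; first exact: oexp_map_mono.
by move=> x; apply: oexp_map_lt_pow.
Qed.

Lemma tower_exists_gt k (v : omega_tower k.+1) : exists w, ord_lt v w.
Proof. exact: oexp_exists_gt (tower_inhabited k). Qed.

Lemma tower_lt_pow k (f : omega_tower k.+2) : exists v, ord_lt f (oexp_pow v).
Proof. exact: oexp_lt_pow_exists (tower_inhabited _) (@tower_exists_gt k). Qed.

(** * Heights *)

(* [height R g U] implies that [U] embeds, along [R], in the ordinal
   omega ^ g; unlike order types, heights are compatible with finite unions,
   which makes them easy to bound for sums of sets. *)
Inductive height (T : Type) (R : T -> T -> Prop) (W : ordinal_rep) :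
    W -> set T -> Prop :=
| height_intro g U : (forall u, U u -> below R g (U `&` [set v | R v u])) ->
    height R g U
with below (T : Type) (R : T -> T -> Prop) (W : ordinal_rep) :
    W -> set T -> Prop :=
| below_empty g V : V `<=` set0 -> below R g V
| below_cover g V g' V1 V2 : ord_lt g' g -> height R g' V1 -> below R g V2 ->
    V `<=` V1 `|` V2 -> below R g V.

Section HeightTheory.
Variables (T : Type) (R : T -> T -> Prop) (W : ordinal_rep).
Implicit Types (g : W) (U V : set T).

Lemma height_below g U : height R g U ->
  forall u, U u -> below R g (U `&` [set v | R v u]).
Proof. by case. Qed.

Lemma below_sub g U V : U `<=` V -> below R g V -> below R g U.
Proof.
move=> UV VB; case: VB UV => {}g {}V => [V0|g' V1 V2 g'_lt HV1 B VV] UV.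
  by apply: below_empty; exact: subset_trans V0.
by apply: below_cover g'_lt HV1 B _; exact: subset_trans VV.
Qed.

Lemma below_le g g' V : ord_le g g' -> below R g V -> below R g' V.
Proof.
move=> gg' B; elim: B g' gg' => {}g {}V => [V0 g' gg'|g1 V1 V2 g1_lt HV1 _ IH VV g' gg'].
  exact: below_empty.
by apply: below_cover HV1 (IH _ gg') VV; exact: ord_lt_le_trans gg'.
Qed.

Lemma below_setU g V1 V2 : below R g V1 -> below R g V2 -> below R g (V1 `|` V2).
Proof.
move=> B; elim: B V2 => {}g V => [V0 V2|g' V1' V2' g'_lt HV1 _ IH VV V2] B2.
  by apply: below_sub B2 => x [/V0|].
apply: below_cover g'_lt HV1 (IH _ B2) _ => x [/VV[]|]; first by left.
  by right; left.
by right; right.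
Qed.

Lemma below_bigcup g (F : nat -> set T) n :
  (forall i, (i < n)%N -> below R g (F i)) ->
  below R g [set x | exists2 i, (i < n)%N & F i x].
Proof.
elim: n => [_|n IH FB]; first by apply: below_empty => x [].
apply: (@below_sub _ _ ([set x | exists2 i, (i < n)%N & F i x] `|` F n)).
  move=> x [i]; rewrite ltnS leq_eqVlt => /orP[/eqP->|ltn] Fx; first by right.
  by left; exists i.
by apply: below_setU; [apply: IH => i ?; apply: FB; apply: leqW|exact: FB].
Qed.

Lemma height_lt_below g g' V : ord_lt g' g -> height R g' V -> below R g V.
Proof.
move=> g'_lt HU.
by apply: below_cover g'_lt HU (@below_empty _ _ _ _ set0 _) _ => // x; left.
Qed.

Lemma height_set1 g u : ~ R u u -> height R g [set u].
Proof. by move=> Ruu; constructor=> _ ->; apply: below_empty => _ [-> /Ruu]. Qed.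

Lemma height_le g g' U : ord_le g g' -> height R g U -> height R g' U.
Proof. by move=> gg' /height_below HU; constructor=> u /HU; apply: below_le. Qed.

End HeightTheory.

Lemma height_transfer (T T' : Type) (R : T -> T -> Prop) (R' : T' -> T' -> Prop)
    (S : T' -> T -> Prop) (W : ordinal_rep) :
  (forall u' v' u v, S u' u -> S v' v -> R' u' v' -> R u v) ->
  forall (g : W) (U : set T) (U' : set T'),
  (forall u', U' u' -> exists u, U u /\ S u' u) ->
  height R g U -> height R' g U'.
Proof.
move=> SR; elim/ord_ind => g IH U U' UU' /height_below HU.
have below_transfer V : below R g V -> forall V' : set T',
    (forall v', V' v' -> exists v, V v /\ S v' v) -> below R' g V'.
  move=> B; elim: B IH => {V HU}{}g V.
    move=> V0 _ V' VV'; apply: below_empty => v' /VV'[v [/V0]]//.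
  move=> g' V1 V2 g'_lt HV1 _ IHB VV IH V' VV'.
  apply: (@below_cover _ _ _ _ _ g' [set v' | exists v, V1 v /\ S v' v]
            (V' `&` [set v' | exists v, V2 v /\ S v' v])) => //.
  - by apply: (IH _ g'_lt V1) => // v' [v [? ?]]; exists v.
  - by apply: IHB => // v' [].
  - move=> v' V'v'; have [v [/VV[]]] := VV' _ V'v'; first by left; exists v.
    by right; split=> //; exists v.
constructor=> u' U'u'; have [u [Uu Suu']] := UU' _ U'u'.
apply: (below_transfer _ (HU _ Uu)) => v' [U'v' /= Rvu].
have [v [Uv Svv']] := UU' _ U'v'.
by exists v; split=> //; split=> //=; apply: SR Rvu.
Qed.

Lemma height_sub (T : Type) (R : T -> T -> Prop) (W : ordinal_rep) (g : W) U V :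
  U `<=` V -> height R g V -> height R g U.
Proof.
move=> UV; apply: (@height_transfer _ _ R R eq) => [u v _ _ <- <- //|u /UV Vu].
by exists u.
Qed.

Lemma height_map (T : Type) (R : T -> T -> Prop) (W W' : ordinal_rep)
    (phi : W -> W') : {homo phi : x y / ord_lt x y >-> ord_lt x y} ->
  forall (g : W) (U : set T), height R g U -> height R (phi g) U.
Proof.
move=> mono; elim/ord_ind => g IH U /height_below HU; constructor=> u /HU.
move=> B; elim: B IH => {HU}{}g V.
  by move=> V0 _; apply: below_empty.
move=> g' V1 V2 g'_lt HV1 _ IHB VV IH.
apply: below_cover (mono _ _ g'_lt) _ (IHB IH) VV.
exact: IH.
Qed.

Lemma height_op (T1 T2 T3 : Type) (R1 : T1 -> T1 -> Prop) (R2 : T2 -> T2 -> Prop)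
    (R3 : T3 -> T3 -> Prop) (op : T1 -> T2 -> T3) (W : ordinal_rep) :
  (forall u u' v v', R3 (op u v) (op u' v') -> R1 u u' \/ R2 v v') ->
  forall (a b : omega_exp W) (U : set T1) (V : set T2),
  height R1 a U -> height R2 b V ->
  height R3 (oexp_add a b) [set op u v | u in U & v in V].
Proof.
move=> opR a b; elim/(@ord_ind (omega_exp W)): a b => a IHa b.
elim/(@ord_ind (omega_exp W)): b => b IHb U V HU HV.
pose image U V := [set op u v | u in U & v in V].
constructor=> _ [u0 Uu0 [v0 Vv0 <-]].
apply: (@below_sub _ _ _ _ _ (image (U `&` [set u | R1 u u0]) V `|`
                              image U (V `&` [set v | R2 v v0]))).
  move=> _ [[u Uu [v Vv <-]] /= /opR[Ru|Rv]].
    by left; exists u => //; exists v.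
  by right; exists u => //; exists v.
apply: below_setU.
  elim: (height_below HU Uu0) IHa => a1 U1.
    by move=> U0 _; apply: below_empty => w [u /U0].
  move=> a' V1 V2 a'_lt HV1 _ IH VV IHa.
  apply: below_cover (oexp_lt_add2r b a'_lt) (IHa _ a'_lt _ _ _ HV1 HV) (IH IHa) _.
  by move=> _ [u /VV[] ? [v ? <-]]; [left|right]; exists u => //; exists v.
elim: (height_below HV Vv0) IHb => b1 U1.
  by move=> U0 _; apply: below_empty => w [u _ [v /U0]].
move=> b' V1 V2 b'_lt HV1 _ IH VV IHb.
apply: below_cover (oexp_lt_add2l a b'_lt) (IHb _ b'_lt _ _ HU HV1) (IH IHb) _.
by move=> _ [u ? [v /VV[] ? <-]]; [left|right]; exists u => //; exists v.
Qed.

Lemma height_lex (T : Type) (Rc Rf E : T -> T -> Prop) (W : ordinal_rep) :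
  (forall u, E u u) -> (forall v u, Rf v u -> Rc v u \/ E v u) ->
  forall (a b : omega_exp W) (U : set T), height Rc a U ->
  (forall u, U u -> height Rf b (U `&` [set v | E v u])) ->
  height Rf (oexp_add b a) U.
Proof.
move=> Exx RE a b; elim/(@ord_ind (omega_exp W)): a => a IH U HU Hcl.
constructor=> u Uu.
apply: (@below_sub _ _ _ _ _ ((U `&` [set v | Rc v u]) `|`
   (U `&` [set v | E v u] `&` [set v | Rf v u]))).
  move=> v [Uv /= Rvu]; have [Rcvu|Evu] := RE _ _ Rvu; first by left.
  by right.
apply: below_setU; last first.
  apply: below_le (oexp_le_addr b a) _.
  by apply: (height_below (Hcl _ Uu)); split.
suff below_lex V : below Rc a V -> below Rf (oexp_add b a) (U `&` V).
  by apply: below_sub (below_lex _ (height_below HU Uu)) => v [].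
move=> B; elim: B IH => {V}a1 V.
  by move=> V0 _; apply: below_empty => v [_ /V0].
move=> a' V1 V2 a'_lt HV1 _ IHB VV IH.
apply: (@below_cover _ _ _ _ _ (oexp_add b a') (U `&` V1) (U `&` V2)).
- exact: oexp_lt_add2l.
- apply: IH => //; first by apply: height_sub HV1 => v [].
  by move=> v [Uv _]; apply: height_sub (Hcl _ Uv) => w [[]].
- exact: IHB.
- by move=> v [Uv /VV[]]; [left|right].
Qed.

Section HeightEmbedding.
Variables (T : Type) (R : T -> T -> Prop) (W : ordinal_rep).
Hypothesis R_trans : forall v u w, R u v -> R v w -> R u w.
Implicit Types (U V : set T).

Definition embeds_below U (v : T) (z : omega_exp W) :=
  exists e : T -> omega_exp W, forall u, U u -> R u v -> ord_lt (e u) z /\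
    forall u', U u' -> R u' u -> ord_lt (e u') (e u).

Definition rank U (v : T) : omega_exp W :=
  if pselect (exists z, embeds_below U v z) is left e
  then projT1 (cid (@ord_min _ [set z | embeds_below U v z] e)) else oexp0 W.

Lemma rankP U v z : embeds_below U v z ->
  embeds_below U v (rank U v) /\ ord_le (rank U v) z.
Proof.
move=> ez; rewrite /rank; case: pselect => [e|[]]; last by exists z.
by case: cid => /= r [er rmin]; split=> //; apply: rmin.
Qed.

Lemma rank_lt U u v z : U u -> R u v -> embeds_below U v z ->
  ord_lt (rank U u) (rank U v).
Proof.
move=> Uu Ruv /rankP[[e eP] _]; have [euv emono] := eP _ Uu Ruv.
apply: ord_le_lt_trans euv; apply: (proj2 (rankP _)); exists e => w Uw Rwu.
split; first exact: emono.
by move=> w' Uw' Rw'; apply: (proj2 (eP _ Uw _)) => //; apply: R_trans Ruv.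
Qed.

Lemma rank_le U u v z : R u v -> embeds_below U v z ->
  ord_le (rank U u) (rank U v).
Proof.
move=> Ruv /rankP[[e eP] _]; apply: (proj2 (rankP _)); exists e => w Uw Rwu.
have Rwv := R_trans Rwu Ruv.
by split=> [|w' Uw' Rw']; have [? e'] := eP _ Uw Rwv => //; apply: e'.
Qed.

Definition ranking (g : W) V (s : T -> omega_exp W) :=
  [/\ forall v, ord_lt (s v) (oexp_pow g), forall u v, R u v -> ord_le (s u) (s v) &
      forall u v, V u -> R u v -> ord_lt (s u) (s v)].

Lemma below_ranking_step (g : W) V :
  (forall g' U, ord_lt g' g -> height R g' U ->
     forall v, exists z, embeds_below U v z /\ ord_lt z (oexp_pow g)) ->
  below R g V -> exists s, ranking g V s.
Proof.
move=> IH B; elim: B IH => {V}{}g V.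
  move=> V0 _; exists (fun=> oexp0 W); split=> [v||u v /V0//].
    exact: oexp_pow_gt0.
  by move=> *; exact: ord_refl.
move=> g' V1 V2 g'_lt HV1 _ IHB VV IH; have [s [sbd sle slt]] := IHB IH.
have /choice [z zP] : forall v, exists z, embeds_below V1 v z /\ ord_lt z (oexp_pow g).
  exact: IH g'_lt HV1.
exists (fun v => oexp_add (rank V1 v) (s v)); split.
- move=> v; apply: oexp_add_lt_pow => //; have [e zg] := zP v.
  exact: ord_le_lt_trans (proj2 (rankP e)) zg.
- move=> u v Ruv; apply: (@ord_trans _ (oexp_add (rank V1 u) (s v))).
    by apply: oexp_le_add2l; apply: sle.
  by apply: oexp_le_add2r; apply: rank_le Ruv (proj1 (zP v)).
- move=> u v /VV[V1u|V2u] Ruv.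
    apply: (@ord_le_lt_trans _ (oexp_add (rank V1 u) (s v))).
      by apply: oexp_le_add2l; apply: sle.
    by apply: oexp_lt_add2r; apply: rank_lt Ruv (proj1 (zP v)).
  apply: (@ord_lt_le_trans _ (oexp_add (rank V1 u) (s v))).
    by apply: oexp_lt_add2l; apply: slt.
  by apply: oexp_le_add2r; apply: rank_le Ruv (proj1 (zP v)).
Qed.

Lemma ranking_embeds (g : W) U u s :
  ranking g (U `&` [set v | R v u]) s ->
  embeds_below U u (s u).
Proof.
move=> [sbd sle slt]; exists s => v Uv Rvu; split; first exact: slt.
by move=> w Uw Rwv; apply: slt => //; split=> //=; apply: R_trans Rvu.
Qed.

Lemma height_embeds (g g0 : W) U : ord_lt g0 g -> height R g0 U -> forall v,
  exists z, embeds_below U v z /\ ord_lt z (oexp_pow g).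
Proof.
elim/ord_ind: g0 g U => g0 IH g U g0_lt HU v.
have below_ranked V : below R g0 V -> exists s, ranking g0 V s.
  apply: below_ranking_step => g' V' lt' H'; exact: (IH g' lt' g0 V' lt' H').
exists (oexp_pow g0); split; last exact: oexp_pow_mono.
have ex u : U u -> exists2 s, embeds_below U u (s u) & ord_lt (s u) (oexp_pow g0).
  move=> Uu; have [s rs] := below_ranked _ (height_below HU Uu).
  by exists s; [exact: ranking_embeds rs|case: rs].
exists (rank U) => u Uu _; have [s es bs] := ex _ Uu; split.
  exact: ord_le_lt_trans (proj2 (rankP es)) bs.
by move=> u' Uu' Ru'u; apply: rank_lt Ru'u es.
Qed.

Lemma below_ranking (g : W) V : below R g V -> exists s, ranking g V s.
Proof.
by apply: below_ranking_step => g' U g'_lt HU; apply: height_embeds g'_lt HU.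
Qed.

Lemma locally_height_embeds U :
  (forall u, U u -> exists g : W, below R g (U `&` [set v | R v u])) ->
  exists e : T -> omega_exp W, forall u v, U u -> U v -> R u v ->
    ord_lt (e u) (e v).
Proof.
move=> HU; exists (rank U) => u v Uu Uv Ruv.
have [g /below_ranking[s rs]] := HU _ Uv.
exact: rank_lt Ruv (ranking_embeds rs).
Qed.

Lemma height_minimal (g : W) U V : height R g U -> V `<=` U -> V !=set0 ->
  exists2 v, V v & forall w, V w -> ~ R w v.
Proof.
move=> HU VU [v0 Vv0].
have [|e emono] := @locally_height_embeds U.
  by move=> u Uu; exists g; apply: height_below.
have [|z [[v Vv <-] zmin]] := @ord_min _ (e @` V); first by exists (e v0), v0.
exists v => // w Vw Rwv; move/ord_ltNge: (emono _ _ (VU _ Vw) (VU _ Vv) Rwv).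
by apply; apply: zmin; exists w.
Qed.

End HeightEmbedding.

(** * Order types of subsets of well-ordered types *)

Lemma ordinal_le_homo (V W : ordinal_rep) (e : V -> W) :
  {homo e : x y / ord_lt x y >-> ord_lt x y} -> ordinal_le V W.
Proof.
move=> e_mono.
pose embeds_segment (x : V) (z : W) := exists f : V -> W, forall y, ord_lt y x ->
  ord_lt (f y) z /\ forall y', ord_lt y' y -> ord_lt (f y') (f y).
have /choice[phi phiP] (x : V) : exists z,
    embeds_segment x z /\ forall z', embeds_segment x z' -> ord_le z z'.
  have [|z [? ?]] := @ord_min W [set z | embeds_segment x z]; last by exists z.
  by exists (e x), e => y yx; split=> [|y']; exact: e_mono.
have phi_mono : {homo phi : x y / ord_lt x y >-> ord_lt x y}.
  move=> x y xy; have [[f fP] _] := phiP y; have [fx fmono] := fP _ xy.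
  apply: ord_le_lt_trans fx; apply: (proj2 (phiP x)); exists f => w wx.
  by split; [exact: fmono|have [_ ] := fP _ (ord_lt_trans wx xy)].
exists phi; split=> [x y|x w wx]; first exact: ord_homo_lt.
have [|y0 [y0P y0min]] := @ord_min V [set y | ord_le w (phi y)]; first by exists x.
exists y0; apply: ord_anti y0P; apply: (proj2 (phiP y0)); exists phi => y yy0.
split; last by move=> y'; exact: phi_mono.
by apply/ord_ltNge => /y0min; apply/ord_ltNge.
Qed.

Section OrderTypeLe.
Variables (T : Type) (lt : T -> T -> Prop) (A : set T) (W : ordinal_rep).
Hypothesis lt_total : forall x y, A x -> A y -> x = y \/ lt x y \/ lt y x.
Variable e : T -> W.
Hypothesis e_mono : forall x y, A x -> A y -> lt x y -> ord_lt (e x) (e y).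

Let leA : rel A := fun x y => `[< val x = val y \/ lt (val x) (val y) >].

Let A_val (x : A) : A (val x). Proof. exact: set_valP. Qed.

Let leA_e (x y : A) : leA x y <-> ord_le (e (val x)) (e (val y)).
Proof.
split=> [/asboolP[->|xy]|exy]; first exact: ord_refl.
  by apply/ord_le_eqVlt; right; apply: e_mono.
apply/asboolP; have [->|[xy|yx]] := lt_total (A_val x) (A_val y); [by left|by right|].
by move/ord_leNgt: exy; case; apply: e_mono.
Qed.

Lemma sub_well_order : wochoice.well_order leA.
Proof.
apply: wochoice.antisymmetric_well_order.
  move=> x y /andP[/leA_e xy /leA_e yx]; apply: val_inj.
  have exy := ord_anti xy yx.
  by have [//|[|]] := lt_total (A_val x) (A_val y) => /e_mono-/(_ (A_val _) (A_val _));
    rewrite exy => /ord_ltxx.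
move=> B [x0 Bx0].
have [|z [[x Bx <-] zmin]] := @ord_min W [set e (val x) | x in [set x | x \in B]].
  by exists (e (val x0)), x0.
by exists x; split=> // y yB; apply/leA_e; apply: zmin; exists y.
Qed.

Lemma order_type_le_homo : order_type_le lt A W.
Proof.
pose V := OrdinalRep sub_well_order.
have ltV (x y : V) : lt (val x) (val y) <-> ord_lt x y.
  split=> [xy|[/asboolP[/val_inj exy nxy|//]]]; last by case: nxy.
  split; first by apply/asboolP; right.
  by move=> exy; move: xy; rewrite exy => /(e_mono (A_val y) (A_val y)) /ord_ltxx.
exists V; first by exists id; first exact: (Bijective (g := id)).
apply: (@ordinal_le_homo V W (fun x => e (val x))) => x y /ltV.
exact: e_mono (A_val x) (A_val y).
Qed.

End OrderTypeLe.

(** * Orders of magnitude in an ordered field *)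

Section Magnitude.
Variable K : realFieldType.
Implicit Types (a b c d u v w : K) (U V : set K).

Definition isO d a := exists N : nat, `|a| <= N%:R * d.

Lemma isO0 d : isO d 0.
Proof. by exists 0%N; rewrite normr0 mul0r. Qed.

Lemma isOD d a b : isO d a -> isO d b -> isO d (a + b).
Proof.
move=> [N aN] [M bM]; exists (N + M)%N; rewrite natrD mulrDl.
exact: le_trans (ler_normD _ _) (lerD aN bM).
Qed.

Lemma isON d a : isO d (- a) <-> isO d a.
Proof. by split=> -[N]; rewrite ?normrN => aN; exists N; rewrite ?normrN. Qed.

Lemma isO_norm d a : isO d `|a| <-> isO d a.
Proof. by split=> -[N]; rewrite ?normr_id => aN; exists N; rewrite ?normr_id. Qed.

Lemma isOB d a b : isO d a -> isO d b -> isO d (a - b).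
Proof. by move=> aN bN; apply: isOD => //; apply/isON. Qed.

Lemma isO_id d : 0 <= d -> isO d d.
Proof. by move=> d0; exists 1%N; rewrite mul1r ger0_norm. Qed.

Lemma isO_norm_id a : isO `|a| a.
Proof. by exists 1%N; rewrite mul1r. Qed.

Lemma isO_le d a b : `|a| <= b -> isO d b -> isO d a.
Proof.
move=> ab [N bN]; exists N; apply: le_trans ab _; apply: le_trans bN.
exact: ler_norm.
Qed.

Lemma isO_trans b d a : isO b a -> isO d b -> isO d a.
Proof.
move=> [N aN] [M bM]; exists (N * M)%N; apply: le_trans aN _.
rewrite natrM -mulrA; apply: ler_wpM2l => //.
exact: le_trans (ler_norm _) bM.
Qed.

Lemma isOM c d a b : isO c a -> isO d b -> isO (c * d) (a * b).
Proof.
move=> [N aN] [M bM]; exists (N * M)%N.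
by rewrite normrM natrM mulrACA; apply: ler_pM.
Qed.

Lemma isO_mull c d a : 0 <= c -> isO d a -> isO (c * d) (c * a).
Proof. by move=> /isO_id; apply: isOM. Qed.

Lemma isO_mulr c d a : 0 <= c -> isO d a -> isO (d * c) (a * c).
Proof. by rewrite ![_ * c]mulrC; apply: isO_mull. Qed.

Lemma isO1_mull a b d : isO 1 a -> isO d b -> isO d (a * b).
Proof. by rewrite -{2}[d]mul1r; apply: isOM. Qed.

Definition lt_modO d u v := forall N : nat, N%:R * d < v - u.

Lemma Nlt_modO d u v : ~ lt_modO d u v -> exists N : nat, v - u <= N%:R * d.
Proof. by move=> /existsNP[N /negP]; rewrite -leNgt => ?; exists N. Qed.

Lemma lt_modO_lt d u v : lt_modO d u v -> u < v.
Proof. by move=> /(_ 0%N); rewrite mul0r subr_gt0. Qed.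

Lemma lt_modO0 u v : lt_modO 0 u v <-> u < v.
Proof. by split=> [/lt_modO_lt//|uv N]; rewrite mulr0 subr_gt0. Qed.

Lemma lt_modO_trans d v u w : lt_modO d u v -> lt_modO d v w -> lt_modO d u w.
Proof. by move=> uv /lt_modO_lt vw N; apply: lt_trans (uv N) _; rewrite ltrD2r. Qed.

Lemma isO_Nlt_modO d u v : isO d (v - u) -> ~ lt_modO d u v.
Proof.
move=> [N vu] /(_ N); rewrite ltNge => /negP; apply.
exact: le_trans (ler_norm _) vu.
Qed.

Lemma lt_modO_total d u v : 0 <= d -> lt_modO d u v \/ isO d (u - v) \/ lt_modO d v u.
Proof.
move=> d0; have [|/Nlt_modO[N vuN]] := pselect (lt_modO d u v); first by left.
have [|/Nlt_modO[M uvM]] := pselect (lt_modO d v u); first by right; right.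
right; left; exists (N + M)%N; rewrite ler_norml natrD mulrDl.
by have := mulr_ge0 (ler0n K N) d0; have := mulr_ge0 (ler0n K M) d0; lra.
Qed.

Lemma lt_modO_isO d u v u' v' : isO d (u - u') -> isO d (v - v') ->
  lt_modO d u v -> lt_modO d u' v'.
Proof.
move=> uu vv uv N; have [M ] := isOB uu vv; rewrite ler_norml => /andP[lo hi].
have := uv (N + M)%N; rewrite natrD mulrDl; lra.
Qed.

Lemma lt_modO0_trans v u w : lt_modO 0 u v -> lt_modO 0 v w -> lt_modO 0 u w.
Proof. exact: lt_modO_trans. Qed.

Definition arch_lt u v := forall N : nat, N%:R * u < v.

Lemma Narch_lt u v : ~ arch_lt u v -> exists N : nat, v <= N%:R * u.
Proof. by move=> /existsNP[N /negP]; rewrite -leNgt => ?; exists N. Qed.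

Lemma arch_lt_lt u v : arch_lt u v -> u < v.
Proof. by move=> /(_ 1%N); rewrite mul1r. Qed.

Lemma arch_lt_trans v u w : arch_lt u v -> arch_lt v w -> arch_lt u w.
Proof. by move=> uv /arch_lt_lt vw N; apply: lt_trans (uv N) vw. Qed.

(** ** Sums of sets *)

Definition sumset U V : set K := [set u + v | u in U & v in V].

Fact sumsetA : associative sumset.
Proof.
move=> U V Z; apply/seteqP; split=> [_ [u Uu [_ [v Vv [z Zz <-]] <-]]|].
  by exists (u + v); [exists u => //; exists v|exists z => //; rewrite addrA].
move=> _ [_ [u Uu [v Vv <-]] [z Zz <-]].
by exists u => //; exists (v + z); [exists v => //; exists z|rewrite addrA].
Qed.

Fact sumsetC : commutative sumset.
Proof.
move=> U V; apply/seteqP.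
by split=> _ [u Uu [v Vv <-]]; exists v => //; exists u => //; rewrite addrC.
Qed.

Fact sum0set : left_id [set 0] sumset.
Proof.
move=> U; apply/seteqP; split=> [_ [_ -> [u Uu <-]]|u Uu]; first by rewrite add0r.
by exists 0 => //; exists u => //; rewrite add0r.
Qed.

HB.instance Definition _ :=
  Monoid.isComLaw.Build (set K) [set 0] sumset sumsetA sumsetC sum0set.

Section BigSumset.
Variables (I : finType) (P : pred I) (F : I -> set K).

Lemma big_sumset0 :
  (forall i, P i -> F i 0) -> (\big[sumset/[set 0]]_(i | P i) F i) 0.
Proof.
move=> F0; elim/big_ind: _ => // U V U0 V0.
by exists 0 => //; exists 0 => //; rewrite addr0.
Qed.

Lemma big_sumsetD : (forall i, P i -> forall a b, F i a -> F i b -> F i (a + b)) ->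
  forall a b, (\big[sumset/[set 0]]_(i | P i) F i) a ->
  (\big[sumset/[set 0]]_(i | P i) F i) b ->
  (\big[sumset/[set 0]]_(i | P i) F i) (a + b).
Proof.
move=> FD; elim/big_ind: _ => [a b -> ->|U V UD VD a b|//]; first by rewrite addr0.
move=> [u Uu [v Vv <-]] [u' Uu' [v' Vv' <-]]; exists (u + u'); first exact: UD.
by exists (v + v'); [exact: VD|rewrite addrACA].
Qed.

Lemma sub_big_sumset i : P i -> (forall j, P j -> F j 0) ->
  F i `<=` \big[sumset/[set 0]]_(i | P i) F i.
Proof.
move=> Pi F0 u Fu; rewrite (bigD1 i)//=; exists u => //; exists 0; rewrite ?addr0//.
by elim/big_ind: _ => [//|U V U0 V0|j /andP[/F0]//]; exists 0 => //; exists 0;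
  rewrite ?addr0.
Qed.

End BigSumset.

Lemma height_sumset (W : ordinal_rep) d (a b : omega_exp W) U V : 0 <= d ->
  height (lt_modO d) a U -> height (lt_modO d) b V ->
  height (lt_modO d) (oexp_add a b) (sumset U V).
Proof.
move=> d0; apply: height_op => u u' v v' uv.
have [|/Nlt_modO[N uN]] := pselect (lt_modO d u u'); first by left.
right=> M; have := uv (N + M)%N; rewrite natrD mulrDl; lra.
Qed.

Inductive fsum (P : set K) : set K :=
| fsum0 : fsum P 0
| fsumD p s : P p -> fsum P s -> fsum P (p + s).

Lemma fsum_sub P P' : P `<=` P' -> fsum P `<=` fsum P'.
Proof. by move=> PP' s; elim=> [|p {}s /PP' Pp _]; [left|right]. Qed.

Lemma fsum1 (P : set K) p : P p -> fsum P p.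
Proof. by move=> Pp; rewrite -[p]addr0; right=> //; left. Qed.

Lemma fsum_add (P : set K) s t : fsum P s -> fsum P t -> fsum P (s + t).
Proof.
move=> Ps; elim: Ps t => [|p {}s Pp _ IH] t Pt; first by rewrite add0r.
by rewrite -addrA; right=> //; apply: IH.
Qed.

Lemma fsum_setU (P1 P2 P : set K) : P `<=` P1 `|` P2 ->
  fsum P `<=` sumset (fsum P1) (fsum P2).
Proof.
move=> PP s; elim=> [|p {}s /PP Pp _ [s1 f1 [s2 f2 <-]]].
  by exists 0; [left|exists 0; [left|rewrite addr0]].
case: Pp => Pp; last by exists s1 => //; exists (p + s2); [right|rewrite addrCA].
by exists (p + s1); [right|exists s2 => //; rewrite addrA].
Qed.

Lemma fsum_case (P Q : set K) :
  fsum P `<=` sumset (P `&` ~` Q) (fsum P) `|` fsum (P `&` Q).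
Proof.
move=> s; elim=> [|p {}s Pp Ps [[q Pq [t Pt <-]]|IH]]; first by right; left.
  by left; exists q => //; exists (p + t); [right|rewrite addrCA].
have [Qp|nQp] := pselect (Q p); first by right; right.
by left; exists p => //; exists s.
Qed.

Lemma isO_fsum d (P : set K) : (forall p, P p -> isO d p) ->
  forall s, fsum P s -> isO d s.
Proof. by move=> Pd s; elim=> [|p t /Pd dp _ dt]; [exact: isO0|exact: isOD]. Qed.

Lemma fsum_ge0 (P : set K) s : (forall p, P p -> 0 < p) -> fsum P s -> 0 <= s.
Proof. by move=> P0; elim=> // p {}s /P0/ltW p0 _ s0; apply: addr_ge0. Qed.

Lemma fsum_dominant (P : set K) s : (forall p, P p -> 0 < p) -> fsum P s ->
  s != 0 -> exists p (N : nat), [/\ P p, p <= s & s <= N%:R * p].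
Proof.
move=> P0; elim=> [|p {}s Pp fs IHs]; first by rewrite eqxx.
have p0 := P0 _ Pp; have s0 := fsum_ge0 P0 fs.
move=> _; have [->|/IHs[q [N [Pq qs sN]]]] := eqVneq s 0.
  by exists p, 1%N; rewrite addr0 mul1r.
have [pq|qp] := leP p q.
  exists q, N.+1; split=> //; first by lra.
  by rewrite -natr1 mulrDl mul1r addrC lerD.
exists p, N.+1; split=> //; first by lra.
rewrite -natr1 mulrDl mul1r addrC lerD//.
by apply: le_trans sN _; apply: ler_wpM2l => //; apply: ltW.
Qed.

Fixpoint nsum (P : set K) (k : nat) : set K :=
  if k is k'.+1 then sumset P (nsum P k') else [set 0].

Lemma fsum_nsum (P : set K) m s : 0 < m -> (forall p, P p -> m <= p) -> fsum P s ->
  exists2 k, nsum P k s & k%:R * m <= s.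
Proof.
move=> m0 mP; elim=> [|p {}s Pp _ [k ks kms]]; first by exists 0%N; rewrite ?mul0r.
exists k.+1; first by exists p => //; exists s.
by rewrite -natr1 mulrDl mul1r addrC; apply: lerD => //; apply: mP.
Qed.

Lemma height_nsum (W : ordinal_rep) (b : W) (a : omega_exp W) (P : set K) k :
  ord_lt a (oexp_pow b) -> height (lt_modO 0) a P ->
  exists2 g, ord_lt g (oexp_pow b) & height (lt_modO 0) g (nsum P k).
Proof.
move=> ab HP; elim: k => [|k [g gb Hg]].
  exists (oexp0 W); first exact: oexp_pow_gt0.
  by apply: height_set1 => /lt_modO0; rewrite ltxx.
by exists (oexp_add a g); [exact: oexp_add_lt_pow|exact: height_sumset].
Qed.

(** ** Well-ordered sets *)

Definition well_ordered U := forall V, V `<=` U -> V !=set0 ->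
  exists2 m, V m & forall v, V v -> m <= v.

Lemma well_ordered_sub U V : U `<=` V -> well_ordered V -> well_ordered U.
Proof. by move=> UV HV S SU; apply: HV; apply: subset_trans UV. Qed.

Lemma height_well_ordered (W : ordinal_rep) (g : W) U :
  height (lt_modO 0) g U -> well_ordered U.
Proof.
move=> HU V VU V0; have [m Vm mmin] := height_minimal lt_modO0_trans HU VU V0.
by exists m => // v /mmin/lt_modO0/negP; rewrite -leNgt.
Qed.

Lemma well_ordered_ind U (Q : K -> Prop) : well_ordered U ->
  (forall u, U u -> (forall v, U v -> v < u -> Q v) -> Q u) ->
  forall u, U u -> Q u.
Proof.
move=> HU IH u Uu; apply: contrapT => nQu.
have [||m [Um nQm] mmin] := HU (U `&` [set u | ~ Q u]); first by move=> v [].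
  by exists u.
apply: nQm; apply: IH => // v Uv vm; apply: contrapT => nQv.
by have := mmin v (conj Uv nQv); rewrite leNgt vm.
Qed.

Lemma well_ordered_class_min c U u : well_ordered U -> U u ->
  exists m, [/\ U m, isO c (m - u) & forall v, U v -> isO c (v - u) -> m <= v].
Proof.
move=> HU Uu.
have [||m [Um mu] mmin] := HU (U `&` [set v | isO c (v - u)]).
- by move=> v [].
- by exists u; split=> //=; rewrite subrr; apply: isO0.
- by exists m; split=> // v Uv vu; apply: mmin.
Qed.

Definition pair_cover c U V g (B : set K) (L : seq (K * K)) :=
  (forall p, p \in L -> [/\ U p.1, V p.2 & isO c (g - (p.1 + p.2))]) /\
  forall u v, U u -> V v -> B v -> isO c (g - (u + v)) ->
    exists2 p, p \in L & isO c (u - p.1) /\ isO c (v - p.2).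

(* The pair with the least first entry accounts for all pairs whose first entry
   is in the same class; the other ones have a smaller second entry. *)
Lemma pair_cover_step c U V g B : well_ordered U ->
  (forall v1, V v1 -> B v1 -> exists L, pair_cover c U V g [set v | v < v1] L) ->
  exists L, pair_cover c U V g B L.
Proof.
move=> HU IH.
pose S := [set u | U u /\ exists v, [/\ V v, B v & isO c (g - (u + v))]].
have [S0|nS] := pselect (S !=set0); last first.
  by exists [::]; split=> // u v Uu Vv Bv uv; case: nS; exists u; split=> //; exists v.
have [|u1 [Uu1 [v1 [Vv1 Bv1 uv1]]] u1min] := HU S _ S0; first by move=> u [].
have [L [LP Lcov]] := IH _ Vv1 Bv1; exists ((u1, v1) :: L); split.
  by move=> p; rewrite in_cons => /orP[/eqP->//|/LP].
move=> u v Uu Vv Bv uv; have u1u : u1 <= u by apply: u1min; split=> //; exists v.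
have [uu1|nuu1] := pselect (isO c (u - u1)).
  exists (u1, v1); first by rewrite mem_head.
  split=> //=; rewrite (_ : v - v1 = (g - (u1 + v1)) - (g - (u + v)) - (u - u1)).
    by apply: isOB => //; apply: isOB.
  by ring.
have [|p pL pP] := Lcov u v Uu Vv _ uv; last first.
  by exists p => //; rewrite in_cons pL orbT.
rewrite /= ltNge; apply/negP => v1v; apply: nuu1.
apply: (@isO_le _ _ ((g - (u1 + v1)) - (g - (u + v)))); last exact: isOB.
by rewrite ger0_norm ?subr_ge0//; lra.
Qed.

Lemma well_ordered_pair_cover c U V : well_ordered U -> well_ordered V ->
  forall g, exists L, pair_cover c U V g setT L.
Proof.
move=> HU HV g; apply: (pair_cover_step HU) => v1 Vv1 _.
apply: (@well_ordered_ind _ (fun v1 => exists L, pair_cover c U V g _ L) HV) Vv1.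
by move=> v Vv IH; apply: (pair_cover_step HU) => v2 Vv2 /= v2v; apply: IH.
Qed.

(** ** Finite sums of positive elements *)

Section HeightFsum.
Variables (W : ordinal_rep) (g one : omega_exp W).
Hypothesis one_gt0 : ord_lt (oexp0 W) one.
Implicit Types P Q : set K.
Let top (a : omega_exp W) := oexp_add (oexp_add g one) a.

Lemma fsum_arch_split P p1 (N : nat) : (forall p, P p -> 0 < p) ->
  well_ordered P -> P p1 ->
  exists M : nat, forall t, fsum P t -> t < N%:R * p1 -> exists2 k, (k < M)%N &
    sumset (nsum (P `&` [set p | ~ arch_lt p p1]) k)
           (fsum (P `&` [set p | arch_lt p p1])) t.
Proof.
move=> P0 HP Pp1; set Peq := P `&` [set p | ~ _]; set Plt := P `&` _.
have [||m [Pm /Narch_lt[M p1M]] mmin] := HP Peq.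
- by move=> p [].
- by exists p1; split=> // /arch_lt_lt; rewrite ltxx.
have m0 := P0 _ Pm; exists (N * M)%N => t Pt tN.
have [|t1 f1 [t2 f2 tE]] := fsum_setU (P1 := Peq) (P2 := Plt) _ Pt.
  by move=> p Pp; have [|] := pselect (arch_lt p p1); [right|left].
have [k kt1 kt] := fsum_nsum m0 mmin f1; exists k; last by exists t1 => //; exists t2.
have t20 : 0 <= t2 by apply: fsum_ge0 f2 => p [/P0].
rewrite -(ltr_nat K) -(ltr_pM2r m0) natrM -mulrA.
apply: (@le_lt_trans _ _ t); first by rewrite -tE; lra.
by apply: lt_le_trans tN _; apply: ler_wpM2l.
Qed.

Lemma height_fsum_below (a : omega_exp W) P V :
  (forall (a' : omega_exp W) Q, ord_lt a' a -> Q `<=` P -> height arch_lt a' Q ->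
    height (lt_modO 0) (oexp_pow (top a')) (fsum Q)) ->
  below arch_lt a V ->
  exists2 h, ord_lt h (oexp_pow (top a)) & height (lt_modO 0) h (fsum (P `&` V)).
Proof.
rewrite /top => + B; elim: B => {V}a1 V.
  move=> V0 _; exists (oexp0 _); first exact: oexp_pow_gt0.
  have f0 t : fsum (P `&` V) t -> t = 0 by elim=> // p ? [_ /V0].
  apply: (@height_sub _ _ _ _ _ [set 0]) => [t /f0//|].
  by apply: height_set1 => /lt_modO0; rewrite ltxx.
move=> a' V1 V2 a'_lt HV1 _ IHB VV IH; have [h2 h2_lt HfV2] := IHB IH.
exists (oexp_add (oexp_pow (oexp_add (oexp_add g one) a')) h2).
  by apply: oexp_add_lt_pow => //; apply/oexp_pow_mono/oexp_lt_add2l.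
have HfV1 : height (lt_modO 0) (oexp_pow (oexp_add (oexp_add g one) a'))
    (fsum (P `&` V1)).
  by apply: IH => //; apply: height_sub HV1 => p [].
apply: height_sub (height_sumset (lexx 0) HfV1 HfV2).
by apply: fsum_setU => p [Pp /VV[]]; [left|right].
Qed.

(* A sum of elements of [P] that stays below a given bound has boundedly many
   summands of the dominant archimedean class, and the other summands are in
   lower classes. *)
Lemma height_fsum (a : omega_exp W) P : (forall p, P p -> 0 < p) ->
  height (lt_modO 0) (oexp_pow g) P -> height arch_lt a P ->
  height (lt_modO 0) (oexp_pow (oexp_add (oexp_add g one) a)) (fsum P).
Proof.
elim/(@ord_ind (omega_exp W)): a P => a IH P P0 HP HA; rewrite -/(top a).
have g_top : ord_lt g (top a).
  apply: ord_lt_le_trans (oexp_le_addr _ _).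
  by rewrite -{1}(oexp_add0 g); apply: oexp_lt_add2l.
constructor=> s Ps; have [->|s_neq0] := eqVneq s 0.
  apply: below_empty => t [Pt /lt_modO0]; rewrite ltNge => /negP; apply.
  exact: fsum_ge0 Pt.
have [p1 [N [Pp1 _ sN]]] := fsum_dominant P0 Ps s_neq0.
have [M split_t] := fsum_arch_split N P0 (height_well_ordered HP) Pp1.
pose Peq := P `&` [set p | ~ arch_lt p p1].
pose Plt := P `&` [set p | arch_lt p p1].
apply: (@below_sub _ _ _ _ _ [set t | exists2 k, (k < M)%N &
    sumset (nsum Peq k) (fsum Plt) t]).
  by move=> t [Pt /lt_modO0 ts]; apply: split_t => //; apply: lt_le_trans sN.
apply: below_bigcup => k _.
have [hk hk_lt Hk] : exists2 h, ord_lt h (oexp_pow (top a)) &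
    height (lt_modO 0) h (nsum Peq k).
  by apply: height_nsum (oexp_pow_mono g_top) _; apply: height_sub HP => p [].
have [|hl hl_lt Hl] := @height_fsum_below a P _ _ (height_below HA Pp1).
  move=> a' Q a'_lt QP; apply: IH => //; first by move=> p /QP/P0.
  exact: height_sub HP.
apply: height_lt_below (oexp_add_lt_pow hk_lt hl_lt) (height_sumset _ Hk _) => //.
by apply: height_sub Hl; apply: fsum_sub => p [? ?]; split.
Qed.

End HeightFsum.

(** ** Splitting a class into finitely many smaller ones *)

Definition splits_at d e U g := exists L : seq K, forall v, U v -> v <= g ->
  isO e (g - v) -> exists2 l, l \in L & isO d (v - l).

Definition splits d e U := forall g, splits_at d e U g.

Lemma splits_at_sub d e U V g : U `<=` V -> splits_at d e V g -> splits_at d e U g.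
Proof. by move=> UV [L LP]; exists L => v /UV; apply: LP. Qed.

Lemma splits_sub d e U V : U `<=` V -> splits d e V -> splits d e U.
Proof. by move=> UV sV g; apply: splits_at_sub (sV g). Qed.

Lemma splits_at_nonempty d e U g :
  (forall u, U u -> u <= g -> isO e (g - u) -> splits_at d e U g) ->
  splits_at d e U g.
Proof.
move=> sU; have [[u [Uu ug gu]]|no_u] :=
  pselect (exists u, [/\ U u, u <= g & isO e (g - u)]); first exact: sU gu.
by exists [::] => u Uu ug gu; case: no_u; exists u.
Qed.

Lemma splits_at_isO d e U g a :
  (forall u, U u -> u <= g -> isO e (g - u) -> isO d (u - a)) -> splits_at d e U g.
Proof. by move=> Ua; exists [:: a] => u *; exists a; [exact: mem_head|exact: Ua]. Qed.

Lemma splits_set1 d e a : splits d e [set a].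
Proof.
move=> g; apply: (@splits_at_isO _ _ _ _ a) => _ -> _ _; rewrite subrr.
exact: isO0.
Qed.

Lemma splits_at_setU d e U V g :
  splits_at d e U g -> splits_at d e V g -> splits_at d e (U `|` V) g.
Proof.
move=> [L LP] [L' LP']; exists (L ++ L') => u [/LP|/LP'] u_split /u_split{}u_split;
  by move=> /u_split[l lL ul]; exists l; rewrite // mem_cat lL ?orbT.
Qed.

Lemma splits_at_sumset_class d e U V g p q : well_ordered U -> well_ordered V ->
  U p -> V q -> isO e (g - (p + q)) ->
  (forall v, V v -> isO e (g - (p + v)) -> splits_at d e U (g - v)) ->
  (forall u, U u -> isO e (g - (u + q)) -> splits_at d e V (g - u)) ->
  exists L : seq K, forall u v, U u -> V v -> u + v <= g -> isO e (g - (u + v)) ->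
    isO e (u - p) -> isO e (v - q) -> exists2 l, l \in L & isO d (u + v - l).
Proof.
move=> HU HV Up Vq gpq sU sV.
have [um [Uum um_p um_min]] := well_ordered_class_min e HU Up.
have [vm [Vvm vm_q vm_min]] := well_ordered_class_min e HV Vq.
have [|LU LUP] := sU _ Vvm.
  by rewrite (_ : _ - _ = (g - (p + q)) - (vm - q)); [apply: isOB|ring].
have [|LV LVP] := sV _ Uum.
  by rewrite (_ : _ - _ = (g - (p + q)) - (um - p)); [apply: isOB|ring].
exists [seq x + y | x <- LU, y <- LV] => u v Uu Vv uvg guv up vq.
have um_u := um_min _ Uu up; have vm_v := vm_min _ Vv vq.
have [||x xL ux] := LUP u Uu; first by lra.
  rewrite (_ : _ - u = (g - (u + v)) + ((v - q) - (vm - q))); last by ring.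
  by apply: isOD => //; apply: isOB.
have [||y yL vy] := LVP v Vv; first by lra.
  rewrite (_ : _ - v = (g - (u + v)) + ((u - p) - (um - p))); last by ring.
  by apply: isOD => //; apply: isOB.
exists (x + y); first by apply/allpairsP; exists (x, y).
by rewrite (_ : _ - _ = (u - x) + (v - y)); [apply: isOD|ring].
Qed.

Lemma splits_at_sumset d e U V g : well_ordered U -> well_ordered V ->
  (forall u v, U u -> V v -> isO e (g - (u + v)) -> splits_at d e U (g - v)) ->
  (forall u v, U u -> V v -> isO e (g - (u + v)) -> splits_at d e V (g - u)) ->
  splits_at d e (sumset U V) g.
Proof.
move=> HU HV sU sV; have [Lp [LpP Lcov]] := well_ordered_pair_cover e HU HV g.
have /choice[L LP] : forall p : K * K, exists L : seq K, p \in Lp ->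
    forall u v, U u -> V v -> u + v <= g -> isO e (g - (u + v)) ->
    isO e (u - p.1) -> isO e (v - p.2) -> exists2 l, l \in L & isO d (u + v - l).
  move=> p; have [/LpP[Up Vp gp]|] := boolP (p \in Lp); last by exists [::].
  have [v Vv gv|u Uu gu|L] := splits_at_sumset_class HU HV Up Vp gp (d := d).
  - exact: sU gv.
  - exact: sV gu.
  - by exists L.
exists (flatten [seq L p | p <- Lp]) => _ [u Uu [v Vv <-]] uvg guv.
have [p pL [up vp]] := Lcov _ _ Uu Vv I guv.
have [l lL uvl] := LP p pL u v Uu Vv uvg guv up vp; exists l => //.
by apply/flattenP; exists (L p) => //; apply: map_f.
Qed.

Lemma splits_sumset d e U V : well_ordered U -> well_ordered V ->
  splits d e U -> splits d e V -> splits d e (sumset U V).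
Proof. by move=> HU HV sU sV g; apply: splits_at_sumset. Qed.

Section SplitsFsum.
Variables (d e : K) (P : set K).
Hypotheses (e_gt0 : 0 < e) (P_gt0 : forall p, P p -> 0 < p).
Hypothesis gap : forall p, P p -> isO d p \/ isO p e.
Hypothesis P_splits : splits d e P.

Lemma gap_lower_bound : well_ordered P ->
  exists M : nat, forall p, P p -> ~ isO d p -> e <= M%:R * p.
Proof.
move=> HP; have [P_big|no_p] := pselect ((P `&` [set p | ~ isO d p]) !=set0).
  have [|m [Pm ndm] mmin] := HP _ _ P_big; first by move=> p [].
  case: (gap Pm) => // -[M]; rewrite (gtr0_norm e_gt0) => mM; exists M => p Pp ndp.
  by apply: le_trans mM _; apply: ler_wpM2l => //; apply: mmin.
by exists 0%N => p Pp ndp; case: no_p; exists p.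
Qed.

Lemma splits_at_fsum_small g : well_ordered P -> isO e g ->
  splits_at d e (fsum (P `&` [set p | isO e p])) g.
Proof.
move=> /gap_lower_bound[M eM] eg; set Q := P `&` _; have [N gN] := eg.
suff splits_below k : exists L : seq K, forall s,
    fsum Q s -> s <= g -> M%:R * s < k%:R * e ->
    exists2 l, l \in L & isO d (s - l).
  have [L LP] := splits_below (M * N).+1; exists L => s Qs sg _; apply: LP => //.
  apply: (@le_lt_trans _ _ ((M * N)%:R * e)); last by rewrite ltr_pM2r// ltr_nat.
  rewrite natrM -mulrA; apply: ler_wpM2l => //; apply: le_trans sg _.
  exact: le_trans (ler_norm _) gN.
have Q_ge0 s : fsum Q s -> 0 <= s by apply: fsum_ge0 => p [/P_gt0].
elim: k => [|k [L LP]].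
  exists [::] => s Qs _; rewrite mul0r ltNge => /negP[].
  by rewrite mulr_ge0// Q_ge0.
have [L1 L1P] := P_splits g; exists (0 :: [seq x + y | x <- L1, y <- L]) => s Qs sg sk.
have [[p [[Pp ep] ndp] [t Qt stE]]|sd] := fsum_case [set p | isO d p] Qs; last first.
  by exists 0; rewrite ?mem_head// subr0; apply: isO_fsum sd => p [].
have p0 := P_gt0 Pp; have t0 := Q_ge0 _ Qt; have ep' := eM _ Pp ndp.
rewrite -stE in sg sk *; have [||x xL px] := L1P _ Pp; [lra|exact: isOB|].
have [||y yL ty] := LP _ Qt; first by lra.
  by move: sk; rewrite -natr1 mulrDl mul1r mulrDr; lra.
exists (x + y); last by rewrite (_ : _ - _ = (p - x) + (t - y)); [apply: isOD|ring].
by rewrite in_cons; apply/orP; right; apply/allpairsP; exists (x, y).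
Qed.

Lemma splits_fsum : well_ordered (fsum P) -> splits d e (fsum P).
Proof.
move=> HF; have HP : well_ordered P by apply: well_ordered_sub HF => p; apply: fsum1.
have splits_near s : fsum P s -> forall g, isO e (g - s) -> splits_at d e (fsum P) g.
  apply: (@well_ordered_ind _ (fun s => forall g, isO e (g - s) -> _) HF).
  move=> {}s Ps IH g gs; apply: splits_at_sub (fsum_case [set p | isO e p]) _.
  apply: splits_at_setU; last first.
    have [eg|neg] := pselect (isO e g); first exact: splits_at_fsum_small.
    apply: splits_at_nonempty => t Pt _ gt; case: neg.
    by rewrite -(subrK t g); apply: isOD => //; apply: isO_fsum Pt => p [].
  apply: splits_at_sumset => // [|u v _ _ _|u v [Pu nu] Pv guv].
  - by apply: well_ordered_sub HP => p [].
  - by apply: splits_at_sub (P_splits (g - v)) => p [].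
  - apply: (IH v) => //; last by rewrite -addrA -opprD.
    rewrite ltNge; apply/negP => sv; apply: nu.
    apply: (@isO_le _ _ ((g - s) - (g - (u + v)))); last exact: isOB.
    by rewrite gtr0_norm ?P_gt0//; lra.
by move=> g; apply: splits_at_nonempty => s Ps _; apply: splits_near.
Qed.

End SplitsFsum.

Lemma height_splits (W : ordinal_rep) (a one : omega_exp W) d e U :
  0 <= e -> ord_lt (oexp0 W) one -> splits d e U ->
  height (lt_modO e) a U -> height (lt_modO d) (oexp_add one a) U.
Proof.
move=> e0 one_gt0 sU HU.
apply: (@height_lex _ (lt_modO e) (lt_modO d) (fun v u => isO e (v - u))) => //.
- by move=> u; rewrite subrr; apply: isO0.
- move=> v u /lt_modO_lt vu; have [?|[?|/lt_modO_lt]] := lt_modO_total v u e0.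
  + by left.
  + by right.
  + by rewrite ltNge (ltW vu).
move=> u0 Uu0; constructor=> u [Uu /= uu0]; have [L LP] := sU u.
have covered : (U `&` [set v | isO e (v - u0)] `&` [set v | lt_modO d v u]) `<=`
    [set v | exists2 l, l \in L & isO d (v - l)].
  move=> v [[Uv vu0] /lt_modO_lt vu]; apply: LP => //; first exact: ltW.
  by rewrite (_ : u - v = (u - u0) - (v - u0)); [apply: isOB|ring].
apply: below_sub covered _.
elim: L {LP} => [|l L IH]; first by apply: below_empty => v [].
apply: (@below_cover _ _ _ _ _ (oexp0 W) [set v | isO d (v - l)]
  [set v | exists2 l, l \in L & isO d (v - l)]) => //.
  constructor=> v vl; apply: below_empty => w [wl /= wv].
  apply: isO_Nlt_modO wv; rewrite (_ : v - w = (v - l) - (w - l)); last by ring.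
  exact: isOB.
move=> v [l']; rewrite in_cons => /orP[/eqP->|l'L] vl'; first by left.
by right; exists l'.
Qed.

End Magnitude.

(** * Exponential ordered fields with an infinite element *)

Record exp_field := ExpField {
  ef_field :> realFieldType;
  ef_exp : ef_field -> ef_field;
  ef_ln : ef_field -> ef_field;
  ef_X : ef_field;
  ef_exp_gt0 : forall a, 0 < ef_exp a;
  ef_expD : forall a b, ef_exp (a + b) = ef_exp a * ef_exp b;
  ef_exp_ge : forall a, 1 + a <= ef_exp a;
  ef_expK : forall a, ef_ln (ef_exp a) = a;
  ef_lnK : forall a, 0 < a -> ef_exp (ef_ln a) = a;
  ef_X_gt_nat : forall n : nat, n%:R < ef_X }.

Section ExpField.
Variable K : exp_field.
Implicit Types (a b d f g h p q s u v : K) (c j k m n : nat).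
Local Notation X := (ef_X K).
Local Notation exp := (@ef_exp K).
Local Notation ln := (@ef_ln K).
Local Notation isO := (@isO K).

Lemma ef_exp0 : exp 0 = 1.
Proof.
by apply: (mulfI (lt0r_neq0 (ef_exp_gt0 (0 : K)))); rewrite -ef_expD addr0 mulr1.
Qed.

Lemma ef_expN a : exp (- a) = (exp a)^-1.
Proof.
apply: (mulfI (lt0r_neq0 (ef_exp_gt0 a))).
by rewrite -ef_expD subrr ef_exp0 divff// lt0r_neq0// ef_exp_gt0.
Qed.

Lemma ef_exp_lt a b : (exp a < exp b) = (a < b).
Proof.
suff exp_homo x y : x < y -> exp x < exp y.
  apply/idP/idP; last exact: exp_homo.
  by apply: contraTT; rewrite -!leNgt le_eqVlt => /orP[/eqP->//|/exp_homo/ltW].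
move=> xy; rewrite -(subrK x y) addrC ef_expD -[ltLHS]mulr1 ltr_pM2l ?ef_exp_gt0//.
by apply: lt_le_trans (ef_exp_ge _); rewrite ltrDl subr_gt0.
Qed.

Lemma ef_exp_le a b : (exp a <= exp b) = (a <= b).
Proof. by rewrite !leNgt ef_exp_lt. Qed.

Lemma ef_ln_lt a b : 0 < a -> 0 < b -> (ln a < ln b) = (a < b).
Proof. by move=> a0 b0; rewrite -ef_exp_lt !ef_lnK. Qed.

Lemma ef_ln_le a b : 0 < a -> 0 < b -> (ln a <= ln b) = (a <= b).
Proof. by move=> a0 b0; rewrite -ef_exp_le !ef_lnK. Qed.

Lemma ef_lnM a b : 0 < a -> 0 < b -> ln (a * b) = ln a + ln b.
Proof. by move=> a0 b0; rewrite -[RHS]ef_expK ef_expD !ef_lnK. Qed.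

Lemma ef_ln1 : ln 1 = 0. Proof. by rewrite -ef_exp0 ef_expK. Qed.

Lemma ef_lnV a : 0 < a -> ln a^-1 = - ln a.
Proof. by move=> a0; rewrite -[RHS]ef_expK ef_expN ef_lnK. Qed.

Lemma ef_ln_div a b : 0 < a -> 0 < b -> ln (a / b) = ln a - ln b.
Proof. by move=> a0 b0; rewrite ef_lnM ?invr_gt0// ef_lnV. Qed.

Lemma ef_ln_ge0 a : 1 <= a -> 0 <= ln a.
Proof.
by move=> a1; rewrite -ef_ln1 ef_ln_le//; apply: lt_le_trans a1; exact: ltr01.
Qed.

Lemma ef_ln_leB1 a : 0 < a -> ln a <= a - 1.
Proof. by move=> a0; have := ef_exp_ge (ln a); rewrite ef_lnK//; lra. Qed.

Lemma ef_ln_geBV a : 0 < a -> 1 - a^-1 <= ln a.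
Proof.
by move=> a0; have := @ef_ln_leB1 a^-1; rewrite invr_gt0 ef_lnV// => /(_ a0); lra.
Qed.

Lemma ef_exp_nat n a : exp (n%:R * a) = exp a ^+ n.
Proof.
elim: n => [|n IH]; first by rewrite mul0r ef_exp0.
by rewrite -natr1 mulrDl mul1r addrC ef_expD IH exprS.
Qed.

Lemma ef_ln_exprn n a : 0 < a -> ln (a ^+ n) = n%:R * ln a.
Proof. by move=> a0; rewrite -[RHS]ef_expK ef_exp_nat ef_lnK. Qed.

Lemma ef_X_gt0 : 0 < X. Proof. exact: (ef_X_gt_nat K 0). Qed.
Lemma ef_X_ge1 : 1 <= X. Proof. exact: ltW (ef_X_gt_nat K 1). Qed.
Hint Resolve ef_X_gt0 ef_X_ge1 : core.

Lemma ef_X_ge_nat n : n%:R <= X. Proof. exact/ltW/ef_X_gt_nat. Qed.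

Lemma ef_ln2_ge : 2^-1 <= ln 2.
Proof. by have := @ef_ln_geBV 2 ltac:(lra); lra. Qed.

Lemma ef_ln2_le1 : ln 2 <= 1.
Proof. by have := @ef_ln_leB1 2 ltac:(lra); lra. Qed.

Lemma ef_exp_nat_le n : exp n%:R <= (4 ^ n)%:R.
Proof.
have exp_half : exp 2^-1 <= 2 by rewrite -[leRHS]ef_lnK// ef_exp_le ef_ln2_ge.
rewrite -[n%:R]mulr1 ef_exp_nat natrX; apply: lerXn2r; rewrite ?nnegrE//.
  exact/ltW/ef_exp_gt0.
rewrite [X in exp X](_ : _ = 2^-1 + 2^-1); last by lra.
have := ef_exp_gt0 (2^-1 : K); rewrite ef_expD; nra.
Qed.

Lemma ef_lnX_gt_nat n : n%:R < ln X.
Proof.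
rewrite -ef_exp_lt ef_lnK//; apply: le_lt_trans (ef_exp_nat_le n) _; exact: ef_X_gt_nat.
Qed.

Lemma ef_lnX_gt0 : 0 < ln X. Proof. exact: (ef_lnX_gt_nat 0). Qed.
Hint Resolve ef_lnX_gt0 : core.

Lemma ef_lnX_le_X n : n%:R * ln X <= X.
Proof.
rewrite -ef_exp_le ef_exp_nat ef_lnK//.
pose r : K := n.+1%:R; have r0 : 0 < r by rewrite ltr0n.
rewrite -[X in leRHS](divfK (lt0r_neq0 r0)) [X in ef_exp X]mulrC ef_exp_nat.
apply: (@le_trans _ _ ((X / r) ^+ n.+1)); last first.
  apply: lerXn2r; rewrite ?nnegrE ?(ltW (ef_exp_gt0 _))//.
    by rewrite divr_ge0// ltW.
  by apply: le_trans (ef_exp_ge _); rewrite lerDr.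
rewrite expr_div_n exprSr -mulrA ler_peMr ?exprn_ge0 ?(ltW ef_X_gt0)//.
by rewrite ler_pdivlMr ?exprn_gt0// mul1r -natrX ef_X_ge_nat.
Qed.

Lemma ef_lnX_lt_X n : n%:R * ln X < X.
Proof.
have := ef_lnX_le_X n.+1; rewrite -natr1 mulrDl mul1r.
by have := ef_lnX_gt0; lra.
Qed.

Lemma ef_expB1_le a : exp a - 1 <= a * exp a.
Proof.
have expNa := ef_exp_ge (- a); have expM : exp a * exp (- a) = 1.
  by rewrite -ef_expD subrr ef_exp0.
have := ef_exp_gt0 a; nra.
Qed.

Lemma ef_expB1_norm a : `|exp a - 1| <= `|a| * (1 + exp a).
Proof.
have exp_ge := ef_exp_ge a; have expB1_le := ef_expB1_le a.
have exp_gt0 := ef_exp_gt0 a; have := normr_ge0 a.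
rewrite ler_norml; have [a0|a0] := ger0P a => norm_ge0; apply/andP; split; nra.
Qed.

Lemma isO1_exp a : isO 1 a -> isO 1 (exp a).
Proof.
move=> [N]; rewrite mulr1 => aN; exists (4 ^ N)%N; rewrite mulr1.
rewrite ger0_norm ?(ltW (ef_exp_gt0 _))//; apply: le_trans (ef_exp_nat_le N).
by rewrite ef_exp_le; apply: le_trans (ler_norm _) aN.
Qed.

Lemma isO_expB1 d a : isO 1 a -> isO d a -> isO d (exp a - 1).
Proof.
move=> a1 [N aN].
have [M expM] : isO 1 (1 + exp a) by apply: isOD (isO1_exp a1); apply: isO_id.
exists (N * M)%N; apply: le_trans (ef_expB1_norm a) _.
rewrite natrM mulrAC; have exp_gt0 := ef_exp_gt0 a.
by move: expM; rewrite mulr1 gtr0_norm; [move=> expM; apply: ler_pM => //; lra|lra].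
Qed.

Lemma isO_exp_sub d p a : 0 < p -> isO 1 (a - ln p) -> isO d (a - ln p) ->
  isO (p * d) (exp a - p).
Proof.
move=> p0 a1 ad.
have -> : exp a - p = p * (exp (a - ln p) - 1).
  by rewrite ef_expD ef_expN ef_lnK// mulrBr mulr1 mulrCA divff ?mulr1// lt0r_neq0.
by apply: isO_mull (isO_expB1 a1 ad); exact: ltW.
Qed.

Lemma isO_ln_sub d p q : 0 < p -> 0 < q -> isO q p -> isO (p * d) (p - q) ->
  isO d (ln p - ln q).
Proof.
move=> p0 q0 [N pN] [M pqM].
have ln_le a b : 0 < a -> 0 < b -> ln a - ln b <= `|p - q| / b ->
    ln a - ln b <= M%:R * d * (p / b).
  move=> a0 b0 /le_trans; apply.
  rewrite (_ : M%:R * d * (p / b) = M%:R * (p * d) / b); last by ring.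
  by rewrite ler_pM2r ?invr_gt0.
have Md : 0 <= M%:R * d.
  by rewrite -(pmulr_rge0 _ p0) mulrCA; apply: le_trans pqM.
have pq : p / q <= N%:R by rewrite ler_pdivrMr//; apply: le_trans (ler_norm p) pN.
have ln_div_le a b : 0 < a -> 0 < b -> `|a - b| = `|p - q| ->
    ln a - ln b <= `|p - q| / b.
  move=> a0 b0 <-; rewrite -ef_ln_div//; apply: le_trans (ef_ln_leB1 _) _.
    exact: divr_gt0.
  rewrite -[1](divff (lt0r_neq0 b0)) -mulrBl ler_pM2r ?invr_gt0//; exact: ler_norm.
exists (M * N.+1)%N; rewrite natrM -natr1 mulrAC ler_norml.
have lnB_pq := ln_le p q p0 q0 (ln_div_le p q p0 q0 erefl).
have lnB_qp := ln_le q p q0 p0 (ln_div_le q p q0 p0 (distrC q p)).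
rewrite divff ?lt0r_neq0// mulr1 in lnB_qp.
have MdN := ler_wpM2l Md pq; have MdN0 := mulr_ge0 Md (ler0n K N).
by apply/andP; split; lra.
Qed.

End ExpField.

(** * Skolem elements *)

Section SkolemElements.
Variable K : exp_field.
Implicit Types (a b d f g h p q r s t u v : K) (c j k m n : nat).
Local Notation X := (ef_X K).
Local Notation exp := (@ef_exp K).
Local Notation ln := (@ef_ln K).
Local Notation isO := (@isO K).
Local Notation sumset := (@sumset K).

Let X_gt0 : 0 < X. Proof. exact: ef_X_gt0. Qed.
Let X_ge1 : 1 <= X. Proof. exact: ef_X_ge1. Qed.
Let lnX_gt0 : 0 < ln X. Proof. exact: ef_lnX_gt0. Qed.
Hint Resolve X_gt0 X_ge1 lnX_gt0 : core.

Inductive skolem_elt : set K :=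
| skolem_elt_one : skolem_elt 1
| skolem_elt_X : skolem_elt X
| skolem_elt_add f g : skolem_elt f -> skolem_elt g -> skolem_elt (f + g)
| skolem_elt_mul f g : skolem_elt f -> skolem_elt g -> skolem_elt (f * g)
| skolem_elt_pow f g : skolem_elt f -> skolem_elt g -> skolem_elt (exp (g * ln f)).

Definition emonom c j : K := exp (X * ln c%:R) * X ^+ j.

Inductive tame : set K :=
| tame_one : tame 1
| tame_X : tame X
| tame_add f g : tame f -> tame g -> tame (f + g)
| tame_mul f g : tame f -> tame g -> tame (f * g)
| tame_pow h c j : (0 < c)%N -> tame h -> tame (exp (emonom c j * ln h)).

Lemma emonom_gt0 c j : 0 < emonom c j.
Proof. by rewrite mulr_gt0 ?ef_exp_gt0 ?exprn_gt0. Qed.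
Hint Resolve emonom_gt0 : core.

Lemma emonomM c j c' j' : (0 < c)%N -> (0 < c')%N ->
  emonom c j * emonom c' j' = emonom (c * c') (j + j').
Proof.
move=> c0 c'0; rewrite /emonom natrM ef_lnM ?ltr0n// mulrDr ef_expD exprD; ring.
Qed.

Lemma emonom_ge1 c j : (0 < c)%N -> 1 <= emonom c j.
Proof.
move=> c0; apply: mulr_ege1; last exact: exprn_ege1.
rewrite -[leLHS]ef_exp0 ef_exp_le; apply: mulr_ge0; first exact: ltW.
by apply: ef_ln_ge0; rewrite ler1n.
Qed.

Lemma emonom1 j : emonom 1 j = X ^+ j.
Proof. by rewrite /emonom ef_ln1 mulr0 ef_exp0 mul1r. Qed.

Lemma emonom_ltl m m' k : (0 < m)%N -> (m < m')%N -> emonom m k <= emonom m' 0.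
Proof.
move=> m0 mm'; have m'0 : (0 < m')%N by apply: leq_ltn_trans mm'.
have m0' : (0 : K) < m%:R by rewrite ltr0n.
have m'0' : (0 : K) < m'%:R by rewrite ltr0n.
rewrite /emonom expr0 mulr1 -[X ^+ k]ef_lnK ?exprn_gt0// ef_ln_exprn// -ef_expD ef_exp_le.
rewrite -lerBrDl -mulrBr -ef_ln_div//.
apply: (@le_trans _ _ (X * m'%:R^-1)).
  rewrite ler_pdivlMr// mulrAC -natrM; exact: ef_lnX_le_X.
rewrite ler_pM2l//; apply: le_trans (ef_ln_geBV _); last by rewrite divr_gt0.
rewrite invf_div lerBrDr -[X in X + _]mul1r -mulrDl ler_pdivrMr// mul1r.
by rewrite -(natrD _ 1) add1n ler_nat.
Qed.

Lemma emonom_ler m k k' : (k <= k')%N -> emonom m k <= emonom m k'.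
Proof. by move=> kk'; rewrite ler_pM2l ?ef_exp_gt0//; apply: ler_weXn2l. Qed.

Lemma emonom_lel m m' k : (0 < m)%N -> (m <= m')%N -> emonom m k <= emonom m' k.
Proof.
move=> m0; rewrite leq_eqVlt => /orP[/eqP->//|mm'].
by apply: le_trans (emonom_ltl k m0 mm') _; apply: emonom_ler.
Qed.

Lemma skolem_elt_ge1 s : skolem_elt s -> 1 <= s.
Proof.
elim=> // [f g _ f1 _ g1|f g _ f1 _ g1|f g _ f1 _ g1]; first by lra.
  exact: mulr_ege1.
rewrite -ef_exp0 ef_exp_le mulr_ge0 ?ef_ln_ge0//; lra.
Qed.

Lemma ef_X2_le_pow2 : X ^+ 2 <= exp (X * ln 2).
Proof.
rewrite -[leLHS]ef_lnK ?exprn_gt0// ef_exp_le ef_ln_exprn//.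
have := ef_lnX_le_X K 4; have := ef_ln2_ge K; have := X_gt0; nra.
Qed.

(** ** Small Skolem elements *)

Definition natlin s := exists a b : nat, (0 < a + b)%N /\ s = a%:R * X + b%:R.

Lemma natlin_nat n : (0 < n)%N -> natlin n%:R.
Proof. by move=> n0; exists 0%N, n; rewrite mul0r add0r. Qed.

Lemma natlin_add f g : natlin f -> natlin g -> natlin (f + g).
Proof.
move=> [a [b [ab ->]]] [a' [b' [ab' ->]]].
exists (a + a')%N, (b + b')%N; split; first by rewrite addnACA ltn_addr.
by rewrite !natrD; ring.
Qed.

Lemma natlin_natM n f : (0 < n)%N -> natlin f -> natlin (n%:R * f).
Proof.
move=> n0 [a [b [ab ->]]]; exists (n * a)%N, (n * b)%N.
by split; [rewrite -mulnDr muln_gt0 n0|rewrite !natrM; ring].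
Qed.

Definition natlin_or_large s := natlin s \/ X ^+ 2 <= s.

Lemma natlin_or_large_cases s : natlin_or_large s ->
  [\/ s = 1, exists2 b : nat, (2 <= b)%N & s = b%:R | X <= s].
Proof.
move=> [[a [b [ab ->]]]|X2s]; last first.
  by apply: Or33; apply: le_trans X2s; rewrite expr2 ler_peMl// ltW.
case: a ab => [|a] ab; last first.
  apply: Or33; rewrite -natr1 mulrDl mul1r.
  by have := mulr_ge0 (ler0n K a) (ltW X_gt0); have := ler0n K b; lra.
rewrite mul0r add0r; case: b ab => [//|[|b]] _; first exact: Or31.
by apply: Or32; exists b.+2.
Qed.

Lemma natlin_or_large_ge2 s : natlin_or_large s -> s = 1 \/ 2 <= s.
Proof.
move=> /natlin_or_large_cases[->|[b b2 ->]|Xs]; [by left|by right; rewrite ler_nat|right].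
exact: le_trans (ef_X_ge_nat K 2) Xs.
Qed.

Lemma natlin_or_large_natM n f : (0 < n)%N -> 0 <= f -> natlin_or_large f ->
  natlin_or_large (n%:R * f).
Proof.
move=> n0 f0 [/(natlin_natM n0)|X2f]; [by left|right].
by apply: le_trans X2f _; rewrite ler_peMl// ler1n.
Qed.

Lemma natlin_or_large_add f g : 1 <= f -> 1 <= g ->
  natlin_or_large f -> natlin_or_large g -> natlin_or_large (f + g).
Proof.
by move=> f1 g1 [fl|?] [gl|?]; [left; exact: natlin_add|right; lra..].
Qed.

Lemma natlin_or_large_mul f g : 1 <= f -> 1 <= g ->
  natlin_or_large f -> natlin_or_large g -> natlin_or_large (f * g).
Proof.
move=> f1 g1 fl gl; have [f0 g0] : 0 <= f /\ 0 <= g by split; lra.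
have [->|[b b2 ->]|Xf] := natlin_or_large_cases fl; first by rewrite mul1r.
  by apply: natlin_or_large_natM => //; exact: ltnW.
have [->|[b b2 ->]|Xg] := natlin_or_large_cases gl; first by rewrite mulr1.
  by rewrite mulrC; apply: natlin_or_large_natM => //; exact: ltnW.
by right; rewrite expr2; apply: ler_pM => //; apply: ltW.
Qed.

Lemma natlin_or_large_exprn n f : 0 <= f -> natlin_or_large f -> (2 <= n)%N ->
  natlin_or_large (f ^+ n).
Proof.
move=> f0 /natlin_or_large_cases[->|[b b2 ->]|Xf] n2.
- by rewrite expr1n; left; apply: (natlin_nat (n := 1)).
- by rewrite -natrX; left; apply: natlin_nat; rewrite expn_gt0 ltnW.
- right; apply: (@le_trans _ _ (f ^+ 2)).
    by apply: lerXn2r => //; rewrite nnegrE ltW.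
  by apply: ler_weXn2l => //; apply: le_trans Xf; exact: ef_X_ge1.
Qed.

Lemma natlin_or_large_pow f g : 1 <= f -> 1 <= g ->
  natlin_or_large f -> natlin_or_large g -> natlin_or_large (exp (g * ln f)).
Proof.
move=> f1 g1 fl gl; have f0 : 0 < f by lra.
have [->|[b b2 ->]|Xg] := natlin_or_large_cases gl; first by rewrite mul1r ef_lnK.
  by rewrite ef_exp_nat ef_lnK//; apply: natlin_or_large_exprn => //; exact: ltW.
have [->|f2] := natlin_or_large_ge2 fl.
  by rewrite ef_ln1 mulr0 ef_exp0; left; apply: (natlin_nat (n := 1)).
right; apply: le_trans ef_X2_le_pow2 _; rewrite ef_exp_le.
by apply: ler_pM; rewrite ?ef_ln_ge0 ?ef_ln_le//; [exact: ltW|lra].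
Qed.

Lemma skolem_elt_natlin_or_large s : skolem_elt s -> natlin_or_large s.
Proof.
elim=> [||f g Sf If Sg Ig|f g Sf If Sg Ig|f g Sf If Sg Ig].
- by left; apply: (natlin_nat (n := 1)).
- by left; exists 1%N, 0%N; rewrite mul1r addr0.
- by apply: natlin_or_large_add => //; apply: skolem_elt_ge1.
- by apply: natlin_or_large_mul => //; apply: skolem_elt_ge1.
- by apply: natlin_or_large_pow => //; apply: skolem_elt_ge1.
Qed.

Definition emonom_sum : set K := fsum [set e | exists c j, (0 < c)%N /\ e = emonom c j].

Lemma emonom_sum1 c j : (0 < c)%N -> emonom_sum (emonom c j).
Proof. by move=> c0; apply: fsum1; exists c, j. Qed.

Lemma emonom_sumM e e' : emonom_sum e -> emonom_sum e' -> emonom_sum (e * e').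
Proof.
elim=> [|e1 e2 [c [j [c0 ->]]] _ IH] e'P; first by rewrite mul0r; left.
rewrite mulrDl; apply: fsum_add (IH e'P).
elim: e'P => [|e3 e4 [c' [j' [c'0 ->]]] _ IH']; first by rewrite mulr0; left.
rewrite mulrDr emonomM//; right=> //.
by exists (c * c')%N, (j + j')%N; rewrite muln_gt0 c0.
Qed.

Lemma emonom_sum_nat n : emonom_sum n%:R.
Proof.
elim: n => [|n IH]; first exact: fsum0.
by rewrite -natr1 addrC; right=> //; exists 1%N, 0%N; rewrite emonom1.
Qed.

Lemma emonom_sumX n e : emonom_sum e -> emonom_sum (e ^+ n).
Proof.
move=> eP; elim: n => [|n IH]; first by rewrite expr0; apply: (emonom_sum_nat 1).
by rewrite exprS; apply: emonom_sumM.
Qed.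

Lemma emonom_sum_nat_pow n g : (0 < n)%N -> natlin g ->
  emonom_sum (exp (g * ln n%:R)).
Proof.
move=> n0 [a [b [_ ->]]]; have n0' : 0 < n%:R :> K by rewrite ltr0n.
have -> : exp ((a%:R * X + b%:R) * ln n%:R) = exp (X * ln (n%:R ^+ a)) * n%:R ^+ b.
  by rewrite mulrDl ef_expD ef_exp_nat ef_lnK// ef_ln_exprn//; congr (exp _ * _); ring.
rewrite -!natrX; apply: emonom_sumM; last exact: emonom_sum_nat.
by rewrite -[exp _]mulr1 -(expr0 X); apply: emonom_sum1; rewrite expn_gt0 n0.
Qed.

Lemma natlin_of_mul_lt g b N : 0 <= g -> natlin_or_large g -> 2^-1 <= b ->
  g * b < X * N%:R -> natlin g.
Proof.
move=> g0 [//|X2g] b2 gbN; have := ef_X_gt_nat K (2 * N)%N; rewrite natrM.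
have : g * 2^-1 < X * N%:R by apply: le_lt_trans gbN; apply: ler_wpM2l.
by move: X2g; rewrite expr2; have := ef_X_gt0 K; nra.
Qed.

Lemma skolem_elt_emonom_sum s : skolem_elt s ->
  forall N, (0 < N)%N -> s < exp (X * ln N%:R) -> emonom_sum s.
Proof.
elim=> [||f g Sf If Sg Ig|f g Sf If Sg Ig|f g Sf If Sg Ig] N N0 sN.
- exact: (emonom_sum_nat 1).
- by rewrite -[X]expr1 -emonom1; apply: emonom_sum1.
- have := skolem_elt_ge1 Sf; have := skolem_elt_ge1 Sg => *; apply: fsum_add.
    by apply: (If N) => //; lra.
  by apply: (Ig N) => //; lra.
- have f1 := skolem_elt_ge1 Sf; have g1 := skolem_elt_ge1 Sg; apply: emonom_sumM.
    by apply: (If N) => //; apply: le_lt_trans sN; rewrite ler_peMr//; lra.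
  by apply: (Ig N) => //; apply: le_lt_trans sN; rewrite ler_peMl//; lra.
have f1 := skolem_elt_ge1 Sf; have g1 := skolem_elt_ge1 Sg; have f0 : 0 < f by lra.
have gl := skolem_elt_natlin_or_large Sg.
have lnf0 := ef_ln_ge0 f1; rewrite ef_exp_lt in sN.
have f_sum : emonom_sum f.
  apply: (If N) => //; rewrite -[ltLHS]ef_lnK// ef_exp_lt.
  by apply: le_lt_trans sN; rewrite ler_peMl.
have {}sN : g * ln f < X * N%:R.
  apply: lt_le_trans sN _; rewrite ler_pM2l//.
  by have := @ef_ln_leB1 K N%:R; rewrite ltr0n => /(_ N0); lra.
have [fE|[b b2 fE]|fX] := natlin_or_large_cases (skolem_elt_natlin_or_large Sf).
- by rewrite fE ef_ln1 mulr0 ef_exp0; apply: (emonom_sum_nat 1).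
- rewrite fE; apply: emonom_sum_nat_pow; first exact: ltnW.
  apply: (natlin_of_mul_lt _ gl _ sN); first by lra.
  by apply: le_trans (ef_ln2_ge K) _; rewrite ef_ln_le// fE ler_nat.
have [->|[b b2 ->]|gX] := natlin_or_large_cases gl; first by rewrite mul1r ef_lnK.
  by rewrite ef_exp_nat ef_lnK//; apply: emonom_sumX.
have := ef_lnX_gt_nat K N; rewrite ltNge => /negP[].
rewrite -(ler_pM2l X_gt0); apply: le_trans (ltW sN).
by apply: ler_pM => //; [exact: ltW|exact: ltW|rewrite ef_ln_le].
Qed.

Lemma skolem_elt_tame s : skolem_elt s ->
  forall N, (0 < N)%N -> ln s < exp (X * ln N%:R) -> tame s.
Proof.
elim=> [||f g Sf If Sg Ig|f g Sf If Sg Ig|f g Sf If Sg Ig] N N0 sN.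
- exact: tame_one.
- exact: tame_X.
- have := skolem_elt_ge1 Sf; have := skolem_elt_ge1 Sg => *.
  by apply: tame_add; [apply: (If N)|apply: (Ig N)] => //; apply: le_lt_trans sN;
    rewrite ef_ln_le//; lra.
- have f1 := skolem_elt_ge1 Sf; have g1 := skolem_elt_ge1 Sg.
  have lf := ef_ln_ge0 f1; have lg := ef_ln_ge0 g1.
  move: sN; rewrite ef_lnM; [|lra|lra] => sN.
  by apply: tame_mul; [apply: (If N)|apply: (Ig N)] => //; lra.
have f1 := skolem_elt_ge1 Sf; have g1 := skolem_elt_ge1 Sg; have f0 : 0 < f by lra.
rewrite ef_expK in sN.
have [->|f2] := natlin_or_large_ge2 (skolem_elt_natlin_or_large Sf).
  by rewrite ef_ln1 mulr0 ef_exp0; apply: tame_one.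
have lf : 2^-1 <= ln f by apply: le_trans (ef_ln2_ge K) _; rewrite ef_ln_le.
have tame_f : tame f.
  by apply: (If N) => //; apply: le_lt_trans sN; rewrite ler_peMl//; lra.
have : emonom_sum g.
  apply: (@skolem_elt_emonom_sum _ Sg (2 * N)%N); first by rewrite muln_gt0.
  rewrite natrM ef_lnM ?ltr0n// mulrDr ef_expD.
  have : 2 <= exp (X * ln 2).
    apply: le_trans ef_X2_le_pow2; apply: le_trans (ef_X_ge_nat K 2) _.
    by rewrite expr2 ler_peMl// ltW.
  by have := ef_exp_gt0 (X * ln N%:R); nra.
elim=> [|_ e [c [j [c0 ->]]] _ IH]; first by rewrite mul0r ef_exp0; apply: tame_one.
by rewrite mulrDl ef_expD; apply: tame_mul => //; apply: tame_pow.
Qed.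

Lemma tame_ge1 s : tame s -> 1 <= s.
Proof.
elim=> // [f g _ f1 _ g1|f g _ f1 _ g1|h c j c0 _ h1]; first by lra.
  exact: mulr_ege1.
by rewrite -[leLHS](ef_exp0 K) ef_exp_le mulr_ge0 ?ef_ln_ge0// ltW.
Qed.

Lemma tame_gt0 s : tame s -> 0 < s. Proof. by move=> /tame_ge1; lra. Qed.

Lemma tame_exprn h n : tame h -> tame (h ^+ n).
Proof.
by move=> Th; elim: n => [|n IH]; [exact: tame_one|rewrite exprS; exact: tame_mul].
Qed.

Lemma tame_nat n : (0 < n)%N -> tame n%:R.
Proof.
elim: n => [//|[_ _|n IH _]]; first exact: tame_one.
by rewrite -natr1; apply: tame_add; [exact: IH|exact: tame_one].
Qed.

Lemma tame_emonom c j : (0 < c)%N -> tame (emonom c j).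
Proof.
move=> c0; apply: tame_mul; last exact/tame_exprn/tame_X.
rewrite -[X in exp (X * _)]expr1 -(emonom1 1).
by apply: tame_pow => //; apply: tame_nat.
Qed.

(** ** Sizes of logarithms *)

Lemma isO1_emonom m k : (0 < m)%N -> isO (emonom m k * ln X) 1.
Proof.
move=> m0; exists 1%N; rewrite normr1 mul1r; apply: mulr_ege1; first exact: emonom_ge1.
exact: ltW (ef_lnX_gt_nat K 1).
Qed.

Lemma isO_emonom_lnX m m' k k' : (0 < m)%N -> (m <= m')%N -> (k <= k')%N ->
  isO (emonom m' k' * ln X) (emonom m k * ln X).
Proof.
move=> m0 mm' kk'; apply: isO_mulr; first exact: ltW.
apply: (@isO_le _ _ _ (emonom m' k')); last by apply: isO_id; exact: ltW.
rewrite gtr0_norm//; apply: le_trans (emonom_lel _ m0 mm') _; exact: emonom_ler.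
Qed.

Definition log_size m k h := [/\ (0 < m)%N, emonom m k * ln 2 <= ln h &
  isO (emonom m k * ln X) (ln h)].

Lemma log_size_const h : 2 <= h -> h <= X -> log_size 1 0 h.
Proof.
move=> h2 hX; have h0 : 0 < h by lra.
split=> //; rewrite emonom1 expr0 !mul1r; first by rewrite ef_ln_le.
apply: (@isO_le _ _ _ (ln X)); last by apply: isO_id; exact: ltW.
by rewrite ger0_norm ?ef_ln_le// ef_ln_ge0//; lra.
Qed.

Lemma log_size_le2M m k g h : log_size m k g -> 1 <= g -> g <= h -> h <= 2 * g ->
  log_size m k h.
Proof.
move=> [m0 lo hi] g1 gh h2g; have [g0 h0] : 0 < g /\ 0 < h by split; lra.
have lgh : ln g <= ln h by rewrite ef_ln_le.
split=> //; first exact: le_trans lgh.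
apply: (@isO_le _ _ _ (1 + ln g)); last by apply: isOD => //; apply: isO1_emonom.
rewrite ger0_norm; last by apply: ef_ln_ge0; lra.
apply: le_trans (_ : ln 2 + ln g <= _); first by rewrite -ef_lnM// ef_ln_le//; lra.
by have := ef_ln2_le1 K; lra.
Qed.

Lemma log_size_mul m k f g : log_size m k g -> 1 <= f -> f <= g ->
  log_size m k (f * g).
Proof.
move=> [m0 lo hi] f1 fg; have [f0 g0] : 0 < f /\ 0 < g by split; lra.
have lfg : ln f <= ln g by rewrite ef_ln_le.
have lf := ef_ln_ge0 f1; rewrite /log_size ef_lnM//; split=> //; first by lra.
by apply: isOD => //; apply: isO_le hi; rewrite ger0_norm.
Qed.

Lemma log_size_pow m k c j h : (0 < c)%N -> log_size m k h ->
  log_size (c * m) (j + k) (exp (emonom c j * ln h)).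
Proof.
move=> c0 [m0 lo hi]; rewrite /log_size -emonomM// ef_expK; split.
- by rewrite muln_gt0 c0.
- by rewrite -mulrA ler_pM2l.
- by rewrite -mulrA; apply: isO_mull => //; apply: ltW.
Qed.

Lemma tame_log_size h : tame h -> h = 1 \/ exists m k, log_size m k h.
Proof.
elim=> [||f g Tf If Tg Ig|f g Tf If Tg Ig|f c j c0 Tf [->|[m [k fs]]]].
- by left.
- by right; exists 1%N, 0%N; apply: log_size_const => //; exact: (ef_X_ge_nat K 2).
- wlog fg : f g Tf If Tg Ig / f <= g.
    move=> le_case; have [fg|/ltW gf] := leP f g; first exact: le_case.
    by rewrite addrC; apply: le_case.
  have f1 := tame_ge1 Tf; have g1 := tame_ge1 Tg; right.
  case: Ig => [gE|[m [k gs]]]; last by exists m, k; apply: log_size_le2M gs _ _ _; lra.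
  exists 1%N, 0%N; apply: log_size_const; first by lra.
  by have := ef_X_ge_nat K 2; lra.
- wlog fg : f g Tf If Tg Ig / f <= g.
    move=> le_case; have [fg|/ltW gf] := leP f g; first exact: le_case.
    by rewrite mulrC; apply: le_case.
  have f1 := tame_ge1 Tf; case: Ig => [gE|[m [k gs]]].
    by left; rewrite gE mulr1; lra.
  by right; exists m, k; apply: log_size_mul.
- by left; rewrite ef_ln1 mulr0 ef_exp0.
- by right; exists (c * m)%N, (j + k)%N; apply: log_size_pow.
Qed.

Lemma emonom_isO_lex m k n l : (0 < m)%N -> (0 < n)%N ->
  isO (emonom n l * ln X) (emonom m k * ln 2) -> (m < n)%N \/ (m = n /\ (k <= l)%N).
Proof.
move=> m0 n0 [C]; rewrite ger0_norm; last first.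
  by apply: mulr_ge0; [exact: ltW|have := ef_ln2_ge K; lra].
move=> Em_le; suff not_le : ~ emonom n l.+1 <= emonom m k.
  have [?|nm|mn] := ltngtP m n; first by left.
    case: not_le; apply: le_trans (emonom_ltl _ n0 nm) _; exact: emonom_ler.
  right; split=> //; rewrite leqNgt; apply/negP => kl; case: not_le.
  by rewrite mn; apply: emonom_ler.
move=> En_le; have := ef_lnX_lt_X K (2 * C); rewrite ltNge => /negP; apply.
have : emonom n l * X * 2^-1 <= C%:R * (emonom n l * ln X).
  apply: le_trans Em_le; apply: ler_pM.
  - by apply: mulr_ge0; apply: ltW.
  - by lra.
  - by move: En_le; rewrite {1}/emonom exprSr mulrA.
  - exact: ef_ln2_ge.
rewrite natrM mulrCA -mulrA ler_pM2l//; lra.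
Qed.

Definition fragment m k : set K :=
  [set h | tame h /\ isO (emonom m k * ln X) (ln h)].

Lemma fragment_gt0 m k h : fragment m k h -> 0 < h.
Proof. by move=> [/tame_gt0]. Qed.

Lemma fragment_mul m k f g : fragment m k f -> fragment m k g -> fragment m k (f * g).
Proof.
move=> [Tf lf] [Tg lg]; split; first exact: tame_mul.
by rewrite ef_lnM ?tame_gt0//; apply: isOD.
Qed.

Lemma fragment_one m k : fragment m k 1.
Proof. by split; [exact: tame_one|rewrite ef_ln1; exact: isO0]. Qed.

Lemma fragment_le m k f g : tame f -> f <= g -> fragment m k g -> fragment m k f.
Proof.
move=> Tf fg [Tg lg]; split=> //; apply: isO_le lg.
by rewrite ger0_norm ?ef_ln_ge0 ?tame_ge1// ef_ln_le// tame_gt0.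
Qed.

Lemma fragment_leq m m' k k' : (0 < m)%N -> (m <= m')%N -> (k <= k')%N ->
  fragment m k `<=` fragment m' k'.
Proof.
by move=> m0 mm' kk' h [Th lh]; split=> //; apply: isO_trans lh _; apply: isO_emonom_lnX.
Qed.

Lemma log_size_fragment m k h : tame h -> log_size m k h -> fragment m k h.
Proof. by move=> Th [_ _]. Qed.

(** ** Components *)

Inductive component : set K :=
| component_one : component 1
| component_X : component X
| component_mul p q : component p -> component q -> component (p * q)
| component_pow h c j : (0 < c)%N -> (c, j) != (1%N, 0%N) -> tame h ->
    component (exp (emonom c j * ln h)).

Lemma component_tame p : component p -> tame p.
Proof.
elim=> [||{}p q _ ? _ ?|h c j c0 _ Th].
- exact: tame_one.
- exact: tame_X.
- exact: tame_mul.
- exact: tame_pow.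
Qed.

Lemma component_gt0 p : component p -> 0 < p.
Proof. by move=> /component_tame/tame_gt0. Qed.

Lemma tame_fsum h : tame h -> fsum component h.
Proof.
elim=> [||f g _ If _ Ig|f g _ If _ Ig|f c j c0 Tf If].
- exact/fsum1/component_one.
- exact/fsum1/component_X.
- exact: fsum_add.
- elim: If => [|p s Pp _ IH]; first by rewrite mul0r; left.
  rewrite mulrDl; apply: fsum_add IH.
  elim: Ig => [|q t Pt _ IH]; first by rewrite mulr0; left.
  by rewrite mulrDr; right=> //; apply: component_mul.
have [|cj] := eqVneq (c, j) (1%N, 0%N); last exact/fsum1/component_pow.
by case=> -> ->; rewrite emonom1 expr0 mul1r ef_lnK// tame_gt0.
Qed.

Definition fragment_component m k : set K := component `&` fragment m k.

Lemma fragment_fsum m k : fragment m k `<=` fsum (fragment_component m k).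
Proof.
move=> h Fh.
have summands_le s : fsum component s -> s <= h ->
    fsum (component `&` [set p | p <= h]) s.
  elim=> [|p {}s Pp Ps IH] psh; first by left.
  have p0 := component_gt0 Pp.
  have s0 : 0 <= s by apply: fsum_ge0 Ps => q /component_gt0.
  by right; [split=> //=; lra|apply: IH; lra].
apply: fsum_sub (summands_le _ (tame_fsum (proj1 Fh)) (lexx h)) => p [Pp ph].
by split=> //; apply: fragment_le Fh => //; exact: component_tame.
Qed.

(** ** Logarithms of components *)

Definition lower_log n : set K :=
  if n is 0 then [set i%:R * ln X | i in [set: nat]]
  else [set ln q | q in \bigcup_k fragment_component n k].

Lemma lower_log0 n : lower_log n 0.
Proof.
case: n => [|n]; first by exists 0%N => //; rewrite mul0r.
exists 1; last exact: ef_ln1.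
by exists 0%N => //; split; [exact: component_one|exact: fragment_one].
Qed.

Lemma lower_logD n u v : lower_log n u -> lower_log n v -> lower_log n (u + v).
Proof.
case: n => [[i _ <-] [j _ <-]|n [q [k _ [Pq Fq]] <-] [q' [k' _ [Pq' Fq']] <-]].
  by exists (i + j)%N => //; rewrite natrD mulrDl.
exists (q * q'); last by rewrite ef_lnM ?component_gt0.
exists (maxn k k') => //; split; first exact: component_mul.
by apply: fragment_mul; [apply: fragment_leq Fq|apply: fragment_leq Fq'] => //;
  rewrite ?leq_maxl ?leq_maxr.
Qed.

Lemma lower_log_lnX n : lower_log n (ln X).
Proof.
case: n => [|n]; first by exists 1%N => //; rewrite mul1r.
exists X => //; exists 0%N => //; split; first exact: component_X.
split; first exact: tame_X.
rewrite -[X in isO _ X]mul1r; apply: isO_mulr (ltW lnX_gt0) _.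
by exists 1%N; rewrite normr1 mul1r emonom_ge1.
Qed.

Definition scaled_log n k c j : set K :=
  [set emonom c j * ln h | h in fragment (n %/ c) (k - j)].

Lemma scaled_log0 n k c j : scaled_log n k c j 0.
Proof. by exists 1; [exact: fragment_one|rewrite ef_ln1 mulr0]. Qed.

Lemma scaled_logD n k c j u v :
  scaled_log n k c j u -> scaled_log n k c j v -> scaled_log n k c j (u + v).
Proof.
move=> [h Fh <-] [h' Fh' <-]; exists (h * h'); first exact: fragment_mul.
by rewrite ef_lnM ?mulrDr// (fragment_gt0 Fh, fragment_gt0 Fh').
Qed.

Definition scaling n k (x : 'I_n.+1 * 'I_k.+1) : bool :=
  [&& (0 < x.1)%N, (x.1 %| n)%N & (x.1 : nat, x.2 : nat) != (1%N, 0%N)].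

Definition component_log n k : set K := sumset (lower_log n)
  (\big[sumset/[set 0]]_(x | @scaling n.+1 k x) scaled_log n.+1 k x.1 x.2).

Lemma sub_lower_component_log n k : lower_log n `<=` component_log n k.
Proof.
move=> v Bv; exists v => //; exists 0; rewrite ?addr0//.
by apply: big_sumset0 => *; exact: scaled_log0.
Qed.

Lemma sub_scaled_component_log n k c j : (0 < c)%N -> (c %| n.+1)%N -> (j <= k)%N ->
  (c, j) != (1%N, 0%N) -> scaled_log n.+1 k c j `<=` component_log n k.
Proof.
move=> c0 cn jk cj v Uv; exists 0; first exact: lower_log0.
exists v; last by rewrite add0r.
have cn' : (c < n.+2)%N by rewrite ltnS dvdn_leq.
have jk' : (j < k.+1)%N by [].
apply: (@sub_big_sumset _ _ _ _ (Ordinal cn', Ordinal jk')) Uv; first exact/and3P.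
by move=> *; exact: scaled_log0.
Qed.

Lemma component_logD n k u v :
  component_log n k u -> component_log n k v -> component_log n k (u + v).
Proof.
move=> [a Ba [b Ub <-]] [a' Ba' [b' Ub' <-]]; exists (a + a'); first exact: lower_logD.
exists (b + b'); last by rewrite addrACA.
by apply: big_sumsetD Ub Ub' => *; exact: scaled_logD.
Qed.

Lemma component_log_pow n k c j h : (0 < c)%N -> (c, j) != (1%N, 0%N) -> tame h ->
  isO (emonom n.+1 k * ln X) (emonom c j * ln h) ->
  component_log n k (emonom c j * ln h).
Proof.
move=> c0 cj Th hO; have [->|[m [l hs]]] := tame_log_size Th.
  by rewrite ef_ln1 mulr0; apply/sub_lower_component_log/lower_log0.
have [m0 lo _] := hs; have cm0 : (0 < c * m)%N by rewrite muln_gt0 c0.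
have [] // := @emonom_isO_lex (c * m) (j + l) n.+1 k.
- rewrite -emonomM// -mulrA; apply: isO_le hO.
  rewrite ger0_norm; first by rewrite ler_pM2l.
  by do 2?[apply: mulr_ge0; first exact: ltW]; have := ef_ln2_ge K; lra.
- move=> cmn; apply: sub_lower_component_log; case: n cmn {hO} => [|n] cmn.
    by move: cmn; rewrite ltnNge cm0.
  exists (exp (emonom c j * ln h)); last by rewrite ef_expK.
  exists (j + l)%N => //; split; first exact: component_pow.
  apply: (@fragment_leq (c * m) _ (j + l)) => //.
  by apply: log_size_fragment; [exact: tame_pow|exact: log_size_pow].
move=> [cmn jlk]; apply: (@sub_scaled_component_log _ _ c j) => //.
- by rewrite -cmn dvdn_mulr.
- exact: leq_trans (leq_addr _ _) jlk.
exists h => //; apply: (@fragment_leq m _ l) => //.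
- by rewrite -cmn mulKn.
- by rewrite leq_subRL// (leq_trans (leq_addr _ _) jlk).
- exact: log_size_fragment.
Qed.

Lemma ln_fragment_component n k :
  ln @` fragment_component n.+1 k `<=` component_log n k.
Proof.
move=> _ [p [Pp Fp] <-]; elim: Pp Fp => [||{}p q Pp Ip Pq Iq|h c j c0 cj Th] Fp.
- by rewrite ef_ln1; apply/sub_lower_component_log/lower_log0.
- exact/sub_lower_component_log/lower_log_lnX.
- have p1 := tame_ge1 (component_tame Pp); have q1 := tame_ge1 (component_tame Pq).
  rewrite ef_lnM ?component_gt0//; apply: component_logD.
    by apply: Ip; apply: fragment_le Fp; [exact: component_tame|rewrite ler_peMr//; lra].
  by apply: Iq; apply: fragment_le Fp; [exact: component_tame|rewrite ler_peMl//; lra].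
- by have [_] := Fp; rewrite ef_expK; apply: component_log_pow.
Qed.

(** ** Order types of fragments *)

Section Counting.
Hypothesis gap : forall p q, tame p -> tame q -> isO q p \/ isO p (q * X).

Definition ratio d := exists f g, [/\ tame f, tame g & d = f / g].

Lemma ratio_gt0 d : ratio d -> 0 < d.
Proof. by move=> [f [g [Tf Tg ->]]]; rewrite divr_gt0// tame_gt0. Qed.

Lemma ratio_mul d p : ratio d -> tame p -> ratio (d * p).
Proof.
move=> [f [g [Tf Tg ->]]] Tp; exists (f * p), g; split=> //; first exact: tame_mul.
by rewrite mulrAC.
Qed.

Lemma ratio_div d p : ratio d -> tame p -> ratio (d / p).
Proof.
move=> [f [g [Tf Tg ->]]] Tp; exists f, (g * p); split=> //; first exact: tame_mul.
by rewrite invfM mulrA.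
Qed.

Lemma gap_ratio r p : ratio r -> tame p -> isO r p \/ isO p (r * X).
Proof.
move=> [f [g [Tf Tg ->]]] Tp; have g0 := tame_gt0 Tg; have gn0 := lt0r_neq0 g0.
have gV0 : 0 <= g^-1 by rewrite invr_ge0 ltW.
have [fpg|pgf] := gap (tame_mul Tp Tg) Tf; [left|right].
  by have := isO_mulr gV0 fpg; rewrite mulfK.
by have := isO_mulr gV0 pgf; rewrite mulfK// mulrAC.
Qed.

Definition small_ratio d := ratio d /\ isO 1 (d * X).

Lemma small_ratio_lt d (N : nat) : small_ratio d -> N%:R * d <= 2^-1.
Proof.
move=> [rd [M]]; have d0 := ratio_gt0 rd; rewrite mulr1 ger0_norm; last first.
  by apply: mulr_ge0; apply: ltW.
move=> dM; have := ef_X_ge_nat K (2 * N * M)%N; rewrite !natrM => XM.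
by have N0 := ler0n K N; rewrite -(ler_pM2r X_gt0); nra.
Qed.

Lemma small_ratio_isO1 d : small_ratio d -> isO 1 d.
Proof.
move=> sd; have d0 := ratio_gt0 (proj1 sd); exists 1%N; rewrite mulr1 gtr0_norm//.
by have := small_ratio_lt 1 sd; lra.
Qed.

Lemma small_ratio_div_emonom d c j : (0 < c)%N -> small_ratio d ->
  small_ratio (d / emonom c j).
Proof.
move=> c0 [rd dX]; split; first by apply: ratio_div => //; apply: tame_emonom.
have d0 := ratio_gt0 rd; apply: isO_le dX.
rewrite ger0_norm; last by rewrite !mulr_ge0 ?invr_ge0// ltW.
by rewrite ler_pM2r// ler_pdivrMr// ler_peMr ?emonom_ge1// ltW.
Qed.

Lemma small_ratio_XV i : small_ratio (X ^- i.+1).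
Proof.
split.
  exists 1, (X ^+ i.+1); split; [exact: tame_one|exact/tame_exprn/tame_X|].
  by rewrite mul1r.
exists 1%N; rewrite mul1r exprS invfM mulrAC mulVf ?lt0r_neq0// mul1r.
rewrite ger0_norm ?invr_ge0 ?exprn_ge0 ?(ltW X_gt0)//.
by rewrite invf_le1 ?exprn_gt0// exprn_ege1.
Qed.

(* Elements that are not [O(r)] are, by the gap property, at least of the order
   of [r X]; the ones in the class of [g] modulo [O(r X)] then have the same order
   [p0], and the ratio [r / p0] is small. *)
Lemma splits_tame (P : set K) : P `<=` tame ->
  (forall d, small_ratio d -> splits d (d * X) (ln @` P)) ->
  forall r, ratio r -> splits r (r * X) P.
Proof.
move=> TP D r rr g; have r0 := ratio_gt0 rr.
have [[p0 [Pp0 p0g gp0 np0]]|all_small] := pselect (exists p,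
    [/\ P p, p <= g, isO (r * X) (g - p) & ~ isO r p]); last first.
  apply: (@splits_at_isO _ _ _ _ _ 0) => p Pp pg gp; rewrite subr0.
  by apply: contrapT => np; apply: all_small; exists p.
have large p : P p -> isO (r * X) (g - p) -> ~ isO r p -> isO p (r * X) /\ isO p g.
  move=> Pp gp np; have [//|rXp] := gap_ratio rr (TP _ Pp); split=> //.
  rewrite -(subrK p g); apply: isOD; last exact/isO_id/ltW/tame_gt0/TP.
  exact: isO_trans gp rXp.
have p0_gt0 := tame_gt0 (TP _ Pp0); have [rXp0 p0g'] := large _ Pp0 gp0 np0.
have p0V : 0 <= p0^-1 by rewrite invr_ge0 ltW.
have sd : small_ratio (r / p0).
  split; first exact: ratio_div (TP _ Pp0).
  by have := isO_mulr p0V rXp0; rewrite divff ?lt0r_neq0// mulrAC.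
have d0 := ratio_gt0 (proj1 sd).
have [L LP] := D _ sd (ln g); exists (0 :: [seq exp l | l <- L]) => p Pp pg gp.
have [rp|np] := pselect (isO r p); first by exists 0; rewrite ?mem_head ?subr0.
have p_gt0 := tame_gt0 (TP _ Pp); have [rXp pg'] := large _ Pp gp np.
have g_gt0 : 0 < g by apply: lt_le_trans pg.
have p0p : isO p0 p by apply: isO_le p0g'; rewrite gtr0_norm.
have scale e q : 0 < e -> isO q p0 -> isO (q * (e / p0)) e.
  move=> e0 qp0; have := isO_mulr (ltW (divr_gt0 e0 p0_gt0)) qp0.
  by rewrite [p0 * _]mulrC divfK// lt0r_neq0.
have [|||l lL pl] := LP (ln p).
- by exists p.
- by rewrite ef_ln_le.
- apply: isO_ln_sub => //; apply: isO_trans gp _; rewrite mulrAC.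
  apply: scale; first exact: mulr_gt0.
  by apply: isO_le (isO_id (ltW g_gt0)); rewrite gtr0_norm.
exists (exp l); first by rewrite in_cons map_f ?orbT.
apply/isON; rewrite opprB; move/isON: pl; rewrite opprB => pl.
apply: isO_trans (isO_exp_sub p_gt0 (isO_trans pl (small_ratio_isO1 sd)) pl) _.
by have := isO_mulr (ltW d0) p0p; rewrite [p0 * _]mulrC divfK// lt0r_neq0.
Qed.

Lemma splits_ln_tame (P : set K) : P `<=` tame ->
  (forall r, ratio r -> splits r (r * X) P) ->
  forall d, small_ratio d -> splits d (d * X) (ln @` P).
Proof.
move=> TP D d sd g; have d0 := ratio_gt0 (proj1 sd); have [_ dX1] := sd.
apply: splits_at_nonempty => _ [s0 Ps0 <-] s0g gs0.
have s0_gt0 := tame_gt0 (TP _ Ps0).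
have [L LP] := D _ (ratio_mul (proj1 sd) (TP _ Ps0)) (exp g).
exists [seq ln l | l <- L] => _ [s Ps <-] sg gs; have s_gt0 := tame_gt0 (TP _ Ps).
have le_exp s' : 0 < s' -> ln s' <= g -> isO (exp g) s'.
  move=> s'0 s'g; apply: (@isO_le _ _ _ (exp g)); last exact/isO_id/ltW/ef_exp_gt0.
  by rewrite gtr0_norm// -[leLHS]ef_lnK// ef_exp_le.
have exp_le s' : 0 < s' -> isO (d * X) (g - ln s') -> isO s' (exp g).
  move=> s'0 gs'; have := isO_exp_sub s'0 (isO_trans gs' dX1) (isO_trans gs' dX1).
  by rewrite mulr1 -{2}[exp g](subrK s') => /isOD; apply; exact/isO_id/ltW.
have ss0 : isO s s0 := isO_trans (le_exp _ s0_gt0 s0g) (exp_le _ s_gt0 gs).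
have s0s : isO s0 s := isO_trans (le_exp _ s_gt0 sg) (exp_le _ s0_gt0 gs0).
have [||l lL sl] := LP s Ps; first by rewrite -[leLHS]ef_lnK// ef_exp_le.
  apply: isO_trans (isO_exp_sub s_gt0 (isO_trans gs dX1) gs) _.
  have -> : d * s0 * X = s0 * (d * X) by ring.
  by apply: isO_mulr _ s0s; apply: mulr_ge0; apply: ltW.
exists (ln l); first exact: map_f.
have {}sl : isO (s * d) (s - l).
  by apply: isO_trans sl _; rewrite mulrC; apply: isO_mull _ ss0; exact: ltW.
have l2 : s <= 2 * l.
  have [N slN] := sl; have := small_ratio_lt N sd; have := le_trans (ler_norm _) slN.
  by rewrite mulrCA => ? ?; nra.
have l0 : 0 < l by lra.
by apply: isO_ln_sub sl => //; exists 2%N; rewrite gtr0_norm.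
Qed.

Lemma splits_scale d e b (U : set K) : 0 < b -> splits (d / b) (e / b) U ->
  splits d e [set b * u | u in U].
Proof.
move=> b0 sU g; have [L LP] := sU (g / b); exists [seq b * l | l <- L].
have bV : 0 <= b^-1 by rewrite invr_ge0 ltW.
move=> _ [u Uu <-] ug gu; have [||l lL ul] := LP u Uu.
- by rewrite ler_pdivlMr// mulrC.
- by have := isO_mulr bV gu; rewrite mulrBl mulrAC divff ?mul1r// lt0r_neq0.
exists (b * l); first exact: map_f.
by have := isO_mull (ltW b0) ul; rewrite mulrBr mulrCA divff ?mulr1// lt0r_neq0.
Qed.

Lemma height_scale (W : ordinal_rep) (a : W) d b (U : set K) : 0 < b ->
  height (lt_modO (d / b)) a U -> height (lt_modO d) a [set b * u | u in U].
Proof.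
move=> b0; apply: (height_transfer (S := fun v u => v = b * u)).
  move=> _ _ u v -> -> uv N; have := uv N.
  by rewrite -mulrBr mulrA ltr_pdivrMr// [b * _]mulrC.
by move=> _ [u Uu <-]; exists u.
Qed.

Lemma height_lt_modO0_le (W : ordinal_rep) (a : W) d (U : set K) :
  height (lt_modO 0) a U -> height (lt_modO d) a U.
Proof.
apply: (height_transfer (S := eq)) => [u v _ _ <- <- /lt_modO_lt/lt_modO0//|u Uu].
by exists u.
Qed.

Lemma height_ln (W : ordinal_rep) (a : W) (U : set K) :
  (forall u, U u -> 0 < u) -> height (lt_modO 0) a (ln @` U) <-> height (lt_modO 0) a U.
Proof.
move=> U0; split.
  apply: (height_transfer (S := fun u v => U u /\ v = ln u)).
    move=> u' v' u v [Uu ->] [Uv ->] /lt_modO0 uv; apply/lt_modO0.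
    by rewrite ef_ln_lt// U0.
  by move=> u Uu; exists (ln u); split=> //; exists u.
apply: (height_transfer (S := fun v u => U u /\ v = ln u)).
  move=> u' v' u v [Uu ->] [Uv ->] /lt_modO0 uv; apply/lt_modO0.
  by move: uv; rewrite ef_ln_lt// U0.
by move=> _ [u Uu <-]; exists u.
Qed.

Lemma arch_lt_ln p q : 0 < p -> 0 < q -> arch_lt p q -> lt_modO 1 (ln p) (ln q).
Proof.
move=> p0 q0 pq N; rewrite mulr1 ltrBrDr -ef_exp_lt ef_expD !ef_lnK//.
apply: le_lt_trans (pq (4 ^ N)%N); rewrite ler_pM2r//; exact: ef_exp_nat_le.
Qed.

Lemma height_arch (W : ordinal_rep) (a : W) (U : set K) : (forall u, U u -> 0 < u) ->
  height (lt_modO 1) a (ln @` U) -> height (@arch_lt K) a U.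
Proof.
move=> U0; apply: (height_transfer (S := fun u v => U u /\ v = ln u)).
  by move=> u' v' u v [Uu ->] [Uv ->]; apply: arch_lt_ln; apply: U0.
by move=> u Uu; exists (ln u); split=> //; exists u.
Qed.

Lemma height_nat_multiples (W : ordinal_rep) (one : omega_exp W) d u :
  ord_lt (oexp0 W) one -> 0 < u ->
  height (lt_modO d) one [set i%:R * u | i in [set: nat]].
Proof.
move=> one_gt0 u0; constructor=> _ [i _ <-].
apply: (@below_sub _ _ _ _ _ [set v | exists2 i', (i' < i)%N & v = i'%:R * u]).
  move=> _ [[i' _ <-] /lt_modO_lt]; rewrite ltr_pM2r// ltr_nat => i'i.
  by exists i'.
apply: (below_bigcup (F := fun i' => [set i'%:R * u])) => i' _.
by apply: height_lt_below one_gt0 _; apply: height_set1 => /lt_modO_lt; rewrite ltxx.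
Qed.

Let tower_one_gt0 n : ord_lt (oexp0 (omega_tower n)) (tower_one n).
Proof. exact: oexp_pow_gt0. Qed.

Definition log_bounds n (U : set K) :=
  [/\ exists g : omega_tower n.+2, height (lt_modO 0) g U,
      exists a : omega_tower n.+1, height (lt_modO 1) a U &
      forall d, small_ratio d -> splits d (d * X) U].

Lemma log_bounds_sub n (U V : set K) : U `<=` V -> log_bounds n V -> log_bounds n U.
Proof.
move=> UV [[g Hg] [a Ha] D]; split; [exists g|exists a|].
- exact: height_sub Hg.
- exact: height_sub Ha.
- by move=> d /D; apply: splits_sub.
Qed.

Lemma log_bounds_set1 n u : log_bounds n [set u].
Proof.
split; [exists (oexp0 _)|exists (oexp0 _)|by move=> d _; exact: splits_set1].
all: by apply: height_set1 => /lt_modO_lt; rewrite ltxx.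
Qed.

Lemma log_bounds_sumset n (U V : set K) :
  log_bounds n U -> log_bounds n V -> log_bounds n (sumset U V).
Proof.
move=> [[g Hg] [a Ha] D] [[g' Hg'] [a' Ha'] D']; split.
- by exists (oexp_add g g'); apply: height_sumset.
- by exists (oexp_add a a'); apply: height_sumset.
- move=> d sd; apply: splits_sumset; [| |exact: D|exact: D'].
    exact: height_well_ordered Hg.
  exact: height_well_ordered Hg'.
Qed.

Lemma height_fine n (U : set K) i : log_bounds n U ->
  exists b : omega_tower n.+1, height (lt_modO (X ^- i)) b U.
Proof.
move=> [_ [a Ha] D]; elim: i => [|i [b Hb]]; first by exists a; rewrite expr0 invr1.
exists (oexp_add (tower_one n) b).
apply: height_splits (tower_one_gt0 n) (D _ (small_ratio_XV i)) _ => //.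
  by rewrite mulr_ge0 ?invr_ge0 ?exprn_ge0// ltW.
by rewrite exprS invfM mulrAC mulVf ?lt0r_neq0// mul1r.
Qed.

Lemma splits_emonom c j (U : set K) : (0 < c)%N ->
  (forall d, small_ratio d -> splits d (d * X) U) ->
  forall d, small_ratio d -> splits d (d * X) [set emonom c j * u | u in U].
Proof.
move=> c0 D d sd; apply: splits_scale => //; rewrite mulrAC; apply: D.
exact: small_ratio_div_emonom.
Qed.

Lemma log_bounds_Xn n (U : set K) j :
  log_bounds n U -> log_bounds n [set emonom 1 j * u | u in U].
Proof.
move=> BU; have [[g Hg] _ D] := BU; have [b Hb] := height_fine j BU; split.
- by exists g; apply: height_scale => //; rewrite mul0r.
- by exists b; apply: height_scale => //; rewrite emonom1 mul1r.
- exact: splits_emonom.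
Qed.

Lemma log_bounds_lift n (U : set K) c j : (0 < c)%N ->
  log_bounds n U -> log_bounds n.+1 [set emonom c j * u | u in U].
Proof.
move=> c0 [[g Hg] _ D]; have [iota [_ [iota_mono _]]] := tower_lift n.+2; split.
- exists (iota g); apply: height_scale => //; rewrite mul0r.
  exact: height_map iota_mono _ _ Hg.
- by exists g; apply: height_scale => //; apply: height_lt_modO0_le.
- exact: splits_emonom.
Qed.

Lemma log_bounds_lower_log0 : log_bounds 0 (lower_log 0).
Proof.
split.
- by exists (tower_one 1); apply: height_nat_multiples (tower_one_gt0 1) _.
- by exists (tower_one 0); apply: height_nat_multiples (tower_one_gt0 0) _.
move=> d [rd dX] g; apply: splits_at_nonempty => v0 Bv0 v0g gv0.
apply: (@splits_at_isO _ _ _ _ _ v0) => v Bv vg gv.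
have : isO 1 (v - v0).
  rewrite (_ : v - v0 = (g - v0) - (g - v)); last by ring.
  by apply: isO_trans dX; apply: isOB.
case: Bv Bv0 => [i _ <-] [i0 _ <-]; rewrite -mulrBl => -[N]; rewrite mulr1 normrM.
have [->|ii0] := eqVneq i i0; first by rewrite subrr mul0r => _; apply: isO0.
rewrite (gtr0_norm lnX_gt0) leNgt => /negP[]; apply: lt_le_trans (ef_lnX_gt_nat K N) _.
have -> : i%:R - i0%:R = (i%:Z - i0%:Z)%:~R :> K by rewrite intrB.
apply: ler_peMl; first exact: ltW.
by rewrite -intr_norm ler1z -gtz0_ge1 normr_gt0 subr_eq0.
Qed.

Lemma height_local n (R : K -> K -> Prop) (U : set K) :
  (forall u, U u -> exists g : omega_tower n, height R g (U `&` [set v | R v u])) ->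
  exists t : omega_tower n.+1, height R t U.
Proof.
move=> HU; have [iota [t [iota_mono iota_t]]] := tower_lift n; exists t.
constructor=> u /HU[g Hg]; exact: height_lt_below (iota_t g) (height_map iota_mono Hg).
Qed.

Lemma log_bounds_lower_logS n :
  (forall k, log_bounds n (ln @` fragment n.+1 k)) -> log_bounds n.+1 (lower_log n.+1).
Proof.
move=> FB.
have initial (R : K -> K -> Prop) q k : (forall u v, R u v -> u < v) ->
    component q -> fragment n.+1 k q ->
    lower_log n.+1 `&` [set v | R v (ln q)] `<=` ln @` fragment n.+1 k.
  move=> R_lt Pq Fq _ [[q' [k' _ [Pq' Fq']] <-] /R_lt/ltW qq'].
  exists q' => //; apply: fragment_le Fq; first exact: component_tame.
  by rewrite -ef_ln_le// component_gt0.
split.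
- apply: height_local => _ [q [k _ [Pq Fq]] <-]; have [[g Hg] _ _] := FB k.
  by exists g; apply: height_sub (initial _ _ _ _ Pq Fq) Hg => u v /lt_modO_lt.
- apply: height_local => _ [q [k _ [Pq Fq]] <-]; have [_ [a Ha] _] := FB k.
  by exists a; apply: height_sub (initial _ _ _ _ Pq Fq) Ha => u v /lt_modO_lt.
move=> d sd g; apply: splits_at_nonempty => _ [q [k _ [Pq Fq]] <-] qg gq.
have [_ _ D] := FB k; have [L LP] := D d sd g.
exists L => _ [q' [k' _ [Pq' Fq']] <-] q'g gq'; apply: LP => //; exists q' => //.
split; first exact: component_tame.
rewrite -(subrK (ln q) (ln q')); apply: isOD; last by case: Fq.
apply: (@isO_trans _ 1); last exact: isO1_emonom.
rewrite (_ : _ - _ = (g - ln q) - (g - ln q')); last by ring.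
by apply: isO_trans (proj2 sd); apply: isOB.
Qed.

Lemma log_bounds_scaled_log n k c j : (0 < c)%N -> (c %| n.+1)%N -> (j <= k)%N ->
  (c, j) != (1%N, 0%N) ->
  (forall n', n = n'.+1 -> forall k', log_bounds n' (ln @` fragment n'.+1 k')) ->
  (forall k', (k' < k)%N -> log_bounds n (ln @` fragment n.+1 k')) ->
  log_bounds n (scaled_log n.+1 k c j).
Proof.
move=> c0 cn jk cj FBn FBk.
have scaled_sub m i : fragment (n.+1 %/ c) (k - j) `<=` fragment m i ->
    scaled_log n.+1 k c j `<=` [set emonom c j * u | u in ln @` fragment m i].
  by move=> sub _ [h Fh <-]; exists (ln h) => //; exists h => //; exact: sub.
have [c1|c1] := eqVneq c 1%N.
  have j0 : (0 < j)%N by rewrite lt0n; apply: contraNneq cj => ->; rewrite c1.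
  apply: log_bounds_sub (scaled_sub n.+1 (k - j)%N _) _; first by rewrite c1 divn1.
  by rewrite c1; apply/log_bounds_Xn/FBk; rewrite -subn_gt0 subKn.
have c2 : (1 < c)%N by rewrite ltn_neqAle eq_sym c1.
case: n cn FBn {FBk} scaled_sub => [|n] cn FBn scaled_sub.
  by move: (leq_trans c2 (dvdn_leq (ltn0Sn 0) cn)).
apply: log_bounds_sub (scaled_sub n.+1 (k - j)%N _) _; last first.
  by apply: log_bounds_lift => //; exact: FBn.
apply: fragment_leq => //; first by rewrite divn_gt0// dvdn_leq.
by rewrite -ltnS; apply: ltn_Pdiv.
Qed.

Lemma log_bounds_fragment_component n k :
  log_bounds n (lower_log n) ->
  (forall n', n = n'.+1 -> forall k', log_bounds n' (ln @` fragment n'.+1 k')) ->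
  (forall k', (k' < k)%N -> log_bounds n (ln @` fragment n.+1 k')) ->
  log_bounds n (ln @` fragment_component n.+1 k).
Proof.
move=> Blow FBn FBk; apply: log_bounds_sub (@ln_fragment_component n k) _.
apply: log_bounds_sumset => //; elim/big_ind: _ => [|U V|[c j] /and3P[c0 cn cj]].
- exact: log_bounds_set1.
- exact: log_bounds_sumset.
- by apply: log_bounds_scaled_log => //; rewrite -ltnS; exact: ltn_ord.
Qed.

Lemma log_bounds_fragment n k : log_bounds n (ln @` fragment_component n.+1 k) ->
  log_bounds n (ln @` fragment n.+1 k).
Proof.
move=> [[g Hg] [a Ha] D].
have P_gt0 p : fragment_component n.+1 k p -> 0 < p by move=> [/component_gt0].
have [G HG] : exists G : omega_tower n.+2,
    height (lt_modO 0) G (fsum (fragment_component n.+1 k)).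
  have [v gv] := tower_lt_pow g.
  exists (oexp_pow (oexp_add (oexp_add v (tower_one n)) a)).
  apply: height_fsum => //; last exact: height_arch.
  by apply: height_le (proj1 gv) _; apply/height_ln.
split.
- exists G; apply/height_ln; first by move=> u /fragment_gt0.
  exact: height_sub (@fragment_fsum _ _) HG.
- exists a; apply: (height_transfer (S := fun u v => isO 1 (u - v))) Ha.
    by move=> u' v' u v uu vv; apply: lt_modO_isO.
  move=> _ [s Fs <-]; have s0 := fragment_gt0 Fs.
  have [p [N [Pp ps sN]]] := fsum_dominant P_gt0 (fragment_fsum Fs) (lt0r_neq0 s0).
  have p0 := P_gt0 _ Pp; exists (ln p); split; first by exists p.
  have sp : isO p s by exists N; rewrite gtr0_norm.
  apply/isON; rewrite opprB; apply: isO_ln_sub => //.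
    by apply: isO_le (isO_id (ltW s0)); rewrite gtr0_norm.
  by rewrite mulr1; apply: isOB => //; apply/isO_id/ltW.
- apply: splits_ln_tame => [s []//|r rr]; apply: splits_sub (@fragment_fsum _ _) _.
  apply: splits_fsum => //.
  + by rewrite mulr_gt0// ratio_gt0.
  + by move=> p [Pp _]; apply: gap_ratio => //; apply: component_tame.
  + by apply: splits_tame => // p [/component_tame].
  + exact: height_well_ordered HG.
Qed.

Lemma fragment_log_bounds n k : log_bounds n (ln @` fragment n.+1 k).
Proof.
elim: n k => [|n IHn] k; elim/ltn_ind: k => k IHk.
  apply/log_bounds_fragment/log_bounds_fragment_component => //.
  exact: log_bounds_lower_log0.
apply/log_bounds_fragment/log_bounds_fragment_component => //.
  exact: log_bounds_lower_logS.
by move=> n' [<-].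
Qed.

Definition skolem_elt_below n : set K :=
  [set s | skolem_elt s /\ ln s < exp (X * ln n.+1%:R) * ln 2].

Lemma skolem_elt_below_fragment n s : (0 < n)%N -> skolem_elt_below n s ->
  exists k, fragment n k s.
Proof.
move=> n0 [Ss sn]; have E_gt0 := ef_exp_gt0 (X * ln n.+1%:R).
have Ts : tame s.
  apply: (skolem_elt_tame Ss (N := n.+1)) => //; apply: lt_le_trans sn _.
  by rewrite ler_piMr ?ef_ln2_le1// ltW.
have [->|[m [k ss]]] := tame_log_size Ts; first by exists 0%N; apply: fragment_one.
have [m0 lo _] := ss; exists k.
apply: (@fragment_leq m n k k) => //; last exact: log_size_fragment.
rewrite leqNgt; apply/negP => nm.
have : emonom m k * ln 2 < emonom n.+1 0 * ln 2.
  by apply: le_lt_trans lo _; rewrite /emonom expr0 mulr1.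
rewrite ltr_pM2r; last by have := ef_ln2_ge K; lra.
apply/negP; rewrite -leNgt; apply: le_trans (emonom_lel 0 _ nm) _ => //.
exact: emonom_ler.
Qed.

Lemma skolem_elt_below_homo n (W : ordinal_rep) (R : K -> K -> Prop) :
  (forall v u w, R u v -> R v w -> R u w) -> (forall u v, R u v -> u < v) ->
  (forall k, exists g : W, height R g (fragment n.+1 k)) ->
  exists e : K -> omega_exp W, forall s t,
    skolem_elt_below n.+1 s -> skolem_elt_below n.+1 t -> R s t -> ord_lt (e s) (e t).
Proof.
move=> R_trans R_lt HF; apply: (locally_height_embeds R_trans) => t St.
have [k Ft] := skolem_elt_below_fragment (ltn0Sn n) St; have [g Hg] := HF k; exists g.
apply: below_sub (height_below Hg Ft) => s [Ss /= Rst]; split=> //.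
apply: fragment_le (ltW (R_lt _ _ Rst)) Ft.
by have [k' []] := skolem_elt_below_fragment (ltn0Sn n) Ss.
Qed.

Theorem skolem_elt_below_embeds n : (0 < n)%N ->
  (exists e : K -> omega_tower n.+2, forall s t,
    skolem_elt_below n s -> skolem_elt_below n t -> s < t -> ord_lt (e s) (e t)) /\
  (exists e : K -> omega_tower n.+1, forall s t,
    skolem_elt_below n s -> skolem_elt_below n t -> arch_lt s t -> ord_lt (e s) (e t)).
Proof.
case: n => [//|n] _; split.
  have [|u v|k|e eP] := @skolem_elt_below_homo n (omega_tower n.+2) (@lt_modO K 0).
  - exact: lt_modO_trans.
  - exact: lt_modO_lt.
  - have [[g Hg] _ _] := fragment_log_bounds n k; exists g.
    by apply/height_ln => // u /fragment_gt0.
  - by exists e => s t Ss St st; apply: eP => //; apply/lt_modO0.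
apply: (skolem_elt_below_homo (@arch_lt_trans K) (@arch_lt_lt K)) => k.
have [_ [g Hg] _] := fragment_log_bounds n k; exists g.
by apply: height_arch Hg => u /fragment_gt0.
Qed.

End Counting.
End SkolemElements.

(** * Asymptotic expansions of logarithms *)

Lemma seq_max (d : Order.disp_t) (T : orderType d) (P : pred T) (s : seq T) : has P s ->
  exists x, [/\ x \in s, P x & forall y, y \in s -> P y -> (y <= x)%O].
Proof.
move=> /hasP[x0 x0s Px0].
have index_lt y : y \in s -> (index y s < size s)%N by rewrite index_mem.
case: (@Order.TotalTheory.arg_maxP _ _ 'I_(size s) (Ordinal (index_lt _ x0s))
  (fun i => P (nth x0 s i)) (fun i => nth x0 s i)); first by rewrite /= nth_index.
move=> i Pi imax; exists (nth x0 s i); split=> //; first exact: mem_nth.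
move=> y ys Py; have := imax (Ordinal (index_lt _ ys)).
by rewrite /= nth_index//; apply.
Qed.

Section Gap.
Variables (R : realType) (K : exp_field) (cst : {rmorphism R -> K}).
Implicit Types (a b d e f g h t u v w y z : K) (q r s : R).
Local Notation X := (ef_X K).
Local Notation exp := (@ef_exp K).
Local Notation ln := (@ef_ln K).
Local Notation isO := (@isO K).
Local Notation tame := (@tame K).
Local Notation emonom := (@emonom K).

Hypothesis cst_le : {mono cst : x y / x <= y}.
Hypothesis cst_exp : forall r, exp (cst r) = cst (expR r).

Variable analytic : set K.
Hypothesis analytic_cst : forall r, analytic (cst r).
Hypothesis analytic_XV : analytic X^-1.
Hypothesis analytic_add : forall a b, analytic a -> analytic b -> analytic (a + b).
Hypothesis analytic_mul : forall a b, analytic a -> analytic b -> analytic (a * b).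
Hypothesis analytic_exp : forall a, analytic a -> analytic (exp a).
Hypothesis analytic_ln : forall a, analytic a -> 1 <= a -> analytic (ln a).
Hypothesis analytic_isO1 : forall a, analytic a -> isO 1 a.
Hypothesis analytic_div : forall a, analytic a -> exists r a',
  analytic a' /\ a = cst r + X^-1 * a'.
Hypothesis analytic_order : forall a, analytic a -> a = 0 \/ exists (k : nat) r a',
  [/\ r != 0, analytic a' & a = X ^- k * (cst r + X^-1 * a')].

Definition taylor (phi : K -> K) := forall N : nat, exists (c : nat -> R) (C : nat),
  forall e, `|e| <= 2^-1 ->
    `|phi e - \sum_(i < N) cst (c i) * e ^+ i| <= C%:R * `|e| ^+ N.
Hypothesis taylor_exp : taylor exp.
Hypothesis taylor_ln : taylor (fun e => ln (1 + e)).

Let X_gt0 : 0 < X. Proof. exact: ef_X_gt0. Qed.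
Let X_ge0 : 0 <= X. Proof. exact/ltW/ef_X_gt0. Qed.
Let X_neq0 : X != 0. Proof. exact: lt0r_neq0. Qed.
Let X_ge1 : 1 <= X. Proof. exact: ef_X_ge1. Qed.
Let lnX_gt0 : 0 < ln X. Proof. exact: ef_lnX_gt0. Qed.
Let exp_gt0 a : 0 < exp a. Proof. exact: ef_exp_gt0. Qed.
Let exp_ge0 a : 0 <= exp a. Proof. exact/ltW/ef_exp_gt0. Qed.
Hint Resolve X_gt0 X_ge0 X_neq0 X_ge1 lnX_gt0 exp_gt0 exp_ge0 : core.

Lemma cst_lt : {mono cst : x y / x < y}.
Proof. by move=> x y; rewrite !ltNge cst_le. Qed.

Lemma cst_norm r : cst `|r| = `|cst r|.
Proof.
have [r0|r0] := ger0P r; first by rewrite ger0_norm// -(rmorph0 cst) cst_le.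
by rewrite rmorphN ltr0_norm// -(rmorph0 cst) cst_lt.
Qed.

Lemma cst_ln (r : R) : 0 < r -> ln (cst r) = cst (exp.ln r).
Proof. by move=> r0; rewrite -[RHS]ef_expK cst_exp lnK. Qed.

Lemma isO1_cst r : isO 1 (cst r).
Proof.
have [N rN] : exists N : nat, `|r| <= N%:R.
  by exists (Num.bound `|r|); apply: ltW; apply: archi_boundP.
by exists N; rewrite mulr1 -cst_norm -(rmorph_nat cst) cst_le.
Qed.

Lemma isO_cst r : r != 0 -> isO `|cst r| 1.
Proof.
move=> r0; have rn0 : 0 < `|r| by rewrite normr_gt0.
have [N rN] : exists N : nat, `|r|^-1 <= N%:R.
  by exists (Num.bound `|r|^-1); apply: ltW; apply: archi_boundP; rewrite invr_ge0.
exists N; rewrite normr1 -cst_norm -(rmorph_nat cst) -rmorphM -(rmorph1 cst) cst_le.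
by rewrite -ler_pdivrMr// div1r.
Qed.

Definition expqX q := exp (cst q * X).

Lemma expqX_gt0 q : 0 < expqX q. Proof. exact: ef_exp_gt0. Qed.
Hint Resolve expqX_gt0 : core.

Lemma expqXD q q' : expqX (q + q') = expqX q * expqX q'.
Proof. by rewrite /expqX rmorphD mulrDl ef_expD. Qed.

Lemma expqX0 : expqX 0 = 1.
Proof. by rewrite /expqX rmorph0 mul0r ef_exp0. Qed.

Lemma lnX_le_cstX r (N : nat) : 0 < r -> N%:R * ln X <= cst r * X.
Proof.
move=> r0; have [M] := isO_cst (lt0r_neq0 r0).
rewrite normr1 gtr0_norm -?(rmorph0 cst) ?cst_lt// => Mr.
have M0 : 0 < M%:R :> K.
  by rewrite lt0r ler0n andbT; apply: contraTneq Mr => ->; rewrite mul0r ler10.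
rewrite -(ler_pM2l M0) !mulrA -natrM; apply: le_trans (ef_lnX_le_X K (M * N)) _.
by rewrite ler_peMl.
Qed.

Lemma exprn_le_expqX r (N : nat) : 0 < r -> X ^+ N <= expqX r.
Proof.
by move=> r0; rewrite -[leLHS]ef_lnK ?exprn_gt0// ef_exp_le ef_ln_exprn// lnX_le_cstX.
Qed.

Lemma X_le_expX : X <= exp X.
Proof. by apply: le_trans (ef_exp_ge _); rewrite lerDr. Qed.

Lemma nat_le_expX (N : nat) : N%:R <= exp X.
Proof. exact: le_trans (ef_X_ge_nat K N) X_le_expX. Qed.

(** ** Laurent elements *)

Definition laurent w := exists (k : nat) a, analytic a /\ w = X ^+ k * a.

Lemma analytic_XVn k : analytic (X ^- k).
Proof.
rewrite -exprVn; elim: k => [|k IH]; last by rewrite exprS; apply: analytic_mul.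
by rewrite expr0 -(rmorph1 cst).
Qed.

Lemma laurent_analytic a : analytic a -> laurent a.
Proof. by move=> Aa; exists 0%N, a; rewrite mul1r. Qed.

Lemma laurent_cst (r : R) : laurent (cst r). Proof. exact: laurent_analytic. Qed.

Lemma laurent_X : laurent X.
Proof. by exists 1%N, 1; rewrite expr1 mulr1 -(rmorph1 cst). Qed.

Lemma laurent_mul w w' : laurent w -> laurent w' -> laurent (w * w').
Proof.
move=> [k [a [Aa ->]]] [k' [a' [Aa' ->]]]; exists (k + k')%N, (a * a').
by split; [exact: analytic_mul|rewrite exprD; ring].
Qed.

Lemma laurent_add w w' : laurent w -> laurent w' -> laurent (w + w').
Proof.
move=> [k [a [Aa ->]]] [k' [a' [Aa' ->]]].
exists (k + k')%N, (X ^- k' * a + X ^- k * a'); split.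
  by apply: analytic_add; apply: analytic_mul => //; apply: analytic_XVn.
by rewrite exprD; field; rewrite !expf_neq0.
Qed.

Lemma laurent_exprz (n : int) : laurent (X ^ n).
Proof.
case: n => n; last by apply: laurent_analytic; rewrite NegzE -exprnN; apply: analytic_XVn.
rewrite -exprnP; elim: n => [|n IH].
  by rewrite expr0 -(rmorph1 cst); exact: laurent_cst.
by rewrite exprS; apply: laurent_mul IH; exact: laurent_X.
Qed.

Definition infinitesimal e := forall N : nat, N%:R * `|e| <= 1.

Lemma infinitesimal_isO1 e : infinitesimal e -> isO 1 e.
Proof. by move=> /(_ 1%N); rewrite mul1r => e1; exists 1%N; rewrite mulr1. Qed.

Lemma analytic_infinitesimal a : analytic a -> infinitesimal (X^-1 * a).
Proof.
move=> /analytic_isO1[M]; rewrite mulr1 => aM N.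
rewrite normrM gtr0_norm ?invr_gt0// mulrCA mulrC ler_pdivrMr// mul1r.
apply: (le_trans _ (ef_X_ge_nat K (N * M)%N)).
by rewrite natrM; apply: ler_wpM2l.
Qed.

Lemma analytic_unit_lower r a : r != 0 -> analytic a -> isO `|cst r + X^-1 * a| 1.
Proof.
move=> /isO_cst[N]; rewrite normr1 => rN Aa; exists (2 * N)%N; rewrite normr1.
have := analytic_infinitesimal Aa (2 * N)%N; rewrite natrM => aN.
have := lerB_normD (cst r) (X^-1 * a); have := ler0n K N; nra.
Qed.

Lemma laurent_order w : laurent w -> w = 0 \/ exists e : int,
  isO `|w| (X ^ e) /\ isO (X ^ e) w.
Proof.
move=> [k [a [/analytic_order[->|[l [r [a' [r0 Aa' ->]]]]] ->]]].
  by left; rewrite mulr0.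
right; exists (k%:Z - l%:Z); set y := cst r + _.
have -> : X ^+ k * (X ^- l * y) = X ^ (k%:Z - l%:Z) * y.
  by rewrite mulrA expfzDr// -exprnP -exprnN.
have Xe : 0 <= X ^ (k%:Z - l%:Z) by rewrite exprz_ge0.
split; last rewrite -[X in isO X _]mulr1.
  rewrite normrM (ger0_norm Xe) -[X in isO _ X]mulr1.
  by apply: isO_mull => //; exact: analytic_unit_lower.
apply: isO_mull => //; apply: isOD; first exact: isO1_cst.
exact/infinitesimal_isO1/analytic_infinitesimal.
Qed.

Lemma exprz_X_le (e e' : int) : e <= e' -> X ^ e <= X ^ e'.
Proof. by move=> ee'; apply: ler_weXz2l. Qed.

Lemma exprz_X_lt (e e' : int) : e < e' -> X ^ e * X <= X ^ e'.
Proof.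
by move=> ee'; rewrite -{2}(expr1z X) -expfzDr//; apply: exprz_X_le; rewrite lezD1.
Qed.

Definition poly_upper w := exists M : nat, `|w| <= X ^+ M.

Definition poly_lower w := w = 0 \/ exists M : nat, 1 <= X ^+ M * `|w|.

Lemma laurent_upper w : laurent w -> poly_upper w.
Proof.
move=> [k [a [/analytic_isO1[N aN] ->]]]; exists k.+1.
rewrite normrM normrX (gtr0_norm X_gt0) exprSr ler_pM2l ?exprn_gt0//.
by apply: le_trans (ef_X_ge_nat K N); rewrite -[leRHS]mulr1.
Qed.

Lemma isO_poly_lower v w : isO `|w| v -> poly_lower v -> (v = 0 -> w = 0) -> poly_lower w.
Proof.
move=> [N vN] [v0|[M vM]] w0; [by left; exact: w0|right; exists M.+1].
apply: le_trans vM _; rewrite exprSr -mulrA ler_pM2l ?exprn_gt0//.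
by apply: le_trans vN _; rewrite ler_wpM2r// ef_X_ge_nat.
Qed.

Lemma laurent_lower w : laurent w -> poly_lower w.
Proof.
move=> Lw; have [|[e [Xe_w _]]] := laurent_order Lw; first by left.
have [->|w0] := eqVneq w 0; first by left.
apply: (isO_poly_lower Xe_w); last by move=> /eqP; rewrite gt_eqF ?exprz_gt0.
right; exists `|e|%N; rewrite gtr0_norm ?exprz_gt0//.
by rewrite exprnP -expfzDr// -(expr0z X); apply: exprz_X_le; clear; lia.
Qed.

Lemma norm_le_dominant v w : 2 * `|w| <= `|v| \/ 2 * `|v| <= `|w| -> `|v| <= 2 * `|v + w|.
Proof.
have := ler_normB (v + w) w; have := ler_normB (v + w) v.
by rewrite addrK addrAC subrr add0r => vw_v vw_w [] ?; lra.
Qed.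

(* [ln X] is not a quotient of Laurent elements, so no cancellation occurs. *)
Lemma laurent_lnX_dominated z w : laurent z -> laurent w ->
  isO `|z * ln X + w| (z * ln X).
Proof.
move=> /laurent_order[->|[e [[C Xe_z] [C1 z_Xe]]]] Lw.
  by rewrite mul0r; exact: isO0.
exists 2%N; apply: norm_le_dominant; have lnX0 := ltW lnX_gt0.
case: (laurent_order Lw) => [->|[e' [[C' Xe'_w] [C1' w_Xe']]]].
  by left; rewrite normr0 mulr0.
rewrite normrM (ger0_norm lnX0); rewrite ger0_norm ?exprz_ge0// in Xe_z.
rewrite ger0_norm ?exprz_ge0// in Xe'_w.
have [e'e|ee'] := leP e' e; [left|right].
  apply: le_trans (_ : (2 * C1' * C)%:R * `|z| <= _); last first.
    by rewrite [leRHS]mulrC ler_wpM2r// ltW// ef_lnX_gt_nat.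
  rewrite !natrM -!mulrA; apply: ler_wpM2l => //; apply: le_trans w_Xe' _.
  apply: ler_wpM2l => //; exact: le_trans (exprz_X_le e'e) Xe_z.
have C'0 : 0 < C'%:R :> K.
  rewrite lt0r ler0n andbT; apply: contraTneq Xe'_w => ->.
  by rewrite mul0r -ltNge exprz_gt0.
rewrite -(ler_pM2l C'0); apply: le_trans Xe'_w; apply: le_trans (exprz_X_lt ee').
apply: le_trans (_ : X ^ e * ((2 * C1 * C')%:R * ln X) <= _); last first.
  by rewrite ler_wpM2l ?exprz_ge0// ef_lnX_le_X.
have := ler_wpM2r (mulr_ge0 (ltW C'0) lnX0) z_Xe; rewrite !natrM; lra.
Qed.

Lemma laurent_lnX_lower z w : laurent z -> laurent w -> poly_lower (z * ln X + w).
Proof.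
move=> Lz Lw; have [z0|z0] := eqVneq z 0.
  by rewrite z0 mul0r add0r; apply: laurent_lower.
have zlnX0 : z * ln X != 0 by rewrite mulf_neq0// lt0r_neq0.
apply: isO_poly_lower (laurent_lnX_dominated Lz Lw) _ _; last first.
  by move=> /eqP; rewrite (negbTE zlnX0).
apply: (@isO_poly_lower z); last by move=> z0'; rewrite z0' eqxx in z0.
  exists 1%N; rewrite mul1r normrM ler_peMr// gtr0_norm//.
  exact/ltW/(ef_lnX_gt_nat K 1).
exact: laurent_lower.
Qed.

Lemma laurent_lnX_upper z w : laurent z -> laurent w -> poly_upper (z * ln X + w).
Proof.
move=> /laurent_upper[M zM] /laurent_upper[M' wM']; exists (M + M').+2.
apply: le_trans (ler_normD _ _) _; rewrite normrM (gtr0_norm lnX_gt0).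
have lnX_le : ln X <= X by have := ef_lnX_le_X K 1; rewrite mul1r.
have X_mono i j : (i <= j)%N -> X ^+ i <= X ^+ j by apply: ler_weXn2l.
have zlnX : `|z| * ln X <= X ^+ (M + M').+1.
  apply: le_trans (X_mono M.+1 _ _); last by rewrite ltnS leq_addr.
  by rewrite exprSr; apply: ler_pM => //; apply: ltW.
have w_le : `|w| <= X ^+ (M + M').+1.
  by apply: le_trans wM' (X_mono _ _ _); rewrite leqW// leq_addl.
rewrite exprS; have := ef_X_ge_nat K 2; have : 0 < X ^+ (M + M').+1 by rewrite exprn_gt0.
by move=> ? ?; nra.
Qed.

Lemma laurent_lnX_eq0 z w : laurent z -> laurent w -> z * ln X + w = 0 -> z = 0 /\ w = 0.
Proof.
move=> Lz Lw zw0; have [N] := laurent_lnX_dominated Lz Lw.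
rewrite zw0 normr0 mulr0 normr_le0 mulf_eq0 (gt_eqF lnX_gt0) orbF => /eqP z0.
by move: zw0; rewrite z0 mul0r add0r.
Qed.

Lemma isO_X_lnX z w : laurent z -> laurent w -> isO X (z * ln X + w) -> isO 1 z.
Proof.
move=> Lz Lw zwO; have [->|[e [Xe_z z_Xe]]] := laurent_order Lz; first exact: isO0.
have [e0|e0] := leP e 0.
  apply: isO_trans z_Xe _; exists 1%N.
  by rewrite gtr0_norm ?exprz_gt0// mul1r -(expr0z X); apply: exprz_X_le.
have [N] : isO X (X * ln X).
  have zO := isO_trans (laurent_lnX_dominated Lz Lw) (proj2 (isO_norm _ _) zwO).
  apply: isO_trans (proj2 (isO_norm _ _) zO); rewrite normrM (gtr0_norm lnX_gt0).
  apply: isO_mulr; first exact: ltW.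
  apply: isO_trans Xe_z; exists 1%N; rewrite mul1r !gtr0_norm ?exprz_gt0//.
  by rewrite -{1}(expr1z X); apply: exprz_X_le; rewrite -gtz0_ge1.
rewrite gtr0_norm ?mulr_gt0// mulrC ler_pM2r// leNgt => /negP[].
exact: ef_lnX_gt_nat.
Qed.

Lemma laurent_isO_X w : laurent w -> isO X w -> exists r s a,
  analytic a /\ w = cst r * X + cst s + X^-1 * a.
Proof.
move=> [k [a [Aa ->]]]; elim: k a Aa => [|k IH] a Aa wO.
  have [s [a' [Aa' ->]]] := analytic_div Aa; exists 0, s, a'.
  by rewrite rmorph0 mul0r add0r mul1r.
have [r [a' [Aa' aE]]] := analytic_div Aa.
case: k IH wO => [|k] IH wO.
  have [s [a2 [Aa2 a'E]]] := analytic_div Aa'; exists r, s, a2; split=> //.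
  by rewrite aE a'E expr1; field.
have [r0|r0] := eqVneq r 0.
  have lower_degree : X ^+ k.+2 * a = X ^+ k.+1 * a'.
    by rewrite aE r0 rmorph0 add0r exprSr -mulrA mulVKf.
  by rewrite lower_degree in wO *; exact: IH.
have [N] : isO X (X * X).
  apply: (@isO_trans _ (X ^+ k.+2)).
    exists 1%N; rewrite mul1r gtr0_norm ?mulr_gt0// -expr2.
    by apply: ler_weXn2l.
  have Xk : 0 <= X ^+ k.+2 by rewrite exprn_ge0.
  apply: isO_trans (proj2 (isO_norm _ _) wO).
  rewrite normrM (ger0_norm Xk) -[X in isO _ X]mulr1; apply: isO_mull => //.
  by rewrite aE; exact: analytic_unit_lower.
rewrite gtr0_norm ?mulr_gt0// ler_pM2r// leNgt => /negP[]; exact: ef_X_gt_nat.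
Qed.

(** ** Sums of exponentials with Laurent coefficients *)

Inductive intpoly : set K :=
| intpoly0 : intpoly 0
| intpolyS z (n : int) : intpoly z -> intpoly (X * z + n%:~R).

Lemma intpoly_int (n : int) : intpoly n%:~R.
Proof. by rewrite -[_%:~R]add0r -(mulr0 X); apply/intpolyS/intpoly0. Qed.

Lemma intpoly_add z z' : intpoly z -> intpoly z' -> intpoly (z + z').
Proof.
move=> Zz; elim: Zz z' => [|{}z n Zz IH] z' Zz'; first by rewrite add0r.
case: Zz' => [|{}z' n' Zz']; first by rewrite addr0; apply: intpolyS.
by rewrite addrACA -mulrDr -intrD; apply/intpolyS/IH.
Qed.

Lemma intpoly_opp z : intpoly z -> intpoly (- z).
Proof.
elim=> [|{}z n Zz IH]; first by rewrite oppr0; apply: intpoly0.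
by rewrite opprD -mulrN -intrN; apply: intpolyS.
Qed.

Lemma intpoly_mulX k z : intpoly z -> intpoly (X ^+ k * z).
Proof.
move=> Zz; elim: k => [|k IH]; first by rewrite mul1r.
by rewrite exprS -mulrA -[_ * _]addr0; apply: (@intpolyS _ 0).
Qed.

Lemma intpoly_laurent z : intpoly z -> laurent z.
Proof.
elim=> [|{}z n _ IH]; first by rewrite -(rmorph0 cst); apply: laurent_cst.
apply: laurent_add; first by apply: laurent_mul IH; apply: laurent_X.
by rewrite -(rmorph_int cst); apply: laurent_cst.
Qed.

Lemma intpoly_cases z : intpoly z -> (exists n : int, z = n%:~R) \/ X <= 2 * `|z|.
Proof.
elim=> [|{}z n _ z_cases]; first by left; exists 0.
have [->|z1] : z = 0 \/ 1 <= `|z|; last 1 first.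
- right; have := lerB_normD (X * z) n%:~R; rewrite normrM (gtr0_norm X_gt0).
  have -> : `|n%:~R| = `|n|%N%:R :> K by rewrite -intr_norm -abszE.
  by have := ef_X_ge_nat K (2 * `|n|)%N; rewrite natrM; have := ler_wpM2l X_ge0 z1; lra.
- case: z_cases => [[m ->]|XZ]; last by right; have := ef_X_ge_nat K 2; lra.
  have [->|m0] := eqVneq m 0; [by left|right].
  by rewrite -intr_norm ler1z -gtz0_ge1 normr_gt0.
- by left; exists n; rewrite mulr0 add0r.
Qed.

Definition expsum_val (l : seq (R * K)) : K := \sum_(i <- l) expqX i.1 * i.2.

Definition expsum_coef (l : seq (R * K)) q : K := \sum_(i <- l | i.1 == q) i.2.

Lemma expsum_val_coef (s : seq R) (l : seq (R * K)) : uniq s ->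
  {subset [seq i.1 | i <- l] <= s} ->
  expsum_val l = \sum_(q <- s) expqX q * expsum_coef l q.
Proof.
move=> us; elim: l => [|i l IH] ls.
  by rewrite /expsum_val big_nil big1// => q _; rewrite /expsum_coef big_nil mulr0.
have is_ : i.1 \in s by apply: ls; rewrite mem_head.
rewrite /expsum_val big_cons -/(expsum_val l) IH; last first.
  by move=> q ql; apply: ls; rewrite in_cons ql orbT.
rewrite (bigD1_seq i.1)//= [in RHS](bigD1_seq i.1)//= addrA; congr (_ + _).
  by rewrite -mulrDr; congr (_ * _); rewrite /expsum_coef big_cons eqxx.
apply: eq_bigr => q qi; congr (_ * _).
by rewrite /expsum_coef big_cons eq_sym (negbTE qi).
Qed.

Definition expsum v := exists l : seq (R * K),
  (forall i, i \in l -> laurent i.2) /\ v = expsum_val l.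

Definition intexpsum u := exists l : seq (R * K),
  (forall i, i \in l -> intpoly i.2 /\ 0 <= i.1) /\ u = expsum_val l.

Lemma expsum_val_cat l l' : expsum_val (l ++ l') = expsum_val l + expsum_val l'.
Proof. by rewrite /expsum_val big_cat. Qed.

Lemma expsum_val_map l q w (F : K -> K) : (forall v, F v = w * v) ->
  expsum_val [seq (q + i.1, F i.2) | i <- l] = expqX q * w * expsum_val l.
Proof.
move=> FE; rewrite /expsum_val big_map mulr_sumr; apply: eq_bigr => i _ /=.
by rewrite expqXD FE; ring.
Qed.

Lemma expsum_add v v' : expsum v -> expsum v' -> expsum (v + v').
Proof.
move=> [l [lP ->]] [l' [lP' ->]]; exists (l ++ l'); rewrite expsum_val_cat; split=> // i.
by rewrite mem_cat => /orP[/lP|/lP'].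
Qed.

Lemma expsum_0 : expsum 0.
Proof. by exists [::]; rewrite /expsum_val big_nil. Qed.

Lemma expsum_scale q w v : laurent w -> expsum v -> expsum (expqX q * w * v).
Proof.
move=> Lw [l [lP ->]]; exists [seq (q + i.1, w * i.2) | i <- l].
split; last by rewrite (expsum_val_map _ _ (w := w)).
by move=> _ /mapP[i /lP Li ->] /=; apply: laurent_mul.
Qed.

Lemma expsum_expqX q w : laurent w -> expsum (expqX q * w).
Proof.
move=> Lw; exists [:: (q, w)]; split; first by move=> i; rewrite inE => /eqP ->.
by rewrite /expsum_val big_seq1.
Qed.

Lemma expsum_laurent w : laurent w -> expsum w.
Proof. by move=> /(expsum_expqX 0); rewrite expqX0 mul1r. Qed.

Lemma expsum_mul v v' : expsum v -> expsum v' -> expsum (v * v').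
Proof.
move=> [l [lP ->]] Tv'; elim: l lP => [|i l IH] lP.
  by rewrite /expsum_val big_nil mul0r; apply: expsum_0.
rewrite /expsum_val big_cons mulrDl; apply: expsum_add.
  by apply: expsum_scale Tv'; apply: lP; rewrite mem_head.
by apply: IH => j jl; apply: lP; rewrite in_cons jl orbT.
Qed.

Lemma intexpsum_add u u' : intexpsum u -> intexpsum u' -> intexpsum (u + u').
Proof.
move=> [l [lP ->]] [l' [lP' ->]]; exists (l ++ l'); rewrite expsum_val_cat; split=> // i.
by rewrite mem_cat => /orP[/lP|/lP'].
Qed.

Lemma intexpsum_opp u : intexpsum u -> intexpsum (- u).
Proof.
move=> [l [lP ->]]; exists [seq (0 + i.1, - i.2) | i <- l]; split.
  by move=> _ /mapP[i /lP[Zi i0] ->] /=; rewrite add0r; split=> //; apply: intpoly_opp.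
by rewrite (expsum_val_map _ _ (w := -1)) ?expqX0 ?mul1r ?mulN1r// => v; rewrite mulN1r.
Qed.

Lemma emonom_expqX c j : (0 < c)%N -> emonom c j = expqX (exp.ln c%:R) * X ^+ j.
Proof.
by move=> c0; rewrite /emonom /expqX -cst_ln ?ltr0n// rmorph_nat mulrC [X * _]mulrC mulrC.
Qed.

Lemma intexpsum_scale c j u : (0 < c)%N -> intexpsum u -> intexpsum (emonom c j * u).
Proof.
move=> c0 [l [lP ->]]; exists [seq (exp.ln c%:R + i.1, X ^+ j * i.2) | i <- l].
split; last by rewrite (expsum_val_map _ _ (w := X ^+ j)) ?emonom_expqX.
move=> _ /mapP[i /lP[Zi i0] ->] /=; split; first exact: intpoly_mulX.
by rewrite addr_ge0// ln_ge0// ler1n.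
Qed.

Lemma intexpsum_int (n : int) : intexpsum n%:~R.
Proof.
exists [:: (0, n%:~R)]; split; last by rewrite /expsum_val big_seq1 expqX0 mul1r.
by move=> i; rewrite inE => /eqP -> /=; split=> //; apply: intpoly_int.
Qed.

(** ** Exponentially small and exponentially approximable elements *)

Definition expbounded v := exists M : nat, `|v| <= exp (M%:R * X).

Lemma expX_nat_le (M M' : nat) : (M <= M')%N -> exp (M%:R * X) <= exp (M'%:R * X).
Proof. by move=> MM'; rewrite ef_exp_le ler_pM2r// ler_nat. Qed.

Lemma expXS (M : nat) : exp (M.+1%:R * X) = exp (M%:R * X) * exp X.
Proof. by rewrite -ef_expD -natr1 mulrDl mul1r. Qed.

Lemma two_expX (M : nat) : 2 * exp (M%:R * X) <= exp (M.+1%:R * X).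
Proof. by rewrite expXS mulrC ler_pM2l//; exact: nat_le_expX. Qed.

Lemma expbounded_add v v' : expbounded v -> expbounded v' -> expbounded (v + v').
Proof.
move=> [M vM] [M' vM']; exists (M + M').+1.
apply: le_trans (two_expX _); apply: le_trans (ler_normD _ _) _.
have := expX_nat_le (leq_addr M' M); have := expX_nat_le (leq_addl M M').
by lra.
Qed.

Lemma expbounded_term q w : laurent w -> expbounded (expqX q * w).
Proof.
move=> /laurent_upper[M wM]; have [N] := isO1_cst q; rewrite mulr1 => qN.
exists (N + M)%N; rewrite normrM (gtr0_norm (expqX_gt0 q)) natrD mulrDl ef_expD.
apply: ler_pM => //; first exact: ltW.
  by rewrite /expqX ef_exp_le ler_pM2r//; apply: le_trans (ler_norm _) qN.
apply: le_trans wM _; rewrite ef_exp_nat; apply: lerXn2r; rewrite ?nnegrE//.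
exact: X_le_expX.
Qed.

Lemma expsum_expbounded v : expsum v -> expbounded v.
Proof.
move=> [l [lP ->]]; elim: l lP => [|i l IH] lP.
  by exists 0%N; rewrite /expsum_val big_nil normr0.
rewrite /expsum_val big_cons; apply: expbounded_add.
  by apply: expbounded_term; apply: lP; rewrite mem_head.
by apply: IH => j jl; apply: lP; rewrite in_cons jl orbT.
Qed.

Definition expapprox v := forall N : nat,
  exists2 t, expsum t & `|v - t| <= exp (- (N%:R * X)).

Lemma expX_neg_le1 (N : nat) : exp (- (N%:R * X)) <= 1.
Proof. by rewrite -[leRHS](ef_exp0 K) ef_exp_le oppr_le0 mulr_ge0. Qed.

Lemma two_expX_neg (N : nat) : 2 * exp (- (N.+1%:R * X)) <= exp (- (N%:R * X)).
Proof.
rewrite !ef_expN -(@ler_pM2l _ (exp (N.+1%:R * X)))// mulrCA divff ?lt0r_neq0// mulr1.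
rewrite expXS mulrAC divff ?lt0r_neq0// mul1r.
exact: (nat_le_expX 2).
Qed.

Lemma expapprox_expsum v : expsum v -> expapprox v.
Proof. by move=> Tv N; exists v => //; rewrite subrr normr0. Qed.

Lemma expapprox_add v v' : expapprox v -> expapprox v' -> expapprox (v + v').
Proof.
move=> Dv Dv' N; have [t Tt tv] := Dv N.+1; have [t' Tt' tv'] := Dv' N.+1.
exists (t + t'); first exact: expsum_add.
apply: le_trans (two_expX_neg N); rewrite opprD addrACA.
by apply: le_trans (ler_normD _ _) _; rewrite mulr_natl mulr2n; lra.
Qed.

Lemma expapprox_expbounded v : expapprox v -> expbounded v.
Proof.
move=> /(_ 0%N)[t Tt tv]; rewrite -(subrK t v).
apply: expbounded_add; last exact: expsum_expbounded.
by exists 0%N; apply: le_trans tv _; rewrite !mul0r oppr0.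
Qed.

Lemma expapprox_mul v v' : expapprox v -> expapprox v' -> expapprox (v * v').
Proof.
move=> Dv Dv' N; have [M vM] := expapprox_expbounded Dv.
have [M' vM'] := expapprox_expbounded Dv'.
have [t Tt tv] := Dv (N + M + M').+2; have [t' Tt' tv'] := Dv' (N + M + M').+2.
exists (t * t'); first exact: expsum_mul.
have t'M : `|t'| <= exp (M'.+1%:R * X).
  apply: le_trans (two_expX M'); rewrite [leRHS]mulr_natl mulr2n.
  have -> : t' = v' - (v' - t') by ring.
  apply: le_trans (ler_normB _ _) _; apply: lerD => //.
  apply: le_trans tv' _; apply: le_trans (expX_neg_le1 _) _.
  by rewrite -[leLHS](ef_exp0 K) ef_exp_le mulr_ge0.
have -> : v * v' - t * t' = v * (v' - t') + (v - t) * t' by ring.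
apply: le_trans (two_expX_neg N); apply: le_trans (ler_normD _ _) _.
have small_mul (m : nat) (x y : K) : (m <= M + M' + 1)%N -> `|x| <= exp (m%:R * X) ->
    `|y| <= exp (- ((N + M + M').+2%:R * X)) -> `|x * y| <= exp (- (N.+1%:R * X)).
  move=> mM xm ym; rewrite normrM; apply: le_trans (ler_pM _ _ xm ym) _ => //.
  rewrite -ef_expD ef_exp_le.
  have : (m + N.+1)%:R * X <= (N + M + M').+2%:R * X.
    by rewrite ler_pM2r// ler_nat; move: mM; clear; lia.
  by rewrite natrD mulrDl; lra.
have small_vv' : `|v * (v' - t')| <= exp (- (N.+1%:R * X)).
  by apply: (small_mul M) => //; clear; lia.
have small_vt : `|(v - t) * t'| <= exp (- (N.+1%:R * X)).
  by rewrite mulrC; apply: (small_mul M'.+1) => //; clear; lia.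
by lra.
Qed.

Lemma expapprox_cst r : expapprox (cst r).
Proof. exact/expapprox_expsum/expsum_laurent/laurent_cst. Qed.

Lemma expapprox_opp v : expapprox v -> expapprox (- v).
Proof.
move=> Dv; rewrite -mulN1r -(rmorph1 cst) -rmorphN; apply: expapprox_mul Dv.
exact: expapprox_cst.
Qed.

Definition expsmall e := exists m : nat, `|e| <= exp (- (X / m.+1%:R)).

Lemma expsmall_mono (m m' : nat) : (m <= m')%N ->
  exp (- (X / m.+1%:R)) <= exp (- (X / m'.+1%:R)).
Proof.
by move=> mm'; rewrite ef_exp_le lerN2 ler_pM2l// lef_pV2 ?posrE ?ltr0n// ler_nat.
Qed.

Lemma two_expsmall (n m : nat) : n%:R * exp (- (X / m.+1%:R)) <= exp (- (X / m.+2%:R)).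
Proof.
rewrite -(@ler_pM2r _ (exp (X / m.+1%:R)))// -mulrA -!ef_expD addNr ef_exp0 mulr1.
apply: le_trans (_ : 1 + (- (X / m.+2%:R) + X / m.+1%:R) <= _); last exact: ef_exp_ge.
have a0 : 0 < m.+1%:R :> K by rewrite ltr0n.
have b0 : 0 < m.+2%:R :> K by rewrite ltr0n.
have := ef_X_ge_nat K (n * (m.+1 * m.+2))%N; rewrite !natrM => nX.
have : n%:R <= X / m.+1%:R - X / m.+2%:R.
  have -> : X / m.+1%:R - X / m.+2%:R = X / (m.+1%:R * m.+2%:R).
    by rewrite -[m.+2%:R]natr1; field; rewrite ?natr1 !lt0r_neq0.
  by rewrite ler_pdivlMr ?mulr_gt0.
by move: (X / m.+1%:R) (X / m.+2%:R) => x y; lra.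
Qed.

Lemma expsmall_add e e' : expsmall e -> expsmall e' -> expsmall (e + e').
Proof.
move=> [m em] [m' em']; exists (m + m').+1.
apply: le_trans (two_expsmall 2 _); apply: le_trans (ler_normD _ _) _.
have := expsmall_mono (leq_addr m' m); have := expsmall_mono (leq_addl m m').
by lra.
Qed.

Lemma expsmall0 : expsmall 0.
Proof. by exists 0%N; rewrite normr0. Qed.

Lemma expsmall_isO d e : isO `|d| e -> expsmall d -> expsmall e.
Proof.
move=> [N eN] [m dm]; exists m.+1; apply: le_trans eN _.
exact: le_trans (ler_wpM2l (ler0n _ N) dm) (two_expsmall N m).
Qed.

Lemma expsmall_mul a e : isO 1 a -> expsmall e -> expsmall (a * e).
Proof. by move=> a1; apply: expsmall_isO; apply: isO1_mull a1 (isO_norm_id e). Qed.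

Lemma expsmall_term q w : q < 0 -> laurent w -> expsmall (expqX q * w).
Proof.
move=> q0 /laurent_upper[M wM]; have q2 : 0 < - (q / 2) by lra.
have [N] := isO_cst (lt0r_neq0 q2).
rewrite normr1 gtr0_norm -?(rmorph0 cst) ?cst_lt// => Nq.
case: N Nq => [|N] Nq; first by move: Nq; rewrite mul0r ler10.
exists N; rewrite normrM (gtr0_norm (expqX_gt0 q)).
apply: le_trans (_ : expqX q * expqX (- (q / 2)) <= _).
  by rewrite ler_pM2l//; apply: le_trans wM (exprn_le_expqX M q2).
rewrite -expqXD (_ : q + _ = q / 2); last by lra.
rewrite /expqX ef_exp_le mulrC -mulrN ler_pM2l// lerNr -rmorphN -[leLHS]div1r.
by rewrite ler_pdivrMr ?ltr0n// mulrC.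
Qed.

Lemma expsmall_infinitesimal e : expsmall e -> infinitesimal e.
Proof.
move=> [m em] n; apply: le_trans (ler_wpM2l (ler0n _ n) em) _.
apply: le_trans (two_expsmall n m) _.
by rewrite -[leRHS](ef_exp0 K) ef_exp_le oppr_le0 divr_ge0.
Qed.

Lemma isO_X_expsmall e : expsmall e -> isO X e.
Proof.
move=> /expsmall_infinitesimal/infinitesimal_isO1 e1; apply: isO_trans e1 _.
by exists 1%N; rewrite normr1 mul1r.
Qed.

Lemma expapprox_taylor phi e : taylor phi -> expapprox e -> expsmall e ->
  expapprox (phi e).
Proof.
move=> Tphi De se N; have [m em] := se.
have [c [C cP]] := Tphi (m.+1 * N.+2)%N.
have e2 : `|e| <= 2^-1 by have := expsmall_infinitesimal se 2; lra.
have Dp n : expapprox (\sum_(i < n) cst (c i) * e ^+ i).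
  elim: n => [|n IH]; first by rewrite big_ord0; apply/expapprox_expsum/expsum_0.
  rewrite big_ord_recr; apply: expapprox_add => //; apply: expapprox_mul.
    exact: expapprox_cst.
  elim: (n : nat) => [|k IHk]; last by rewrite exprS; apply: expapprox_mul.
  by rewrite expr0 -(rmorph1 cst); apply: expapprox_cst.
have [t Tt ht] := Dp (m.+1 * N.+2)%N N.+1; exists t => //.
apply: le_trans (two_expX_neg N).
rewrite -(subrK (\sum_(i < m.+1 * N.+2) cst (c i) * e ^+ i) (phi e)) -addrA.
apply: le_trans (ler_normD _ _) _; rewrite [leRHS]mulr_natl mulr2n; apply: lerD => //.
apply: le_trans (cP _ e2) _.
apply: le_trans (_ : C%:R * exp (- (N.+2%:R * X)) <= _).
  apply: ler_wpM2l => //.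
  apply: le_trans (lerXn2r _ _ _ em) _; rewrite ?nnegrE// -ef_exp_nat ef_exp_le.
  rewrite mulrN lerN2 natrM mulrAC mulrCA divff ?pnatr_eq0// mulr1.
  by rewrite mulrC.
rewrite !ef_expN [in leLHS]expXS invfM mulrCA -[leRHS]mulr1 ler_pM2l ?invr_gt0//.
by rewrite ler_pdivrMr// mul1r nat_le_expX.
Qed.

(** ** Normal forms of elements of size O(X) *)

Definition negligible (c x : K) := forall M : nat, X ^+ M * `|x| <= c.

Lemma negligible_half c x (M : nat) : negligible c x -> 2 * (X ^+ M * `|x|) <= c.
Proof.
move=> /(_ M.+1); apply: le_trans; rewrite exprS -mulrA.
by apply: ler_wpM2r (ef_X_ge_nat K 2); rewrite mulr_ge0 ?exprn_ge0.
Qed.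

Lemma negligibleD c x y : negligible c x -> negligible c y -> negligible c (x + y).
Proof.
move=> /negligible_half nx /negligible_half ny i.
apply: le_trans (ler_wpM2l (exprn_ge0 i X_ge0) (ler_normD x y)) _.
by have := nx i; have := ny i; rewrite mulrDr; lra.
Qed.

Lemma negligible_expqX q q0 b : q < q0 -> poly_upper b ->
  negligible (expqX q0) (expqX q * b).
Proof.
move=> qq0 [j bj] i; rewrite normrM (gtr0_norm (expqX_gt0 q)) mulrCA.
rewrite -[q0](subrK q) addrC expqXD ler_pM2l//.
apply: le_trans (_ : X ^+ i * X ^+ j <= _); first by rewrite ler_pM2l ?exprn_gt0.
by rewrite -exprD; apply: exprn_le_expqX; rewrite subr_gt0.
Qed.

Lemma expqX_dominant_eq0 q b x : 0 < q -> poly_lower b -> negligible (expqX q) x ->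
  isO X (expqX q * b + x) -> b = 0.
Proof.
move=> q0 [//|[M bM]] nx [N vN]; exfalso; have XM : 0 < X ^+ M by apply: exprn_gt0.
have qb : expqX q * `|b| <= N%:R * X + `|x|.
  rewrite -(gtr0_norm (expqX_gt0 q)) -normrM.
  by have := ler_normB (expqX q * b + x) x; rewrite addrK; lra.
have q_le : expqX q <= X ^+ M * (N%:R * X) + X ^+ M * `|x|.
  rewrite -mulrDr; apply: le_trans (_ : X ^+ M * (expqX q * `|b|) <= _); last first.
    by rewrite ler_pM2l.
  by rewrite mulrCA ler_peMr// ltW.
have x_le := negligible_half M nx.
have XM2 : X ^+ M * (N%:R * X) <= X ^+ M.+2.
  by rewrite exprSr exprSr -mulrA ler_pM2l// ler_pM2r// ef_X_ge_nat.
have := exprn_le_expqX M.+3 q0; rewrite exprS; have : 0 < X ^+ M.+2 by apply: exprn_gt0.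
by have := ef_X_gt_nat K 2; nra.
Qed.

Lemma isO_X_rates (s : seq R) (b : R -> K) : uniq s ->
  (forall q, poly_upper (b q)) -> (forall q, poly_lower (b q)) ->
  isO X (\sum_(q <- s) expqX q * b q) -> forall q, q \in s -> 0 < q -> b q = 0.
Proof.
move=> us b_upper b_lower vO q1 q1s q1_gt0; apply/eqP; apply/negP => /negP bq1.
have [|q0 [q0s /andP[q0_gt0 bq0] q0max]] :=
  @seq_max _ _ (fun q => (0 < q) && (b q != 0)) s.
  by apply/hasP; exists q1 => //; rewrite q1_gt0.
case/eqP: bq0; rewrite (bigD1_seq q0)//= in vO.
apply: (expqX_dominant_eq0 q0_gt0 (b_lower q0) _ vO).
have negl0 : negligible (expqX q0) 0 by move=> i; rewrite normr0 mulr0 ltW.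
rewrite big_seq_cond; elim/big_ind: _ => // [|q /andP[qs qq0]]; first exact: negligibleD.
have [->|bq] := eqVneq (b q) 0; first by rewrite mulr0.
apply: negligible_expqX => //; have [q_le0|q_gt0] := leP q 0.
  exact: le_lt_trans q0_gt0.
by rewrite lt_neqAle qq0 q0max// q_gt0.
Qed.

Lemma expsum_coef_closed (Q : set K) (l : seq (R * K)) q : Q 0 ->
  (forall a b, Q a -> Q b -> Q (a + b)) -> (forall i, i \in l -> Q i.2) ->
  Q (expsum_coef l q).
Proof.
move=> Q0 QD Ql; rewrite /expsum_coef big_seq_cond.
by elim/big_ind: _ => // i /andP[/Ql].
Qed.

Lemma isO_X_coef (lu lt : seq (R * K)) q :
  (forall i, i \in lu -> laurent i.2) -> (forall i, i \in lt -> laurent i.2) ->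
  isO X (expsum_val lu * ln X + expsum_val lt) -> 0 < q ->
  expsum_coef lu q = 0 /\ expsum_coef lt q = 0.
Proof.
move=> luP ltP vO q0; have laurent0 : laurent 0.
  by rewrite -(rmorph0 cst); apply: laurent_cst.
have Lu p : laurent (expsum_coef lu p).
  by apply: expsum_coef_closed => //; exact: laurent_add.
have Lt p : laurent (expsum_coef lt p).
  by apply: expsum_coef_closed => //; exact: laurent_add.
pose s := undup (q :: [seq i.1 | i <- lu ++ lt]).
have us : uniq s by apply: undup_uniq.
have vE : expsum_val lu * ln X + expsum_val lt =
    \sum_(p <- s) expqX p * (expsum_coef lu p * ln X + expsum_coef lt p).
  rewrite !(expsum_val_coef us) ?mulr_suml -?big_split.
  - by apply: eq_bigr => p _ /=; rewrite mulrDr mulrA.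
  - by move=> p pl; rewrite mem_undup in_cons map_cat mem_cat pl !orbT.
  - by move=> p pl; rewrite mem_undup in_cons map_cat mem_cat pl orbT.
rewrite vE in vO; apply: laurent_lnX_eq0 => //.
apply: (isO_X_rates us _ _ vO) => // [p|p|]; [| |by rewrite mem_undup mem_head].
  exact: laurent_lnX_upper.
exact: laurent_lnX_lower.
Qed.

Lemma expsum_val_split (l : seq (R * K)) : exists2 s : seq R, uniq s &
  expsum_val l - expsum_coef l 0 = \sum_(q <- s | q != 0) expqX q * expsum_coef l q.
Proof.
pose s := undup (0 :: [seq i.1 | i <- l]); exists s; first exact: undup_uniq.
have s0 : 0 \in s by rewrite mem_undup mem_head.
rewrite (@expsum_val_coef s) ?undup_uniq//; last first.
  by move=> q ql; rewrite mem_undup in_cons ql orbT.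
by rewrite (bigD1_seq 0) ?undup_uniq//= expqX0 mul1r addrAC subrr add0r.
Qed.

Lemma expsmall_expsum_tail (l : seq (R * K)) : (forall i, i \in l -> laurent i.2) ->
  (forall q, 0 < q -> expsum_coef l q = 0) ->
  expsmall (expsum_val l - expsum_coef l 0).
Proof.
move=> lP pos0; have [s _ ->] := expsum_val_split l.
elim/big_ind: _ => [||q q0]; [exact: expsmall0|exact: expsmall_add|].
have [q_lt|q_gt|/eqP] := ltgtP q 0; last by rewrite (negbTE q0).
  apply: expsmall_term q_lt _; apply: expsum_coef_closed => //; last exact: laurent_add.
  by rewrite -(rmorph0 cst); apply: laurent_cst.
by rewrite pos0// mulr0; apply: expsmall0.
Qed.

Lemma expsum_val_coef0 (l : seq (R * K)) : (forall i, i \in l -> 0 <= i.1) ->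
  (forall q, 0 < q -> expsum_coef l q = 0) -> expsum_val l = expsum_coef l 0.
Proof.
move=> l_ge0 pos0; apply/eqP; rewrite -subr_eq0; have [s _ ->] := expsum_val_split l.
apply/eqP; apply: big1 => q q0.
have [q_lt|q_gt|/eqP] := ltgtP q 0; last by rewrite (negbTE q0).
  rewrite /expsum_coef big1_seq ?mulr0// => i /andP[/eqP iq /l_ge0].
  by rewrite iq leNgt q_lt.
by rewrite pos0// mulr0.
Qed.

Lemma normal_form u D : intexpsum u -> expapprox D -> isO X (u * ln X + D) ->
  exists (n : int) r s a e, [/\ analytic a, expapprox e, expsmall e, u = n%:~R &
    D = cst r * X + cst s + X^-1 * a + e].
Proof.
move=> [lu [luP uE]] DD vO; have [t [lt [ltP tE]] Dt] := DD 1%N.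
have small_Dt : expsmall (D - t) by exists 0%N; apply: le_trans Dt _; rewrite mul1r divr1.
have lu_laurent i : i \in lu -> laurent i.2 by move=> /luP[/intpoly_laurent].
have pos0 q : 0 < q -> expsum_coef lu q = 0 /\ expsum_coef lt q = 0.
  apply: isO_X_coef => //; rewrite -uE -tE (_ : _ + t = (u * ln X + D) - (D - t)).
    by apply: isOB => //; apply: isO_X_expsmall.
  by ring.
set z := expsum_coef lu 0; set w := expsum_coef lt 0.
have intpoly_z : intpoly z.
  by apply: expsum_coef_closed; [exact: intpoly0|exact: intpoly_add|move=> i /luP[]].
have laurent_w : laurent w.
  apply: expsum_coef_closed ltP; last exact: laurent_add.
  by rewrite -(rmorph0 cst); apply: laurent_cst.
have uz : u = z.
  by rewrite uE; apply: expsum_val_coef0 => [i /luP[]//|q /pos0[]].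
have small_tw : expsmall (t - w).
  by rewrite tE; apply: expsmall_expsum_tail => // q /pos0[].
have small_Dw : expsmall (D - w).
  by rewrite (_ : D - w = (D - t) + (t - w)); [exact: expsmall_add|ring].
have zwO : isO X (z * ln X + w).
  rewrite (_ : _ + w = (u * ln X + D) - (D - w)); last by rewrite uz; ring.
  by apply: isOB => //; apply: isO_X_expsmall.
have z1 := isO_X_lnX (intpoly_laurent intpoly_z) laurent_w zwO.
have [n nE] : exists n : int, z = n%:~R.
  have [//|XZ] := intpoly_cases intpoly_z; exfalso; have [N zN] := z1.
  by have := ef_X_gt_nat K (2 * N)%N; rewrite natrM; rewrite mulr1 in zN; lra.
have wO : isO X w.
  rewrite (_ : w = z * ln X + w - z * ln X); last by ring.
  apply: isOB => //; apply: isO1_mull z1 _; exists 1%N.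
  by rewrite gtr0_norm// mul1r -[leLHS]mul1r; apply: (ef_lnX_le_X K 1).
have [r [s [a [Aa wE]]]] := laurent_isO_X laurent_w wO.
exists n, r, s, a, (D - w); split=> //; last by rewrite -wE; ring.
  by apply: expapprox_add => //; apply/expapprox_opp/expapprox_expsum/expsum_laurent.
by rewrite uz.
Qed.

Lemma lnX_le_normal (n : int) r y : 0 < r -> isO 1 y ->
  ln X <= n%:~R * ln X + cst r * X + y.
Proof.
move=> r0 [N]; rewrite mulr1 => yN; have := lnX_le_cstX (`|n|%N + N + 1) r0.
have /lerNnormlW : `|n%:~R * ln X| <= `|n|%N%:R * ln X :> K.
  by rewrite normrM (gtr0_norm lnX_gt0) -intr_norm -abszE.
have := ler_wpM2l (ler0n K N) (ltW (ef_lnX_gt_nat K 1)).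
by rewrite !natrD !mulrDl mul1r mulr1; have := lerNnormlW yN; lra.
Qed.

Lemma normal_le_lnX (n : int) r y : r < 0 -> isO 1 y ->
  n%:~R * ln X + cst r * X + y <= - ln X.
Proof.
move=> r0 y1; have rN : 0 < - r by rewrite oppr_gt0.
have := @lnX_le_normal (- n) (- r) (- y) rN (proj2 (isON _ _) y1).
by rewrite mulrNz rmorphN !mulNr -!opprD lerNr.
Qed.

Lemma normal_zero_rate (n : int) y : isO 1 y ->
  if 0 < n then exists C : nat, ln X - C%:R <= n%:~R * ln X + y
  else exists C : nat, n%:~R * ln X + y <= C%:R.
Proof.
move=> [N]; rewrite mulr1 ler_norml => /andP[y1 y2]; case: ifPn => [n0|]; exists N.
  have : ln X <= n%:~R * ln X.
    by apply: ler_peMl; [exact: ltW|rewrite ler1z -gtz0_ge1].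
  by lra.
have : n%:~R * ln X <= 0 by rewrite pmulr_lle0// lerz0 leNgt.
by lra.
Qed.

Lemma isO1_normal_rest s a e : analytic a -> expsmall e -> isO 1 (cst s + X^-1 * a + e).
Proof.
move=> Aa se; apply: isOD; last exact/infinitesimal_isO1/expsmall_infinitesimal.
by apply: isOD; [exact: isO1_cst|exact/infinitesimal_isO1/analytic_infinitesimal].
Qed.

(** ** Expansions of tame elements *)

Lemma exp_int_lnX (n : int) : exp (n%:~R * ln X) = X ^ n.
Proof.
case: n => m; first by rewrite -exprnP ef_exp_nat ef_lnK.
by rewrite NegzE intrN mulNr ef_expN ef_exp_nat ef_lnK// -exprnN.
Qed.

Lemma expapprox_exp_sub1 e : expapprox e -> expsmall e ->
  expapprox (exp e - 1) /\ expsmall (exp e - 1).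
Proof.
move=> De se; split.
  apply: expapprox_add; first exact: expapprox_taylor.
  by apply: expapprox_opp; rewrite -(rmorph1 cst); apply: expapprox_cst.
apply: (expsmall_isO _ se); apply: isO_expB1 (isO_norm_id e).
exact: infinitesimal_isO1 (expsmall_infinitesimal se).
Qed.

Lemma expapprox_ln1p_small v : (forall N : nat, v < - (N%:R * X)) ->
  expapprox (ln (1 + exp v)).
Proof.
move=> vN N; exists 0; first exact: expsum_0.
have v_gt0 := exp_gt0 v; have := @ef_ln_leB1 K (1 + exp v) ltac:(lra).
rewrite subr0 addrAC subrr add0r ger0_norm; last by apply: ef_ln_ge0; lra.
by move=> /le_trans; apply; rewrite ef_exp_le ltW.
Qed.

Lemma expapprox_ln1p_analytic w e : analytic w -> 0 < w ->
  expapprox e -> expsmall e -> expapprox (ln (1 + w * exp e)).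
Proof.
move=> Aw w0 De se; have w1 : 0 < 1 + w by lra.
have A1 : analytic 1 by rewrite -(rmorph1 cst).
have A1w : analytic (1 + w) by exact: analytic_add.
have Al : analytic (ln (1 + w)) by apply: analytic_ln => //; lra.
have Ai : analytic (1 + w)^-1.
  rewrite -(ef_lnK w1) -ef_expN; apply: analytic_exp; rewrite -mulN1r.
  by apply: analytic_mul => //; rewrite -(rmorph1 cst) -rmorphN.
have [De1 se1] := expapprox_exp_sub1 De se.
pose d := w * (1 + w)^-1 * (exp e - 1).
have sd : expsmall d by apply: expsmall_mul se1; apply/analytic_isO1/analytic_mul.
have Dd : expapprox d.
  apply: expapprox_mul De1.
  exact/expapprox_expsum/expsum_laurent/laurent_analytic/analytic_mul.
have d1 : 0 < 1 + d.
  have := expsmall_infinitesimal sd 2; have [? ?|? ?] := ger0P d; lra.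
have -> : ln (1 + w * exp e) = ln (1 + w) + ln (1 + d).
  by rewrite -ef_lnM//; congr ln; rewrite /d; field; exact: lt0r_neq0.
apply: expapprox_add; first exact/expapprox_expsum/expsum_laurent/laurent_analytic.
exact: (@expapprox_taylor (fun e => ln (1 + e)) d).
Qed.

Lemma expapprox_ln1pexp_normal (n : int) r s a e :
  analytic a -> expapprox e -> expsmall e ->
  let v := n%:~R * ln X + (cst r * X + cst s + X^-1 * a + e) in
  v <= 0 -> expapprox (ln (1 + exp v)).
Proof.
move=> Aa De se v v0; have y1 := isO1_normal_rest s Aa se.
have vE : v = n%:~R * ln X + cst r * X + (cst s + X^-1 * a + e) by rewrite /v; ring.
have As : analytic (exp (cst s + X^-1 * a)).
  by apply/analytic_exp/analytic_add => //; apply: analytic_mul.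
have evE : exp v = expqX r * (X ^ n * exp (cst s + X^-1 * a)) * exp e.
  by rewrite vE -exp_int_lnX /expqX -!ef_expD; congr (exp _); ring.
have [r_lt|r_gt|r0] := ltgtP r 0.
- have Lw : laurent (X ^ n * exp (cst s + X^-1 * a)).
    by apply: laurent_mul; [exact: laurent_exprz|exact: laurent_analytic].
  rewrite evE; apply: (@expapprox_taylor (fun e => ln (1 + e))) => //.
    apply: expapprox_mul; first exact/expapprox_expsum/expsum_expqX.
    exact: expapprox_taylor.
  rewrite mulrC; apply: expsmall_mul (expsmall_term r_lt Lw).
  exact/isO1_exp/infinitesimal_isO1/expsmall_infinitesimal.
- by have := lnX_le_normal n r_gt y1; rewrite -vE; have := lnX_gt0; lra.
have n0 : n <= 0.
  rewrite leNgt; apply/negP => n_gt0; have := normal_zero_rate n y1; rewrite n_gt0.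
  move=> [C]; have := ef_lnX_gt_nat K C.
  by rewrite vE r0 rmorph0 mul0r addr0 in v0; lra.
rewrite evE r0 expqX0 mul1r; apply: expapprox_ln1p_analytic => //; last first.
  by rewrite mulr_gt0// exprz_gt0.
apply: analytic_mul => //; case: n n0 {v v0 vE evE} => [[|m]|m] // _.
  by rewrite expr0z -(rmorph1 cst).
by rewrite NegzE -exprnN; apply: analytic_XVn.
Qed.

Lemma expapprox_ln1pexp u D : intexpsum u -> expapprox D -> u * ln X + D <= 0 ->
  expapprox (ln (1 + exp (u * ln X + D))).
Proof.
move=> Uu DD v0; set v := _ + D in v0 *.
have [[N vN]|v_small] := pselect (exists N : nat, - (N%:R * X) <= v); last first.
  apply: expapprox_ln1p_small => N; rewrite ltNge; apply/negP => vN.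
  by apply: v_small; exists N.
have vO : isO X v by exists N; rewrite ler0_norm//; lra.
have [n [r [s [a [e [Aa De se uE DE]]]]]] := normal_form Uu DD vO.
by rewrite /v uE DE in v0 *; exact: expapprox_ln1pexp_normal.
Qed.

Lemma tame_expansion_add f g u u' D D' : 0 < f -> 0 < g -> f <= g ->
  intexpsum u -> intexpsum u' -> expapprox D -> expapprox D' ->
  ln f = u * ln X + D -> ln g = u' * ln X + D' ->
  exists2 D2, expapprox D2 & ln (f + g) = u' * ln X + D2.
Proof.
move=> f0 g0 fg Uu Uu' DD DD' fE gE.
have vE : (u - u') * ln X + (D - D') = ln f - ln g by rewrite fE gE; ring.
exists (D' + ln (1 + exp ((u - u') * ln X + (D - D')))).
  apply: expapprox_add => //; apply: expapprox_ln1pexp.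
  - by apply: intexpsum_add => //; apply: intexpsum_opp.
  - by apply: expapprox_add => //; apply: expapprox_opp.
  - by rewrite vE subr_le0 ef_ln_le.
rewrite addrA -gE vE -ef_ln_div// ef_lnK ?divr_gt0// -ef_lnM//.
  by congr ln; field; exact: lt0r_neq0.
by have := divr_gt0 f0 g0; lra.
Qed.

Lemma tame_expansion h : tame h ->
  exists u D, [/\ intexpsum u, expapprox D & ln h = u * ln X + D].
Proof.
have D0 : expapprox 0 by apply/expapprox_expsum/expsum_0.
elim=> [||f g Tf [u [D [Uu DD fE]]] Tg [u' [D' [Uu' DD' gE]]]|
          f g Tf [u [D [Uu DD fE]]] Tg [u' [D' [Uu' DD' gE]]]|
          f c j c0 Tf [u [D [Uu DD fE]]]].
- exists 0, 0; split=> //; first exact: (intexpsum_int 0).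
  by rewrite ef_ln1 mul0r addr0.
- by exists 1, 0; split=> //; [exact: (intexpsum_int 1)|rewrite mul1r addr0].
- have f0 := tame_gt0 Tf; have g0 := tame_gt0 Tg.
  have [fg|/ltW gf] := leP f g.
    by have [D2] := tame_expansion_add f0 g0 fg Uu Uu' DD DD' fE gE; exists u', D2.
  have [D2] := tame_expansion_add g0 f0 gf Uu' Uu DD' DD gE fE.
  by exists u, D2; rewrite addrC.
- exists (u + u'), (D + D'); split; [exact: intexpsum_add|exact: expapprox_add|].
  by rewrite ef_lnM ?tame_gt0// fE gE; ring.
- exists (emonom c j * u), (emonom c j * D); split; first exact: intexpsum_scale.
    apply: expapprox_mul => //; rewrite emonom_expqX//.
    by apply/expapprox_expsum/expsum_expqX; rewrite exprnP; apply: laurent_exprz.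
  by rewrite ef_expK fE; ring.
Qed.

Lemma normal_gap (n : int) r y : isO 1 y -> let v := n%:~R * ln X + cst r * X + y in
  (exists C : nat, v <= C%:R) \/ exists C : nat, ln X - C%:R <= v.
Proof.
move=> y1 v; have [r_lt|r_gt|r0] := ltgtP r 0.
- by left; exists 0%N; have := normal_le_lnX n r_lt y1; rewrite -/v; have := lnX_gt0; lra.
- by right; exists 0%N; rewrite subr0; apply: lnX_le_normal.
have := normal_zero_rate n y1; rewrite /v r0 rmorph0 mul0r addr0.
by case: ifP => _; [right|left].
Qed.

Lemma expansion_gap u D : intexpsum u -> expapprox D -> let v := u * ln X + D in
  (exists C : nat, v <= C%:R) \/ exists C : nat, ln X - C%:R <= v.
Proof.
move=> Uu DD v; have [v0|v0] := leP v 0; first by left; exists 0%N.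
have [vX|Xv] := leP v X; last first.
  by right; exists 0%N; have := ef_lnX_le_X K 1; lra.
have vO : isO X v by exists 1%N; rewrite mul1r gtr0_norm.
have [n [r [s [a [e [Aa De se uE DE]]]]]] := normal_form Uu DD vO.
have -> : v = n%:~R * ln X + cst r * X + (cst s + X^-1 * a + e).
  by rewrite /v uE DE; ring.
exact/normal_gap/isO1_normal_rest.
Qed.

Lemma isO_of_ln_le f g (C : nat) : 0 < f -> 0 < g -> ln f <= ln g + C%:R -> isO g f.
Proof.
move=> f0 g0 fg; exists (4 ^ C)%N; rewrite gtr0_norm//.
apply: le_trans (_ : exp C%:R * g <= _); last by rewrite ler_pM2r//; apply: ef_exp_nat_le.
by rewrite -{1}(ef_lnK f0) -{1}(ef_lnK g0) -ef_expD ef_exp_le addrC.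
Qed.

Theorem tame_gap f g : tame f -> tame g -> isO g f \/ isO f (g * X).
Proof.
move=> Tf Tg; have f0 := tame_gt0 Tf; have g0 := tame_gt0 Tg.
have [u [D [Uu DD fE]]] := tame_expansion Tf.
have [u' [D' [Uu' DD' gE]]] := tame_expansion Tg.
have Uuu : intexpsum (u - u') by apply: intexpsum_add => //; apply: intexpsum_opp.
have DDD : expapprox (D - D') by apply: expapprox_add => //; apply: expapprox_opp.
have vE : (u - u') * ln X + (D - D') = ln f - ln g by rewrite fE gE; ring.
have := expansion_gap Uuu DDD; rewrite /= vE => -[[C fg]|[C gf]]; [left|right].
  by apply: (@isO_of_ln_le _ _ C) => //; lra.
by apply: (@isO_of_ln_le _ _ C); rewrite ?mulr_gt0// ef_lnM//; lra.
Qed.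

End Gap.

(** * Real analytic functions *)

Section Derivatives.
Variable R : realType.
Implicit Types (f g : R -> R) (a b x y l m s t B C D M eta : R).

Definition der f x l := is_derive x 1 f l.

Lemma der_uniq f x l m : der f x l -> der f x m -> l = m.
Proof. by move=> [_ <-] [_ <-]. Qed.

Lemma derE f x l m : l = m -> der f x l -> der f x m. Proof. by move=> ->. Qed.

Lemma der_cst c x : der (fun=> c) x 0. Proof. exact: is_derive_cst. Qed.

Lemma der_id x : der (fun y => y) x 1. Proof. exact: is_derive_id. Qed.

Lemma derD f g x l m : der f x l -> der g x m -> der (fun y => f y + g y) x (l + m).
Proof. exact: is_deriveD. Qed.

Lemma derN f x l : der f x l -> der (fun y => - f y) x (- l).
Proof. exact: is_deriveN. Qed.

Lemma derB f g x l m : der f x l -> der g x m -> der (fun y => f y - g y) x (l - m).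
Proof. by move=> fl gm; apply: derD fl _; apply: derN. Qed.

Lemma derM f g x l m : der f x l -> der g x m ->
  der (fun y => f y * g y) x (l * g x + f x * m).
Proof.
move=> fl gm; apply: (derE _ (is_deriveM fl gm)).
by rewrite addrC; congr (_ + _); rewrite /GRing.scale /= mulrC.
Qed.

Lemma derZ c f x l : der f x l -> der (fun y => c * f y) x (c * l).
Proof.
by move=> fl; apply: derE (derM (der_cst c x) fl); rewrite mul0r add0r.
Qed.

Lemma der_comp f g x l m : der f (g x) l -> der g x m ->
  der (fun y => f (g y)) x (l * m).
Proof. exact: is_derive1_comp. Qed.

Lemma der_exp f x l : der f x l -> der (fun y => expR (f y)) x (l * expR (f x)).
Proof.
by move=> fl; apply: derE (der_comp (is_derive_expR (f x)) fl); rewrite mulrC.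
Qed.

Lemma der_ln f x l : 0 < f x -> der f x l -> der (fun y => ln (f y)) x (l / f x).
Proof.
move=> f0 fl; apply: derE (der_comp (is_derive1_ln f0) fl); rewrite mulrC //.
Qed.

Lemma der_inv f x l : f x != 0 -> der f x l ->
  der (fun y => (f y)^-1) x (- l * (f x)^-1 * (f x)^-1).
Proof.
move=> f0 fl; apply: derE (is_deriveV f0 fl).
by rewrite /GRing.scale /= expr2 invfM; ring.
Qed.

Lemma der_exprn f x l n : der f x l ->
  der (fun y => f y ^+ n.+1) x (n.+1%:R * l * f x ^+ n).
Proof.
move=> fl; elim: n => [|n IH]; first by rewrite expr0 mulr1 mul1r.
have := derM fl IH; rewrite -/(der _ _ _) => dM.
have -> : (fun y => f y ^+ n.+2) = (fun y => f y * f y ^+ n.+1).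
  by apply/funext => y; rewrite exprS.
by apply: derE dM; rewrite -[n.+2%:R]natr1 !exprS; ring.
Qed.

Lemma der_near f g x l : (\near x, f x = g x) -> der f x l -> der g x l.
Proof. exact: near_eq_is_derive. Qed.

Lemma der_ext a b f g x l : a < x < b -> (forall y, a < y < b -> f y = g y) ->
  der f x l -> der g x l.
Proof.
move=> xab fg; apply: der_near; near=> y; apply: fg.
have : y \in `]a, b[ by near: y; apply: near_in_itvoo; rewrite in_itv.
by rewrite in_itv.
Unshelve. all: by end_near. Qed.

Lemma der_mvt f (f' : R -> R) x y : x < y ->
  (forall z, x <= z <= y -> der f z (f' z)) ->
  exists2 c, x < c < y & f y - f x = f' c * (y - x).
Proof.
move=> xy fd; have [||c] := @MVT R f f' x y xy.
- by move=> z; rewrite in_itv /= => /andP[/ltW xz /ltW zy]; apply: fd; rewrite xz.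
- by apply: derivable_within_continuous => z; rewrite in_itv /= => /fd[].
- by rewrite in_itv /= => xcy fyx; exists c.
Qed.

Lemma der_nondecreasing f (f' : R -> R) x y : x <= y ->
  (forall z, x <= z <= y -> der f z (f' z)) -> (forall z, x < z < y -> 0 <= f' z) ->
  f x <= f y.
Proof.
rewrite le_eqVlt => /orP[/eqP->//|xy fd f0]; have [c xcy fyx] := der_mvt xy fd.
by rewrite -subr_ge0 fyx mulr_ge0 ?f0// subr_ge0 ltW.
Qed.

(** ** Sequences of derivatives *)

Definition dertower a b (F : nat -> R -> R) :=
  forall k x, a < x < b -> der (F k) x (F k.+1 x).

Definition shift (T : Type) (F : nat -> T) k := F k.+1.

Lemma dertower_shift a b F : dertower a b F -> dertower a b (shift F).
Proof. by move=> dF k x xab; apply: dF. Qed.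

Fixpoint leibniz (u v : nat -> R) k : R :=
  if k is k'.+1 then leibniz (shift u) v k' + leibniz u (shift v) k' else u 0%N * v 0%N.

Lemma leibnizE u v k : leibniz u v k = \sum_(i < k.+1) 'C(k, i)%:R * u i * v (k - i)%N.
Proof.
elim: k u v => [|k IH] u v; first by rewrite big_ord1 /= mul1r.
rewrite /= !IH [in RHS]big_ord_recl /= subn0 bin0 mul1r.
rewrite [X in _ + X = _]big_ord_recl /= subn0 bin0 mul1r addrCA; congr (_ + _).
rewrite [in RHS](eq_bigr (fun i : 'I_k.+1 =>
   'C(k, i)%:R * u i.+1 * v (k - i)%N + 'C(k, i.+1)%:R * u i.+1 * v (k - i)%N)).
  rewrite big_split /=; congr (_ + _).
  rewrite [in RHS]big_ord_recr /= bin_small// mul0r mul0r addr0.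
  apply: eq_bigr => i _; rewrite /bump leq0n add1n /shift; congr (_ * v _).
  by rewrite subnSK.
move=> i _; rewrite /bump leq0n add1n binS natrD subSS; ring.
Qed.

Definition leibniz_fun (F G : nat -> R -> R) k x := leibniz (F^~ x) (G^~ x) k.

Lemma dertower_leibniz a b F G :
  dertower a b F -> dertower a b G -> dertower a b (leibniz_fun F G).
Proof.
move=> dF dG k x xab; rewrite /leibniz_fun /=; elim: k F G dF dG => [|k IH] F G dF dG /=.
  exact: derM (dF _ _ xab) (dG _ _ xab).
apply: derD; [apply: (IH (shift F) G)|apply: (IH F (shift G))] => //.
  exact: dertower_shift.
exact: dertower_shift.
Qed.

Lemma dertower_uniq a b F G : dertower a b F -> dertower a b G ->
  (forall x, a < x < b -> F 0%N x = G 0%N x) ->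
  forall k x, a < x < b -> F k x = G k x.
Proof.
move=> dF dG FG; elim=> [//|k IH] x xab; apply: der_uniq (dF _ _ xab) _.
by apply: (der_ext xab _ (dG _ _ xab)) => y yab; rewrite IH.
Qed.

Definition const_tower (c : R) k (x : R) := if k is 0 then c else 0.

Lemma dertower_const a b c : dertower a b (const_tower c).
Proof. by case=> [|k] x _; apply: der_cst. Qed.

Lemma dertower_linear a b A (y : R -> R) : dertower a b A ->
  (forall x, a < x < b -> der y x (A 0%N x * y x)) ->
  exists2 G, dertower a b G & G 0%N = y.
Proof.
move=> dA dy.
pose C := fix C k := if k is k'.+1 then
  fun j x => C k' j.+1 x + leibniz_fun (C k') A j x else const_tower 1.
have dC k : dertower a b (C k).
  elim: k => [|k IH]; first exact: dertower_const.
  move=> j x xab; apply: derD; first exact: (IH j.+1).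
  exact: (dertower_leibniz IH dA).
exists (fun k x => C k 0%N x * y x); last by apply/funext => x; rewrite /= mul1r.
move=> k x xab; apply: derE (derM (dC k 0%N x xab) (dy x xab)).
by rewrite /= /leibniz_fun /=; ring.
Qed.

Lemma dertower_inv a b F : dertower a b F -> (forall x, a < x < b -> F 0%N x != 0) ->
  exists2 G, dertower a b G & G 0%N = (fun x => (F 0%N x)^-1).
Proof.
move=> dF F0.
pose C := fix C k := if k is k'.+1 then
  fun j x => leibniz_fun (shift (C k')) F j x -
    k'.+1%:R * leibniz_fun (C k') (shift F) j x
  else const_tower 1.
have dC k : dertower a b (C k).
  elim: k => [|k IH]; first exact: dertower_const.
  move=> j x xab; apply: derB; first exact: (dertower_leibniz (dertower_shift IH) dF).
  by apply: derZ; apply: (dertower_leibniz IH (dertower_shift dF)).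
exists (fun k x => C k 0%N x * (F 0%N x)^-1 ^+ k.+1); last first.
  by apply/funext => x; rewrite /= mul1r expr1.
move=> k x xab; have Fx := F0 _ xab.
have dz := der_exprn k (der_inv Fx (dF _ _ xab)).
apply: derE (derM (dC k 0%N x xab) dz).
rewrite /= /leibniz_fun /shift /= !exprS; set z := (F 0%N x)^-1.
have Fz : F 0%N x * z = 1 by rewrite divff.
rewrite [X in X + _ = _](_ : _ = C k 1%N x * (F 0%N x * z) * (z * z ^+ k)).
  by ring.
by rewrite Fz mulr1.
Qed.

(** ** Bounds on derivatives *)

Definition cauchy_bound a b (C M : R) (F : nat -> R -> R) := dertower a b F /\
  forall k x, a < x < b -> `|F k x| <= C * M ^+ k * k`!%:R.

Lemma cauchy_bound0 a b C M F x : cauchy_bound a b C M F -> a < x < b ->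
  `|F 0%N x| <= C.
Proof. by move=> [_ bF] xab; have := bF 0%N x xab; rewrite expr0 fact0 !mulr1. Qed.

Lemma succ_le_exp2 k : k.+1%:R <= 2 ^+ k :> R.
Proof. by rewrite -natrX ler_nat; apply: ltn_expl. Qed.

Lemma cauchy_bound_le a b C M C' M' F : 0 <= C -> 0 <= M -> C <= C' -> M <= M' ->
  cauchy_bound a b C M F -> cauchy_bound a b C' M' F.
Proof.
move=> C0 M0 CC' MM' [dF bF]; split=> // k x xab; apply: le_trans (bF _ _ xab) _.
apply: ler_pM => //; first by rewrite mulr_ge0// exprn_ge0.
apply: ler_pM => //; first exact: exprn_ge0.
by apply: lerXn2r => //; rewrite nnegrE// (le_trans M0).
Qed.

Lemma fact_neq0 n : n`!%:R != 0 :> R.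
Proof. by rewrite pnatr_eq0 -lt0n fact_gt0. Qed.

Lemma bin_fact_prod k (i : 'I_k.+1) :
  'C(k, i)%:R * i`!%:R * (k - i)`!%:R = k`!%:R :> R.
Proof. by rewrite -!natrM -mulnA bin_fact// -ltnS. Qed.

Lemma leibniz_bound C D M u v k : 0 <= C -> 0 <= D -> 0 <= M ->
  (forall i, (i <= k)%N -> `|u i| <= C * M ^+ i * i`!%:R) ->
  (forall i, (i <= k)%N -> `|v i| <= D * M ^+ i * i`!%:R) ->
  `|leibniz u v k| <= C * D * M ^+ k * k.+1`!%:R.
Proof.
move=> C0 D0 M0 uB vB; rewrite leibnizE; apply: le_trans (ler_norm_sum _ _ _) _.
apply: le_trans (_ : \sum_(i < k.+1) C * D * M ^+ k * k`!%:R <= _); last first.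
  by rewrite sumr_const card_ord -[leLHS]mulr_natr -mulrA -natrM mulnC -factS.
apply: ler_sum => i _; have ik : (i <= k)%N by rewrite -ltnS.
have ME : M ^+ k = M ^+ i * M ^+ (k - i) by rewrite -exprD subnKC.
rewrite !normrM normr_nat -(bin_fact_prod i) ME.
have u_le := uB i ik; have v_le := vB (k - i)%N (leq_subr _ _).
apply: le_trans (ler_pM _ _ (ler_wpM2l (ler0n _ _) u_le) v_le) _ => //.
by rewrite le_eqVlt; apply/orP; left; apply/eqP; ring.
Qed.

Lemma cauchy_bound_shift a b C M F : 0 <= C -> 0 <= M ->
  cauchy_bound a b C M F -> cauchy_bound a b (C * M) (2 * M) (shift F).
Proof.
move=> C0 M0 [dF bF]; split=> [|k x xab]; first exact: dertower_shift.
apply: le_trans (bF k.+1 x xab) _; rewrite exprS factS natrM exprMn -!mulrA.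
do 2![apply: ler_wpM2l => //].
rewrite mulrCA mulrA [_ * M ^+ k]mulrC -mulrA [leRHS]mulrCA.
apply: ler_wpM2l; first exact: exprn_ge0.
by apply: ler_wpM2r => //; exact: succ_le_exp2.
Qed.

Definition analytic_on a b f := exists F C M, [/\ 0 <= C, 1 <= M, cauchy_bound a b C M F &
  forall x, a < x < b -> F 0%N x = f x].

Lemma analytic_on_sub a b a' b' f :
  a <= a' -> b' <= b -> analytic_on a b f -> analytic_on a' b' f.
Proof.
move=> aa' bb' [F [C [M [C0 M1 [dF bF] F0]]]].
have in_ab x : a' < x < b' -> a < x < b.
  by move=> /andP[ax xb]; rewrite (le_lt_trans aa' ax) (lt_le_trans xb bb').
exists F, C, M; split=> //; last by move=> x /in_ab/F0.
by split=> k x /in_ab; [exact: dF|exact: bF].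
Qed.

Lemma analytic_on_ext a b f g :
  (forall x, a < x < b -> f x = g x) -> analytic_on a b f -> analytic_on a b g.
Proof.
move=> fg [F [C [M [C0 M1 bF F0]]]]; exists F, C, M; split=> // x xab.
by rewrite F0// fg.
Qed.

Lemma analytic_on_cst a b c : analytic_on a b (fun=> c).
Proof.
exists (const_tower c), `|c|, 1; split=> //; split; first exact: dertower_const.
move=> [|k] x _ /=; first by rewrite fact0 !mulr1.
by rewrite normr0 !mulr_ge0// exprn_ge0.
Qed.

Lemma analytic_on_id a b : analytic_on a b (fun x => x).
Proof.
pose F k (x : R) : R := if k is k'.+1 then const_tower 1 k' x else x.
exists F, (`|a| + `|b| + 1), 1; split=> //.
split=> [[|[|k]] x _|k x /andP[ax xb]]; [exact: der_id|exact: der_cst|exact: der_cst|].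
rewrite expr1n mulr1; apply: le_trans (_ : `|a| + `|b| + 1 <= _); last first.
  by rewrite ler_peMr ?addr_ge0// ler1n fact_gt0.
have := ler_norm a; have := lerNnormlW (lexx `|a|).
have := ler_norm b; have := lerNnormlW (lexx `|b|).
by case: k => [|[|k]] /= ? ? ? ?; rewrite ?normr0 ?normr1 ?ler_norml; lra.
Qed.

Lemma analytic_on_common a b f g :
  analytic_on a b f -> analytic_on a b g -> exists F G C D M,
  [/\ [/\ 0 <= C, 0 <= D & 1 <= M], cauchy_bound a b C M F, cauchy_bound a b D M G,
    forall x, a < x < b -> F 0%N x = f x & forall x, a < x < b -> G 0%N x = g x].
Proof.
move=> [F [C [M [C0 M1 bF F0]]]] [G [D [N [D0 N1 bG G0]]]].
exists F, G, C, D, (M + N); split=> //; first by split=> //; lra.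
  by apply: cauchy_bound_le bF => //; lra.
by apply: cauchy_bound_le bG => //; lra.
Qed.

Lemma analytic_on_add a b f g :
  analytic_on a b f -> analytic_on a b g -> analytic_on a b (fun x => f x + g x).
Proof.
move=> af ag; have [F [G [C [D [M [[C0 D0 M1] [dF bF] [dG bG] F0 G0]]]]]] :=
  analytic_on_common af ag.
exists (fun k x => F k x + G k x), (C + D), M; split=> //; first exact: addr_ge0.
  split=> k x xab; first exact: derD (dF _ _ xab) (dG _ _ xab).
  rewrite !mulrDl; apply: le_trans (ler_normD _ _) _.
  by apply: lerD; [exact: bF|exact: bG].
by move=> x xab; rewrite F0// G0.
Qed.

Lemma analytic_on_mul a b f g :
  analytic_on a b f -> analytic_on a b g -> analytic_on a b (fun x => f x * g x).
Proof.
move=> af ag; have [F [G [C [D [M [[C0 D0 M1] [dF bF] [dG bG] F0 G0]]]]]] :=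
  analytic_on_common af ag.
have M0 : 0 <= M by lra.
exists (leibniz_fun F G), (C * D), (2 * M); split=> //; [exact: mulr_ge0|lra| |].
  split=> [|k x xab]; first exact: dertower_leibniz.
  have bFk i (_ : (i <= k)%N) := bF i x xab; have bGk i (_ : (i <= k)%N) := bG i x xab.
  apply: le_trans (leibniz_bound C0 D0 M0 bFk bGk) _.
  rewrite factS natrM exprMn -!mulrA; do 2![apply: ler_wpM2l => //].
  rewrite mulrCA; apply: ler_wpM2r; last exact: succ_le_exp2.
  by rewrite mulr_ge0// exprn_ge0.
by move=> x xab; rewrite /leibniz_fun /= F0// G0.
Qed.

Lemma analytic_on_opp a b f : analytic_on a b f -> analytic_on a b (fun x => - f x).
Proof.
move=> /(analytic_on_mul (analytic_on_cst a b (-1))); apply: analytic_on_ext => x _.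
exact: mulN1r.
Qed.

Lemma analytic_on_exp a b f : analytic_on a b f -> analytic_on a b (fun x => expR (f x)).
Proof.
move=> [F [C [M [C0 M1 bF F0]]]]; have M0 : 0 <= M by lra.
have [dF _] := bF; have [_ shift_le] := cauchy_bound_shift C0 M0 bF.
have [|G dG G0] :=
  @dertower_linear a b (shift F) (fun x => expR (F 0%N x)) (dertower_shift dF).
  by move=> x xab; apply: der_exp; apply: dF.
have GE k x : a < x < b -> G k.+1 x = leibniz_fun (shift F) G k x.
  apply: (dertower_uniq (dertower_shift dG) (dertower_leibniz (dertower_shift dF) dG)).
  move=> y yab; apply: der_uniq (dG 0%N y yab) _; rewrite /leibniz_fun /= G0.
  by apply: der_exp; apply: dF.
pose L := 2 * M + C * M.
have CM : 0 <= C * M by rewrite mulr_ge0.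
have L0 : 0 <= L by rewrite /L; lra.
exists G, (expR C), L; split; [exact: expR_ge0|rewrite /L; lra| |].
  split=> // k x xab; elim/ltn_ind: k => -[_|k IH].
    rewrite G0 expr0 fact0 !mulr1 ger0_norm ?expR_ge0// ler_expR.
    exact: le_trans (ler_norm _) (cauchy_bound0 bF xab).
  rewrite GE//; apply: le_trans (leibniz_bound (C := C * M) CM (expR_ge0 C) L0 _ _) _.
  - move=> i _; apply: le_trans (shift_le i x xab) _; apply: ler_wpM2r => //.
    by apply: ler_wpM2l => //; apply: lerXn2r; rewrite ?nnegrE /L; lra.
  - by move=> i ik; apply: IH.
  - apply: ler_wpM2r => //; rewrite [C * M * _]mulrC -mulrA; apply: ler_wpM2l.
      exact: expR_ge0.
    by rewrite exprS; apply: ler_wpM2r; rewrite ?exprn_ge0// /L; lra.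
by move=> x xab; rewrite G0 F0.
Qed.

Lemma half_powers_sum_le2 n : \sum_(i < n) 2^-1 ^+ i <= 2 :> R.
Proof.
have -> : \sum_(i < n) 2^-1 ^+ i = 2 - 2 * 2^-1 ^+ n :> R.
  elim: n => [|n IH]; first by rewrite big_ord0 expr0; lra.
  by rewrite big_ord_recr /= IH exprS; lra.
by have : 0 <= 2^-1 ^+ n :> R by [exact: exprn_ge0]; lra.
Qed.

Lemma leibniz_tail_bound C D M L u v k : 0 <= C -> 0 <= D -> 0 <= M -> 2 * M <= L ->
  (forall i, `|u i| <= C * M ^+ i * i`!%:R) ->
  (forall i, (i <= k)%N -> `|v i| <= D * L ^+ i * i`!%:R) ->
  `|\sum_(i < k.+1) 'C(k.+1, i.+1)%:R * u i.+1 * v (k - i)%N| <=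
    2 * C * M * D * L ^+ k * k.+1`!%:R.
Proof.
move=> C0 D0 M0 ML u_le v_le; have L0 : 0 <= L by lra.
apply: le_trans (ler_norm_sum _ _ _) _.
apply: le_trans (_ : C * M * D * L ^+ k * k.+1`!%:R * 2 <= _); last first.
  by rewrite le_eqVlt; apply/orP; left; apply/eqP; ring.
apply: le_trans (ler_wpM2l _ (half_powers_sum_le2 k.+1)); last first.
  by rewrite !mulr_ge0// exprn_ge0.
rewrite mulr_sumr; apply: ler_sum => i _; have ik : (i <= k)%N by rewrite -ltnS.
have i1 : (i.+1 < k.+2)%N by [].
have := bin_fact_prod (Ordinal i1); rewrite /= subSS => <-; rewrite !normrM normr_nat.
have v_le_ki := v_le (k - i)%N (leq_subr _ _).
apply: le_trans (ler_pM _ _ (ler_wpM2l (ler0n _ _) (u_le i.+1)) v_le_ki) _;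
  rewrite ?mulr_ge0//.
have -> : L ^+ k = L ^+ i * L ^+ (k - i) by rewrite -exprD subnKC.
have ML_i : M ^+ i <= L ^+ i * 2^-1 ^+ i.
  by rewrite -exprMn; apply: lerXn2r; rewrite ?nnegrE ?mulr_ge0//; lra.
rewrite exprS; set B := 'C(_, _)%:R; set f1 := i.+1`!%:R; set f2 := (k - i)`!%:R.
rewrite [leLHS](_ : _ = (B * f1 * f2 * C * M * D * L ^+ (k - i)) * M ^+ i); last by ring.
rewrite [leRHS](_ : _ = (B * f1 * f2 * C * M * D * L ^+ (k - i)) *
  (L ^+ i * 2^-1 ^+ i)); last by ring.
by apply: ler_wpM2l => //; rewrite !mulr_ge0// exprn_ge0.
Qed.

Lemma leibniz_inv_recurrence a b F Z k x : dertower a b F -> dertower a b Z ->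
  (forall y, a < y < b -> F 0%N y * Z 0%N y = 1) -> a < x < b ->
  F 0%N x * Z k.+1 x =
    - \sum_(i < k.+1) 'C(k.+1, i.+1)%:R * F i.+1 x * Z (k - i)%N x.
Proof.
move=> dF dZ FZ xab.
have : leibniz_fun F Z k.+1 x = 0.
  by rewrite (dertower_uniq (dertower_leibniz dF dZ) (@dertower_const a b 1) _ k.+1 xab).
rewrite /leibniz_fun leibnizE big_ord_recl bin0 mul1r subn0 => /eqP.
by rewrite addr_eq0 => /eqP ->.
Qed.

Lemma cauchy_bound_inv a b C M eta F :
  0 <= C -> 1 <= M -> 0 < eta -> cauchy_bound a b C M F ->
  (forall x, a < x < b -> eta <= F 0%N x) ->
  exists2 Z, cauchy_bound a b eta^-1 (2 * M + 2 * C * M / eta) Z &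
    Z 0%N = (fun x => (F 0%N x)^-1).
Proof.
move=> C0 M1 eta0 [dF bF] Feta; have M0 : 0 <= M by lra.
have F_gt0 x : a < x < b -> 0 < F 0%N x by move=> /Feta; apply: lt_le_trans.
have [|Z dZ Z0] := dertower_inv dF; first by move=> x /F_gt0/lt0r_neq0.
have FZ y : a < y < b -> F 0%N y * Z 0%N y = 1.
  by move=> yab; rewrite Z0 divff// lt0r_neq0 ?F_gt0.
exists Z => //; split=> // k x xab; set L := 2 * M + _.
have CMe : 0 <= 2 * C * M / eta by rewrite divr_ge0 ?mulr_ge0// ltW.
have ML : 2 * M <= L by rewrite /L; lra.
have L0 : 0 <= L by lra.
have e0 : 0 <= eta^-1 by rewrite invr_ge0 ltW.
elim/ltn_ind: k => -[_|k IH].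
  rewrite Z0 expr0 fact0 !mulr1 ger0_norm ?invr_ge0 ?(ltW (F_gt0 _ xab))//.
  by rewrite lef_pV2 ?posrE ?F_gt0// Feta.
rewrite -(ler_pM2l (F_gt0 _ xab)) -{1}(gtr0_norm (F_gt0 _ xab)) -normrM.
rewrite (leibniz_inv_recurrence k dF dZ FZ xab) normrN.
apply: le_trans (leibniz_tail_bound (u := F^~ x) (v := Z^~ x) C0 e0 M0 ML _ _) _.
- by move=> i; apply: bF.
- by move=> i ik; apply: IH.
apply: le_trans (_ : eta * (eta^-1 * L ^+ k.+1 * k.+1`!%:R) <= _); last first.
  by apply: ler_wpM2r (Feta _ xab); rewrite !mulr_ge0// exprn_ge0.
rewrite [leLHS](_ : _ = (L ^+ k * k.+1`!%:R) * (2 * C * M / eta)); last by ring.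
rewrite [leRHS](_ : _ = (L ^+ k * k.+1`!%:R) * L); last first.
  by rewrite exprS; field; exact: lt0r_neq0.
by apply: ler_wpM2l; rewrite ?mulr_ge0 ?exprn_ge0// /L; lra.
Qed.

Lemma norm_ln_le (eta C x : R) : 0 < eta -> eta <= x -> x <= C ->
  `|ln x| <= `|ln eta| + `|ln C|.
Proof.
move=> eta0 eta_x xC; have x0 : 0 < x by lra.
have ln_ge : ln eta <= ln x by rewrite ler_ln.
have ln_le : ln x <= ln C by rewrite ler_ln// posrE; lra.
have := ler_norm (ln C); have := lerNnormlW (lexx `|ln eta|).
have := normr_ge0 (ln C); have := normr_ge0 (ln eta).
by rewrite ler_norml; move=> *; apply/andP; split; lra.
Qed.

Lemma analytic_on_ln a b f eta : 0 < eta -> (forall x, a < x < b -> eta <= f x) ->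
  analytic_on a b f -> analytic_on a b (fun x => ln (f x)).
Proof.
move=> eta0 feta [F [C [M [C0 M1 bF F0]]]]; have M0 : 0 <= M by lra.
have Feta x : a < x < b -> eta <= F 0%N x by move=> xab; rewrite F0// feta.
have [Z [dZ bZ] Z0] := cauchy_bound_inv C0 M1 eta0 bF Feta.
have [dF _] := bF; have [_ shift_le] := cauchy_bound_shift C0 M0 bF.
move: bZ; set L := 2 * M + _ => bZ.
have e0 : 0 <= eta^-1 by rewrite invr_ge0 ltW.
have CMe : 0 <= 2 * C * M / eta by rewrite !mulr_ge0.
have L0 : 0 <= L by rewrite /L; lra.
have L1 : 1 <= L by rewrite /L; lra.
have CM : 0 <= C * M by rewrite mulr_ge0.
pose Y k x := if k is k'.+1 then leibniz_fun (shift F) Z k' x else ln (F 0%N x).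
have D0 : 0 <= `|ln eta| + `|ln C| by rewrite addr_ge0.
exists Y, (`|ln eta| + `|ln C| + C * M * eta^-1), L; split=> //.
- by rewrite addr_ge0// mulr_ge0.
- split=> [[|k] x xab|[|k] x xab].
  + apply: derE (der_ln (lt_le_trans eta0 (Feta _ xab)) (dF _ _ xab)).
    by rewrite /Y /leibniz_fun /= Z0.
  + exact: (dertower_leibniz (dertower_shift dF) dZ).
  + rewrite /Y expr0 fact0 !mulr1.
    apply: le_trans (norm_ln_le eta0 (Feta _ xab) (C := C) _) _.
      exact: le_trans (ler_norm _) (cauchy_bound0 bF xab).
    by rewrite lerDl mulr_ge0.
  + rewrite /Y; apply: le_trans (leibniz_bound (C := C * M) (D := eta^-1) CM e0 L0 _ _) _.
    * move=> i _; apply: le_trans (shift_le i x xab) _; apply: ler_wpM2r => //.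
      by apply: ler_wpM2l => //; apply: lerXn2r; rewrite ?nnegrE ?mulr_ge0 /L//; lra.
    * by move=> i _; apply: bZ.
    * apply: ler_wpM2r => //; apply: ler_pM; rewrite ?mulr_ge0 ?exprn_ge0//.
        by rewrite lerDr.
      by rewrite exprS ler_peMl// exprn_ge0.
- by move=> x xab; rewrite /Y F0.
Qed.

(** ** Taylor expansions and the identity theorem *)

Definition taylor_poly (c : nat -> R) s n x := \sum_(k < n) c k / k`!%:R * (x - s) ^+ k.

Lemma taylor_polySr c s n x :
  taylor_poly c s n.+1 x = taylor_poly c s n x + c n / n`!%:R * (x - s) ^+ n.
Proof. exact: big_ord_recr. Qed.

Lemma der_taylor_poly c s n x :
  der (taylor_poly c s n.+1) x (taylor_poly (shift c) s n x).
Proof.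
elim: n => [|n IH].
  have -> : taylor_poly c s 1 = (fun=> c 0%N / 0`!%:R * 1).
    by apply/funext => y; rewrite /taylor_poly big_ord1 expr0.
  by rewrite /taylor_poly big_ord0; apply: der_cst.
have -> : taylor_poly c s n.+2 =
    (fun y => taylor_poly c s n.+1 y + c n.+1 / n.+1`!%:R * (y - s) ^+ n.+1).
  by apply/funext => y; exact: taylor_polySr.
rewrite taylor_polySr; apply: derD => //.
apply: derE (derZ _ (der_exprn n (derB (der_id x) (der_cst s x)))).
have f0 := fact_neq0 n.
have n0 : n.+1%:R != 0 :> R by rewrite pnatr_eq0.
rewrite /shift factS natrM subr0 mulr1; move: f0 n0; move: n`!%:R n.+1%:R => u v u0 v0.
by field; rewrite u0.
Qed.

Lemma der_bound_exprn a b (G G' : R -> R) c n s t :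
  (forall x, a < x < b -> der G x (G' x)) ->
  (forall x, a < x < b -> `|G' x| <= n.+1%:R * c * `|x - s| ^+ n) ->
  a < s < b -> a < t < b -> `|G t - G s| <= c * `|t - s| ^+ n.+1.
Proof.
wlog st : a b G G' s t / s <= t.
  move=> st_case dG bG sab tab; have [st|/ltW ts] := leP s t.
    exact: (st_case a b G G').
  have := st_case (- b) (- a) (fun x => G (- x)) (fun x => - G' (- x)) (- s) (- t).
  rewrite !opprK [- t + s]addrC [`|s - t|]distrC; apply; rewrite ?lerN2//; try lra.
    move=> x xab; apply: derE (der_comp (dG (- x) _) (derN (der_id x))); last by lra.
    by rewrite mulrN1.
  move=> x xab; rewrite normrN -[x + s]opprK normrN opprD; apply: bG; lra.
move=> dG bG sab tab.
have dH z : der (fun x => c * (x - s) ^+ n.+1) z (n.+1%:R * c * (z - s) ^+ n).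
  apply: derE (derZ c (der_exprn n (derB (der_id z) (der_cst s z)))).
  by rewrite subr0 mulr1 mulrA [c * _]mulrC.
have inab z : s <= z <= t -> a < z < b by lra.
have G'_le z : s < z < t ->
    - (n.+1%:R * c * (z - s) ^+ n) <= G' z <= n.+1%:R * c * (z - s) ^+ n.
  move=> zst; have := bG z ltac:(apply: inab; lra).
  by rewrite ler_norml (@ger0_norm _ (z - s)); last by lra.
have HB_mono := @der_nondecreasing _ _ s t st (fun z zI => derB (dH z) (dG z (inab z zI)))
  (fun z zI => ltac:(have := G'_le z zI; lra)).
have HD_mono := @der_nondecreasing _ _ s t st (fun z zI => derD (dH z) (dG z (inab z zI)))
  (fun z zI => ltac:(have := G'_le z zI; lra)).
move: HB_mono HD_mono; rewrite subrr expr0n mulr0 (@ger0_norm _ (t - s)); last by lra.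
by rewrite ler_norml => ? ?; apply/andP; split; lra.
Qed.

Lemma taylor_bound a b F B n s t : dertower a b F -> 0 <= B ->
  (forall x, a < x < b -> `|F n x| <= B) -> a < s < b -> a < t < b ->
  `|F 0%N t - taylor_poly (F^~ s) s n t| <= B / n`!%:R * `|t - s| ^+ n.
Proof.
move=> + B0; elim: n F t => [|n IH] F t dF bF sab tab.
  by rewrite /taylor_poly big_ord0 subr0 fact0 divr1 expr0 mulr1 bF.
pose G x := F 0%N x - taylor_poly (F^~ s) s n.+1 x.
have Gs : G s = 0.
  rewrite /G /taylor_poly big_ord_recl expr0 fact0 divr1 mulr1 big1 ?addr0 ?subrr// => i _.
  by rewrite expr0n mulr0.
rewrite -/(G t) -[G t]subr0 -Gs; apply: (der_bound_exprn (a := a) (b := b)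
  (G' := fun x => F 1%N x - taylor_poly ((shift F)^~ s) s n x)) => // x xab.
  by apply: derB; [exact: dF|exact: der_taylor_poly].
apply: le_trans (IH (shift F) x _ _ _ _) _ => //; first exact: dertower_shift.
suff -> : n.+1%:R * (B / n.+1`!%:R) = B / n`!%:R by [].
have f0 := fact_neq0 n.
have n0 : n.+1%:R != 0 :> R by rewrite pnatr_eq0.
rewrite factS natrM; move: f0 n0; move: n`!%:R n.+1%:R => p q p0 q0.
by field; rewrite p0 q0.
Qed.

Lemma taylor_cauchy_bound a b C M F n s t : 0 <= C -> 0 <= M -> cauchy_bound a b C M F ->
  a < s < b -> a < t < b ->
  `|F 0%N t - taylor_poly (F^~ s) s n t| <= C * (M * `|t - s|) ^+ n.
Proof.
move=> C0 M0 [dF bF] sab tab.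
have B0 : 0 <= C * M ^+ n * n`!%:R by rewrite !mulr_ge0// exprn_ge0.
apply: le_trans (taylor_bound dF B0 (fun x => bF n x) sab tab) _.
by rewrite mulfK ?pnatr_eq0 -?lt0n ?fact_gt0// exprMn mulrA.
Qed.

Lemma le0_half_powers (x C : R) : 0 <= C -> (forall n, x <= C * 2^-1 ^+ n) -> x <= 0.
Proof.
move=> C0 x_le; rewrite leNgt; apply/negP => x0.
have [N CN] : exists N : nat, C / x < N%:R.
  by exists (Num.bound (C / x)); apply: archi_boundP; rewrite divr_ge0// ltW.
have := x_le N; apply/negP; rewrite -ltNge.
have N2 : (N%:R : R) <= 2 ^+ N by rewrite -natrX ler_nat ltnW// ltn_expl.
rewrite exprVn ltr_pdivrMr ?exprn_gt0// mulrC -ltr_pdivrMr//.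
exact: lt_le_trans N2.
Qed.

Lemma analytic_on_vanish_left a b f s : analytic_on a b f -> a < s < b ->
  (forall x, s < x < b -> f x = 0) ->
  exists2 d, 0 < d & forall t, s - d < t -> t <= s -> f t = 0.
Proof.
move=> [F [C [M [C0 M1 bF F0]]]] /andP[as_ sb] f0; have M0 : 0 < M by lra.
pose q := (4 * M)^-1; have q0 : 0 < q by rewrite invr_gt0 mulr_gt0.
have Mq : M * q = 4^-1 by rewrite /q; field; exact: lt0r_neq0.
have [s' [ss' s'q s'b]] : exists s', [/\ s < s', s' <= s + q & s' < b].
  have [bq|bq] := leP (b - s) q; first by exists (s + (b - s) / 2); split; lra.
  by exists (s + q); split; lra.
have s'ab : a < s' < b by apply/andP; split; lra.
have Fs' k : F k s' = 0.
  have dsb : dertower s b F.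
    by move=> j x /andP[sx xb]; apply: (proj1 bF); rewrite xb andbT; lra.
  rewrite (dertower_uniq dsb (@dertower_const s b 0) _ k (x := s')); first by case: k.
    by move=> x /andP[sx xb]; rewrite F0 ?f0//; apply/andP; split; lra.
  by apply/andP; split; lra.
exists (Num.min q (s - a)); first by rewrite lt_min q0; lra.
move=> t; rewrite ltrBlDr -ltrBlDl lt_min => /andP[tq ta] ts.
have tab : a < t < b by apply/andP; split; lra.
apply/eqP; rewrite -normr_le0; apply: (@le0_half_powers _ C) => // n.
have := taylor_cauchy_bound n C0 (ltW M0) bF s'ab tab.
have -> : taylor_poly (F^~ s') s' n t = 0.
  by rewrite /taylor_poly big1// => i _; rewrite Fs' mul0r mul0r.
rewrite subr0 F0// => /le_trans; apply; apply: ler_wpM2l => //.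
apply: lerXn2r; rewrite ?nnegrE ?mulr_ge0 ?(ltW M0)//.
have : `|t - s'| <= 2 * q by rewrite ler_norml; apply/andP; split; lra.
by move=> /(ler_wpM2l (ltW M0)); rewrite mulrCA Mq; lra.
Qed.

Lemma analytic_on_identity f :
  (forall c, 0 < c -> exists a b, a < c < b /\ analytic_on a b f) ->
  (\forall x \near +oo_R, f x = 0) -> forall x, 0 < x -> f x = 0.
Proof.
move=> af [m [_ fm]] x0 x0_gt0; apply: contrapT => fx0.
pose S := [set y | 0 < y /\ forall x, y < x -> f x = 0].
have S_lb : lbound S x0 by move=> y [y0 fy]; rewrite leNgt; apply/negP => /fy.
have S_inf : has_inf S.
  split; last by exists x0.
  exists (Num.max m 1); split; first by rewrite lt_max ltr01 orbT.
  by move=> x; rewrite gt_max => /andP[/fm].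
have s0 : 0 < inf S by apply: lt_le_trans x0_gt0 (lb_le_inf _ S_lb); case: S_inf.
have fs x : inf S < x -> f x = 0.
  rewrite -subr_gt0 => /inf_adherent/(_ S_inf)[y [y0 fy]].
  by rewrite addrC subrK; apply: fy.
have [a [b [sab fa]]] := af _ s0.
have [|d d0 f_left] := analytic_on_vanish_left fa sab; first by move=> x /andP[/fs].
pose y := Num.max (inf S - d) (inf S / 2).
have ys : y < inf S by rewrite /y gt_max; apply/andP; split; lra.
have : inf S <= y; last by rewrite leNgt ys.
apply: ge_inf; first by exists x0.
split; first by rewrite lt_max; apply/orP; right; lra.
move=> x; rewrite gt_max => /andP[dx _].
by have [xs|/fs//] := leP x (inf S); apply: f_left.
Qed.

End Derivatives.

(** ** Analytic germs at [0+] *)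

Section Germs.
Variable R : realType.
Implicit Types (f g : R -> R) (a b x y l m s t B C D M d eta : R).

Lemma der_continuous f x l e : der f x l -> 0 < e ->
  exists2 d, 0 < d & forall y, `|y - x| < d -> `|f y - f x| < e.
Proof.
move=> [df _] e0; have cf : {for x, continuous f}.
  by apply: differentiable_continuous; exact/derivable1_diffP.
have /cvgrPdist_lt/(_ e e0) := cf; rewrite -nbhs_nearE => -[d /= d0 dP].
exists d => // y yx; rewrite distrC; apply: dP; by rewrite /= distrC.
Qed.

Lemma cauchy_bound_limit d C M F : 0 < d -> 0 <= C -> 0 <= M -> cauchy_bound 0 d C M F ->
  exists r, forall t, 0 < t < d -> `|F 0%N t - r| <= C * M * t.
Proof.
move=> d0 C0 M0 bF; have CM : 0 <= C * M by rewrite mulr_ge0.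
have lip s t : 0 < s < d -> 0 < t < d -> F 0%N t - C * M * t <= F 0%N s + C * M * s.
  move=> sd td; have := taylor_cauchy_bound 1 C0 M0 bF sd td.
  rewrite /taylor_poly big_ord1 fact0 divr1 expr0 mulr1 expr1 mulrA => Fts.
  have ts : `|t - s| <= t + s by rewrite ler_norml; apply/andP; split; lra.
  have := ler_wpM2l CM ts; rewrite mulrDr => CMts.
  by have := ler_norm (F 0%N t - F 0%N s); lra.
pose S := [set F 0%N t - C * M * t | t in [set t | 0 < t < d]].
have d2 : 0 < d / 2 < d by lra.
have S0 : S !=set0 by exists (F 0%N (d / 2) - C * M * (d / 2)), (d / 2).
exists (sup S) => t td.
have sup_le : sup S <= F 0%N t + C * M * t.
  by apply: ge_sup => // _ [s sd <-]; apply: lip.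
have le_sup : F 0%N t - C * M * t <= sup S.
  apply: ub_le_sup; last by exists t.
  by exists (F 0%N t + C * M * t) => _ [s sd <-]; apply: lip.
by rewrite ler_norml; apply/andP; split; lra.
Qed.

Lemma taylor_at0_bound d C M F r k t : 0 <= C -> 0 <= M ->
  cauchy_bound 0 d C M F -> (forall t, 0 < t < d -> `|F 0%N t - r| <= C * M * t) ->
  0 < t < d -> `|taylor_poly (F^~ t) t k.+1 0 - r| <= C * (M * t) ^+ k.+1.
Proof.
move=> C0 M0 bF rP td; apply/ler_addgt0Pr => e e0; have e2 : 0 < e / 2 by lra.
set S := taylor_poly _ t k.+1.
have [q q0 qP] := der_continuous (der_taylor_poly (F^~ t) t k 0) e2.
have [q' q'0 q'P] : exists2 q', 0 < q' & C * M * q' <= e / 2.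
  have CM1 : 0 < C * M + 1 by have := mulr_ge0 C0 M0; lra.
  exists (e / 2 / (C * M + 1)); first by rewrite divr_gt0.
  rewrite mulrCA ler_piMr ?(ltW e2)// ler_pdivrMr//; lra.
have [u [u0 uq uq' ut]] : exists u, [/\ 0 < u, u < q, u <= q' & u <= t].
  have m0 : 0 < Num.min (Num.min q q') t by rewrite !lt_min q0 q'0; lra.
  exists (Num.min (Num.min q q') t / 2); split; [by lra| | |].
  - by have : Num.min (Num.min q q') t <= q by [rewrite !ge_min lexx]; lra.
  - by have : Num.min (Num.min q q') t <= q' by [rewrite !ge_min lexx orbT]; lra.
  - by have : Num.min (Num.min q q') t <= t by [rewrite !ge_min lexx orbT]; lra.
have ud : 0 < u < d by lra.
have Fu_r := rP _ ud.
have CMu : C * M * u <= e / 2.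
  by apply: le_trans q'P; apply: ler_wpM2l; rewrite ?mulr_ge0.
have Su_S0 : `|S u - S 0| < e / 2 by apply: qP; rewrite subr0 gtr0_norm.
have Fu_Su : `|F 0%N u - S u| <= C * (M * `|u - t|) ^+ k.+1.
  exact: taylor_cauchy_bound C0 M0 bF td ud.
have ut_le : C * (M * `|u - t|) ^+ k.+1 <= C * (M * t) ^+ k.+1.
  apply: ler_wpM2l => //; apply: lerXn2r; rewrite ?nnegrE ?mulr_ge0//; first by lra.
  by apply: ler_wpM2l => //; rewrite ler_norml; apply/andP; split; lra.
move: Fu_r Su_S0 Fu_Su; set A := C * (M * t) ^+ _ in ut_le *.
rewrite !ler_norml ltr_norml.
move=> /andP[? ?] /andP[? ?] /andP[? ?]; apply/andP; split; lra.
Qed.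

Lemma der_taylor_at0 d F k t : dertower 0 d F -> 0 < t < d ->
  der (fun u => taylor_poly (F^~ u) u k.+1 0) t (F k.+1 t * (- t) ^+ k / k`!%:R).
Proof.
move=> dF td; elim: k => [|k IH].
  have -> : (fun u => taylor_poly (F^~ u) u 1 0) = F 0%N.
    by apply/funext => u; rewrite /taylor_poly big_ord1 expr0 fact0 divr1 mulr1.
  by apply: derE (dF 0%N t td); rewrite expr0 fact0 mulr1 divr1.
have -> : (fun u => taylor_poly (F^~ u) u k.+2 0) =
    (fun u => taylor_poly (F^~ u) u k.+1 0 +
              F k.+1 u * ((k.+1`!%:R)^-1 * (- u) ^+ k.+1)).
  by apply/funext => u; rewrite taylor_polySr sub0r mulrA.
have dpow := derZ (k.+1`!%:R)^-1 (der_exprn k (derN (der_id t))).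
apply: derE (derD IH (derM (dF _ _ td) dpow)).
have f0 := fact_neq0 R k.
have n0 : k.+1%:R != 0 :> R by rewrite pnatr_eq0.
rewrite factS natrM exprS; move: f0 n0; move: (k`!%:R) (k.+1%:R) => p q p0 q0.
by field; rewrite p0.
Qed.

(* The [k]-th derivative of [(F 0 - r) / t] is, up to the factor [k! / t^(k+1)],
   the error at [0] of the Taylor polynomial of [F 0] at [t]. *)
Definition quotient_tower (F : nat -> R -> R) r k t :=
  - k`!%:R * ((- t)^-1 ^+ k.+1 * (taylor_poly (F^~ t) t k.+1 0 - r)).

Lemma quotient_tower0 F r t : t != 0 -> F 0%N t = r + t * quotient_tower F r 0 t.
Proof.
move=> t0; rewrite /quotient_tower /taylor_poly big_ord1 !expr0 fact0 divr1 !mulr1 expr1.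
by field.
Qed.

Lemma dertower_quotient d F r : dertower 0 d F -> dertower 0 d (quotient_tower F r).
Proof.
move=> dF k t td; have t0 : t != 0 by rewrite lt0r_neq0//; lra.
have Nt0 : - t != 0 by rewrite oppr_eq0.
have dinv := der_exprn k (der_inv Nt0 (derN (der_id t))).
have dS := derB (der_taylor_at0 k dF td) (der_cst r t).
apply: derE (derZ (- k`!%:R) (derM dinv dS)).
have f0 := fact_neq0 R k.
have n0 : k.+1%:R != 0 :> R by rewrite pnatr_eq0.
have tk0 : (- t) ^+ k != 0 by rewrite expf_neq0.
rewrite /quotient_tower [taylor_poly _ _ k.+2 _]taylor_polySr sub0r factS natrM.
rewrite !exprS exprVn.
move: f0 n0 tk0; move: (k`!%:R) (k.+1%:R) ((- t) ^+ k) (taylor_poly _ _ _ _) (F k.+1 t).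
by move=> p q T S G p0 q0 T0; field; rewrite ?p0 ?q0 ?t0 ?T0.
Qed.

Lemma cauchy_bound_div d C M F : 0 < d -> 0 <= C -> 0 <= M -> cauchy_bound 0 d C M F ->
  exists r H, cauchy_bound 0 d (C * M) M H /\
    forall t, 0 < t < d -> F 0%N t = r + t * H 0%N t.
Proof.
move=> d0 C0 M0 bF; have [r rP] := cauchy_bound_limit d0 C0 M0 bF.
exists r, (quotient_tower F r); split; last first.
  by move=> t td; apply: quotient_tower0; rewrite lt0r_neq0//; lra.
split=> [|k t td]; first by apply: dertower_quotient; case: bF.
have t0 : 0 < t by lra.
rewrite /quotient_tower !normrM normrN normr_nat normrX normfV normrN (gtr0_norm t0).
rewrite mulrC; apply: ler_wpM2r => //.
apply: le_trans (ler_wpM2l _ (taylor_at0_bound k C0 M0 bF rP td)) _.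
  by rewrite exprn_ge0// invr_ge0 ltW.
rewrite mulrCA -exprMn mulrCA mulVf ?lt0r_neq0// mulr1 exprS; lra.
Qed.

Lemma analytic_on_div0 d g : 0 < d -> analytic_on 0 d g ->
  exists r h, analytic_on 0 d h /\ forall t, 0 < t < d -> g t = r + t * h t.
Proof.
move=> d0 [F [C [M [C0 M1 bF F0]]]]; have M0 : 0 <= M by lra.
have [r [H [bH HE]]] := cauchy_bound_div d0 C0 M0 bF.
exists r, (H 0%N); split; last by move=> t td; rewrite -F0// HE.
by exists H, (C * M), M; split=> //; rewrite mulr_ge0.
Qed.

Lemma cauchy_bound_order d k C M F :
  0 < d -> 0 <= C -> 1 <= M -> cauchy_bound 0 d C M F ->
  (exists j r h, [/\ r != 0, analytic_on 0 d h &
     forall t, 0 < t < d -> F 0%N t = t ^+ j * (r + t * h t)]) \/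
  (forall t, 0 < t < d -> `|F 0%N t| <= C * (M * t) ^+ k).
Proof.
move=> d0 + M1; have M0 : 0 <= M by lra.
elim: k C F => [|k IH] C F C0 bF.
  by right=> t td; rewrite expr0 mulr1; exact: cauchy_bound0 bF td.
have [r [H [bH HE]]] := cauchy_bound_div d0 C0 M0 bF.
have CM : 0 <= C * M by rewrite mulr_ge0.
have [r0|r0] := eqVneq r 0; last first.
  left; exists 0%N, r, (H 0%N); split=> // [|t td]; last by rewrite expr0 mul1r HE.
  by exists H, (C * M), M.
have [[j [s [h [s0 ah hE]]]]|H_le] := IH _ _ CM bH; [left|right].
  exists j.+1, s, h; split=> // t td.
  by rewrite HE// r0 add0r hE// exprS mulrA.
move=> t td; rewrite HE// r0 add0r normrM gtr0_norm; last by lra.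
apply: le_trans (ler_wpM2l _ (H_le t td)) _; first by lra.
by rewrite exprS; lra.
Qed.

Lemma analytic_on_order0 d g : 0 < d -> analytic_on 0 d g ->
  (exists2 e, 0 < e & forall t, 0 < t < e -> g t = 0) \/
  exists j r h, [/\ r != 0, analytic_on 0 d h &
     forall t, 0 < t < d -> g t = t ^+ j * (r + t * h t)].
Proof.
move=> d0 [F [C [M [C0 M1 bF F0]]]]; have M0 : 0 < M by lra.
have [h|nh] := pselect (exists j r h, [/\ r != 0, analytic_on 0 d h &
     forall t, 0 < t < d -> g t = t ^+ j * (r + t * h t)]); [by right|left].
have FC k t : 0 < t < d -> `|g t| <= C * (M * t) ^+ k.
  have [[j [r [h [r0 ah hE]]]]|//] := cauchy_bound_order k d0 C0 M1 bF.
    by case: nh; exists j, r, h; split=> // s sd; rewrite -F0// hE.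
  by move=> FC td; rewrite -F0// FC.
have M2 : 0 < (2 * M)^-1 by rewrite invr_gt0; lra.
exists (Num.min d (2 * M)^-1); first by rewrite lt_min d0.
move=> t /andP[t0]; rewrite lt_min => /andP[td tM].
apply/eqP; rewrite -normr_le0; apply: (@le0_half_powers _ _ C) => // k.
apply: le_trans (FC k t _) _; first by rewrite t0.
apply: ler_wpM2l => //; apply: lerXn2r; rewrite ?nnegrE ?mulr_ge0 ?ltW//; try lra.
rewrite (_ : 2^-1 = M * (2 * M)^-1); last by field; exact: lt0r_neq0.
by rewrite ltr_pM2l.
Qed.

Lemma analytic_on_bounded a b g : analytic_on a b g ->
  exists N : nat, forall t, a < t < b -> `|g t| <= N%:R.
Proof.
move=> [F [C [M [C0 M1 bF F0]]]]; exists (Num.bound C) => t td.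
rewrite -F0//; apply: le_trans (cauchy_bound0 bF td) _.
by apply: ltW; apply: archi_boundP.
Qed.

Lemma analytic_on_ln0 d g : 0 < d -> analytic_on 0 d g ->
  (forall e, 0 < e -> exists2 t, 0 < t < e & 1 <= g t) ->
  exists2 e, 0 < e & analytic_on 0 e (fun t => ln (g t)).
Proof.
move=> d0 ag g1; have [r [h [ah gE]]] := analytic_on_div0 d0 ag.
have [N hN] := analytic_on_bounded ah.
pose e := Num.min d (8 * N.+1%:R)^-1.
have N0 : 0 < N.+1%:R :> R by [].
have q0 : 0 < (8 * N.+1%:R)^-1 :> R by rewrite invr_gt0; lra.
have e0 : 0 < e by rewrite lt_min d0.
have ed : e <= d by rewrite ge_min lexx.
have th t : 0 < t < e -> `|t * h t| <= 8^-1.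
  move=> te; rewrite normrM gtr0_norm; last by lra.
  rewrite (_ : 8^-1 = (8 * N.+1%:R)^-1 * N.+1%:R :> R); last first.
    by field; exact: lt0r_neq0.
  apply: ler_pM => //; first by lra.
    have e8 : e <= (8 * N.+1%:R)^-1 by rewrite ge_min lexx orbT.
    by case/andP: te => _ /ltW te; exact: le_trans te e8.
  by apply: le_trans (hN t _) _; [lra|rewrite ler_nat].
exists e => //; apply: (@analytic_on_ln _ _ _ _ 2^-1); [by []| |exact: analytic_on_sub ag].
have [s se gs] := g1 _ e0.
move=> t te; rewrite gE; last by lra.
have := th _ te; have := th _ se; move: gs; rewrite gE; last by lra.
rewrite !ler_norml => ? /andP[? ?] /andP[? ?]; lra.
Qed.

Definition has_taylor0 f := forall n, exists (c : nat -> R) (C : nat),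
  forall t, `|t| <= 2^-1 -> `|f t - \sum_(i < n) c i * t ^+ i| <= C%:R * `|t| ^+ n.

Lemma analytic_on_has_taylor0 f : analytic_on (- (3 / 4)) (3 / 4) f -> has_taylor0 f.
Proof.
move=> [F [C [M [C0 M1 bF F0]]]] n; have M0 : 0 <= M by lra.
exists (fun i => F i 0 / i`!%:R), (Num.bound (C * M ^+ n)) => t.
rewrite ler_norml => tb.
have t34 : - (3 / 4) < t < 3 / 4 by lra.
have z34 : - (3 / 4) < (0 : R) < 3 / 4 by lra.
have := taylor_cauchy_bound n C0 M0 bF z34 t34.
rewrite subr0 F0// /taylor_poly (eq_bigr (fun i : 'I_n => F i 0 / i`!%:R * t ^+ i)).
  move=> /le_trans; apply; rewrite exprMn mulrA; apply: ler_wpM2r.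
    exact: exprn_ge0.
  by apply: ltW; apply: archi_boundP; rewrite mulr_ge0// exprn_ge0.
by move=> i _; rewrite subr0.
Qed.

Lemma has_taylor0_expR : has_taylor0 expR.
Proof. exact: (analytic_on_has_taylor0 (analytic_on_exp (analytic_on_id _ _))). Qed.

Lemma has_taylor0_ln1 : has_taylor0 (fun t => ln (1 + t)).
Proof.
apply: analytic_on_has_taylor0; apply: (@analytic_on_ln _ _ _ _ (4^-1)).
- by [].
- by move=> x xb; lra.
- by apply: analytic_on_add; [exact: analytic_on_cst|exact: analytic_on_id].
Qed.

End Germs.

(** * Hardy fields *)

Section Hardy.
Variable R : realType.
Implicit Types (f g h p q y : R -> R) (K : set (R -> R)).

Lemma near_pinfty_near (P : R -> Prop) : (\forall x \near +oo_R, P x) ->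
  \forall x \near +oo_R, \forall z \near x, P z.
Proof.
move=> [m [m_real mP]]; exists m; split=> // x mx; near=> z; apply: mP.
by near: z; exact: lt_nbhsr.
Unshelve. all: by end_near. Qed.

Definition evder f f' := \forall x \near +oo_R, der f x (f' x).

Lemma evder_ext f g f' : (\forall x \near +oo_R, g x = f x) -> evder f f' -> evder g f'.
Proof.
move=> /near_pinfty_near; apply: filterS2 => x gf; apply: der_near.
by apply: filterS gf => z ->.
Qed.

Definition evsign f :=
  (\forall x \near +oo_R, f x = 0) \/ (\forall x \near +oo_R, 0 < f x) \/
  \forall x \near +oo_R, f x < 0.

Lemma evsign_ext f g : (\forall x \near +oo_R, g x = f x) -> evsign f -> evsign g.
Proof.
move=> gf [|[|]] fs; [left|right; left|right; right];
  by apply: filterS2 gf fs => x ->.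
Qed.

Lemma evsignM f g : evsign f -> evsign g -> evsign (fun x => f x * g x).
Proof.
move=> [fs|[fs|fs]]; first by move=> _; left; apply: filterS fs => x ->; rewrite mul0r.
  move=> [gs|[gs|gs]]; [left|right; left|right; right]; apply: filterS2 fs gs => x f0 g0.
  - by rewrite g0 mulr0.
  - by rewrite mulr_gt0.
  - by rewrite pmulr_rlt0.
move=> [gs|[gs|gs]]; [left|right; right|right; left]; apply: filterS2 fs gs => x f0 g0.
- by rewrite g0 mulr0.
- by rewrite nmulr_rlt0.
- by rewrite nmulr_rgt0.
Qed.

Lemma evsignN f : evsign f -> evsign (fun x => - f x).
Proof.
move=> [|[|]] fs; [left|right; right|right; left]; apply: filterS fs => x.
- by move=> ->; rewrite oppr0.
- by rewrite oppr_lt0.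
- by rewrite oppr_gt0.
Qed.

Lemma evsignV f : evsign f -> evsign (fun x => (f x)^-1).
Proof.
move=> [|[|]] fs; [left|right; left|right; right]; apply: filterS fs => x.
- by move=> ->; rewrite invr0.
- by rewrite invr_gt0.
- by rewrite invr_lt0.
Qed.

Lemma evsign_gt0 f : (\forall x \near +oo_R, 0 < f x) -> evsign f.
Proof. by right; left. Qed.

Lemma evsign_neq0 f : evsign f ->
  (\forall x \near +oo_R, f x = 0) \/ \forall x \near +oo_R, f x != 0.
Proof.
move=> [|[|]] fs; [by left|right|right]; apply: filterS fs => x.
  exact: lt0r_neq0.
exact: ltr0_neq0.
Qed.

Lemma evsign_incr f f' : evder f f' -> (\forall x \near +oo_R, 0 <= f' x) -> evsign f.
Proof.
move=> df f'0; have [m [_ mP]] := filterI df f'0.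
have mono x (y : R) : m < x -> x <= y -> f x <= f y.
  move=> mx xy; apply: (@der_nondecreasing _ f f' x y xy) => z.
    by move=> /andP[xz _]; have [] := mP z (lt_le_trans mx xz).
  by move=> /andP[xz _]; have [] := mP z (lt_trans mx xz).
have after x0 (P : R -> Prop) : (forall x, x0 < x -> P x) -> \forall x \near +oo_R, P x.
  by move=> x0P; apply: filterS (nbhs_pinfty_gt (num_real x0)).
have [[x0 [mx0 fx0]]|not_gt0] := pselect (exists x, m < x /\ 0 < f x).
  by right; left; apply: (after x0) => x /ltW x0x; apply: lt_le_trans (mono _ _ mx0 x0x).
have [[x0 [mx0 fx0]]|not_ge0] := pselect (exists x, m < x /\ 0 <= f x).
  left; apply: (after x0) => x x0x; apply: le_anti; apply/andP; split.
    rewrite leNgt; apply/negP => fx; apply: not_gt0; exists x.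
    by rewrite (lt_trans mx0).
  exact: le_trans (mono _ _ mx0 (ltW x0x)).
right; right; apply: (after m) => x mx; rewrite ltNge; apply/negP => fx.
by apply: not_ge0; exists x.
Qed.

Lemma evsign_der f f' : evder f f' -> evsign f' -> evsign f.
Proof.
move=> df [f0|[f0|f0]].
- by apply: (evsign_incr df); apply: filterS f0 => x ->.
- by apply: (evsign_incr df); apply: filterS f0 => x; exact: ltW.
- have -> : f = (fun x => - - f x) by apply/funext => x; rewrite opprK.
  apply: evsignN; apply: (@evsign_incr _ (fun x => - f' x)).
    by apply: filterS df => x; exact: derN.
  by apply: filterS f0 => x fx; rewrite oppr_ge0 ltW.
Qed.

Record hardy K : Prop := Hardy {
  hf_ext : forall f g, (\forall x \near +oo_R, g x = f x) -> K f -> K g;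
  hf_cst : forall c, K (fun=> c);
  hf_add : forall f g, K f -> K g -> K (fun x => f x + g x);
  hf_mul : forall f g, K f -> K g -> K (fun x => f x * g x);
  hf_inv : forall f, K f -> K (fun x => (f x)^-1);
  hf_der : forall f, K f -> exists2 f', K f' & evder f f';
  hf_sign : forall f, K f -> evsign f }.

Lemma hf_opp K f : hardy K -> K f -> K (fun x => - f x).
Proof.
move=> hK Kf; apply: (hf_ext hK) (hf_mul hK (hf_cst hK (-1)) Kf).
by apply: nearW => x; rewrite mulN1r.
Qed.

Lemma hardy_cst : hardy [set f | exists c, (\forall x \near +oo_R, f x = c)].
Proof.
split.
- by move=> f g gf [c fc]; exists c; apply: filterS2 gf fc => x -> ->.
- by move=> c; exists c; exact: nearW.
- by move=> f g [c fc] [d gd]; exists (c + d); apply: filterS2 fc gd => x -> ->.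
- by move=> f g [c fc] [d gd]; exists (c * d); apply: filterS2 fc gd => x -> ->.
- by move=> f [c fc]; exists c^-1; apply: filterS fc => x ->.
- move=> f [c fc]; exists (fun=> 0); first by exists 0; exact: nearW.
  by apply: evder_ext fc _; apply: nearW => x; exact: der_cst.
- move=> f [c fc]; apply: evsign_ext fc _.
  have [c0|c0|c0] := ltgtP c 0; [right; right|right; left|left]; exact: nearW.
Qed.

Section Adjoin.
Variables (K : set (R -> R)) (hK : hardy K) (y a b : R -> R).
Hypotheses (Ka : K a) (Kb : K b) (dy : evder y (fun x => a x * y x + b x)).

Fixpoint adjoin_poly n : set (R -> R) :=
  if n is n'.+1 then
    [set f | exists g p, [/\ adjoin_poly n' g, K p &
      \forall x \near +oo_R, f x = g x + p x * y x ^+ n]]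
  else K.

Lemma adjoin_poly_ext n f g :
  (\forall x \near +oo_R, g x = f x) -> adjoin_poly n f -> adjoin_poly n g.
Proof.
case: n => [|n] gf /=; first exact: (hf_ext hK gf).
by move=> [h [p [hh Kp fE]]]; exists h, p; split=> //; apply: filterS2 gf fE => x -> ->.
Qed.

Lemma adjoin_polyW n f : adjoin_poly n f -> adjoin_poly n.+1 f.
Proof.
move=> fn; exists f, (fun=> 0); split=> //; first exact: hf_cst.
by apply: nearW => x; rewrite mul0r addr0.
Qed.

Lemma adjoin_poly_leq n m f : (n <= m)%N -> adjoin_poly n f -> adjoin_poly m f.
Proof.
move=> /subnKC<-; elim: (m - n)%N => [|k IH]; first by rewrite addn0.
by rewrite addnS => /IH/adjoin_polyW.
Qed.

Lemma adjoin_poly_K n f : K f -> adjoin_poly n f.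
Proof. by move=> Kf; apply: (@adjoin_poly_leq 0). Qed.

Lemma adjoin_poly_add n f g :
  adjoin_poly n f -> adjoin_poly n g -> adjoin_poly n (fun x => f x + g x).
Proof.
elim: n f g => [|n IH] f g; first exact: hf_add.
move=> [h [p [hh Kp fE]]] [k [q [hk Kq gE]]].
exists (fun x => h x + k x), (fun x => p x + q x); split; [exact: IH|exact: hf_add|].
by apply: filterS2 fE gE => x -> ->; ring.
Qed.

Lemma adjoin_poly_mulK n f p :
  adjoin_poly n f -> K p -> adjoin_poly n (fun x => f x * p x).
Proof.
move=> + Kp; elim: n f => [|n IH] f /=; first by move=> Kf; exact: hf_mul.
move=> [h [q [hh Kq fE]]].
exists (fun x => h x * p x), (fun x => q x * p x); split; [exact: IH|exact: hf_mul|].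
by apply: filterS fE => x ->; ring.
Qed.

Lemma adjoin_poly_muly n f : adjoin_poly n f -> adjoin_poly n.+1 (fun x => f x * y x).
Proof.
elim: n f => [|n IH] f; last first.
  move=> [h [q [/IH hh Kq fE]]].
  exists (fun x => h x * y x), q; split=> //.
  by apply: filterS fE => x ->; rewrite !exprS; ring.
move=> Kf; exists (fun=> 0), f; split=> //; first exact: hf_cst.
by apply: nearW => x; rewrite add0r expr1.
Qed.

Lemma adjoin_poly_mulyn n k f :
  adjoin_poly n f -> adjoin_poly (n + k) (fun x => f x * y x ^+ k).
Proof.
elim: k => [|k IH] fn.
  by rewrite addn0; apply: adjoin_poly_ext fn; apply: nearW => x; rewrite expr0 mulr1.
rewrite addnS; apply: adjoin_poly_ext (adjoin_poly_muly (IH fn)).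
by apply: nearW => x; rewrite exprSr mulrA.
Qed.

Lemma adjoin_poly_yn n p : K p -> adjoin_poly n (fun x => p x * y x ^+ n).
Proof. by move=> Kp; apply: (@adjoin_poly_mulyn 0 n). Qed.

Lemma adjoin_poly_mul n m f g :
  adjoin_poly n f -> adjoin_poly m g -> adjoin_poly (n + m) (fun x => f x * g x).
Proof.
move=> fn; elim: m g => [|m IH] g; first by rewrite addn0; exact: adjoin_poly_mulK.
move=> [h [q [hh Kq gE]]].
have fhn : adjoin_poly (n + m.+1) (fun x => f x * h x).
  by apply: adjoin_poly_leq (IH _ hh); rewrite leq_add2l.
have fqn := adjoin_poly_mulyn m.+1 (adjoin_poly_mulK fn Kq).
by apply: adjoin_poly_ext (adjoin_poly_add fhn fqn); apply: filterS gE => x ->; ring.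
Qed.

Lemma der_yn n : evder (fun x => y x ^+ n)
  (fun x => n%:R * a x * y x ^+ n + n%:R * b x * y x ^+ n.-1).
Proof.
case: n => [|n].
  by apply: nearW => x; rewrite !mul0r addr0; exact: der_cst.
apply: filterS dy => x /(der_exprn n); apply: derE; rewrite exprS /=; ring.
Qed.

Lemma adjoin_poly_der n f : adjoin_poly n f -> exists2 f', adjoin_poly n f' & evder f f'.
Proof.
elim: n f => [|n IH] f; first exact: hf_der.
move=> [g [p [/IH[g' g'n dg] Kp fE]]]; have [p' Kp' dp] := hf_der hK Kp.
have Kn := hf_cst hK n.+1%:R.
exists (fun x => (g' x + (p x * b x * n.+1%:R) * y x ^+ n) +
                 (p' x + p x * a x * n.+1%:R) * y x ^+ n.+1).
  apply: adjoin_poly_add.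
    apply: adjoin_polyW; apply: adjoin_poly_add => //; apply: adjoin_poly_yn.
    by do 2![apply: (hf_mul hK) => //].
  apply: adjoin_poly_yn; apply: (hf_add hK) => //; do 2![apply: (hf_mul hK) => //].
apply: evder_ext fE _; apply: filterS3 dg dp (der_yn n.+1) => x dgx dpx dyx.
by apply: derE (derD dgx (derM dpx dyx)) => /=; ring.
Qed.

(* After division by the leading monomial (or its coefficient) the derivative has
   lower degree in [y], hence a sign, so the quotient is eventually monotone. *)
Lemma adjoin_poly_sign_expo n h : (\forall x \near +oo_R, b x = 0) ->
  (\forall x \near +oo_R, 0 < y x) -> (forall f, adjoin_poly n f -> evsign f) ->
  adjoin_poly n h -> evsign (fun x => h x + y x ^+ n.+1).
Proof.
move=> b0 y0 sign_n hn; have [h' h'n dh] := adjoin_poly_der hn.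
pose w x := h x * (y x)^-1 ^+ n.+1 + 1.
have sw : evsign w.
  apply: (@evsign_der _ (fun x => (h' x + h x * (- n.+1%:R * a x)) * (y x)^-1 ^+ n.+1)).
    apply: filterS3 dh dy (filterI b0 y0) => x dhx dyx [b0x y0x].
    have := derD (derM dhx (der_exprn n (der_inv (lt0r_neq0 y0x) dyx))) (der_cst 1 x).
    apply: derE; rewrite b0x !exprS; have := lt0r_neq0 y0x.
    by move: (y x) ((y x)^-1 ^+ n) => u v u0; field.
  apply: evsignM.
    apply: sign_n; apply: adjoin_poly_add => //; apply: adjoin_poly_mulK => //.
    by apply: (hf_mul hK) => //; exact: hf_cst.
  by apply: evsign_gt0; apply: filterS y0 => x y0; rewrite exprn_gt0// invr_gt0.
apply: (@evsign_ext (fun x => y x ^+ n.+1 * w x)).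
  apply: filterS y0 => x y0; rewrite /w exprVn.
  by have := lt0r_neq0 (exprn_gt0 n.+1 y0); move: (y x ^+ _) => u u0; field.
by apply: evsignM sw; apply: evsign_gt0; apply: filterS y0 => x y0; rewrite exprn_gt0.
Qed.

Lemma adjoin_poly_sign_prim n h : (\forall x \near +oo_R, a x = 0) ->
  (forall f, adjoin_poly n f -> evsign f) ->
  adjoin_poly n h -> evsign (fun x => h x + y x ^+ n.+1).
Proof.
move=> a0 sign_n hn; have [h' h'n dh] := adjoin_poly_der hn.
apply: (@evsign_der _ (fun x => h' x + n.+1%:R * b x * y x ^+ n)).
  apply: filterS3 dh (der_yn n.+1) a0 => x dhx dyx a0x.
  by apply: derE (derD dhx dyx); rewrite a0x /=; ring.
apply: sign_n; apply: adjoin_poly_add => //; apply: adjoin_poly_yn.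
by apply: (hf_mul hK) => //; exact: hf_cst.
Qed.

Hypothesis expo_or_prim :
  ((\forall x \near +oo_R, b x = 0) /\ \forall x \near +oo_R, 0 < y x) \/
  \forall x \near +oo_R, a x = 0.

Lemma adjoin_poly_sign n f : adjoin_poly n f -> evsign f.
Proof.
elim: n f => [|n IH] f; first exact: hf_sign.
move=> [g [p [gn Kp fE]]].
have [p0|p0] := evsign_neq0 (hf_sign hK Kp).
  apply: (@evsign_ext g); last exact: IH.
  by apply: filterS2 fE p0 => x -> ->; rewrite mul0r addr0.
have hn : adjoin_poly n (fun x => g x * (p x)^-1).
  by apply: adjoin_poly_mulK => //; exact: hf_inv.
apply: (@evsign_ext (fun x => p x * (g x * (p x)^-1 + y x ^+ n.+1))).
  by apply: filterS2 fE p0 => x -> p0x; field.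
apply: evsignM (hf_sign hK Kp) _; have [[b0 y0]|a0] := expo_or_prim.
  exact: adjoin_poly_sign_expo.
exact: adjoin_poly_sign_prim.
Qed.

Definition adjoin : set (R -> R) :=
  [set f | exists n u v, [/\ adjoin_poly n u, adjoin_poly n v,
    \forall x \near +oo_R, v x != 0 & \forall x \near +oo_R, f x = u x / v x]].

Lemma adjoin_subset : K `<=` adjoin.
Proof.
move=> f Kf; exists 0%N, f, (fun=> 1); split=> //; first exact: hf_cst.
  by apply: nearW => x; rewrite oner_neq0.
by apply: nearW => x; rewrite divr1.
Qed.

Lemma adjoin_gen : adjoin y.
Proof.
exists 1%N, y, (fun=> 1); split=> //.
- apply: adjoin_poly_ext (adjoin_poly_yn 1 (hf_cst hK 1)); apply: nearW => x.
  by rewrite mul1r expr1.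
- exact: adjoin_poly_K (hf_cst hK 1).
- by apply: nearW => x; rewrite oner_neq0.
- by apply: nearW => x; rewrite divr1.
Qed.

Lemma adjoin_ext f g : (\forall x \near +oo_R, g x = f x) -> adjoin f -> adjoin g.
Proof.
move=> gf [n [u [v [un vn v0 fE]]]]; exists n, u, v; split=> //.
by apply: filterS2 gf fE => x ->.
Qed.

Lemma adjoin_add f g : adjoin f -> adjoin g -> adjoin (fun x => f x + g x).
Proof.
move=> [n [u [v [un vn v0 fE]]]] [m [u' [v' [um vm v0' gE]]]].
exists (n + m)%N, (fun x => u x * v' x + v x * u' x), (fun x => v x * v' x); split.
- by apply: adjoin_poly_add; apply: adjoin_poly_mul.
- exact: adjoin_poly_mul.
- by apply: filterS2 v0 v0' => x; exact: mulf_neq0.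
apply: filterS3 (filterI v0 v0') fE gE => x [v0x v0'x] -> ->.
by field; rewrite v0x v0'x.
Qed.

Lemma adjoin_mul f g : adjoin f -> adjoin g -> adjoin (fun x => f x * g x).
Proof.
move=> [n [u [v [un vn v0 fE]]]] [m [u' [v' [um vm v0' gE]]]].
exists (n + m)%N, (fun x => u x * u' x), (fun x => v x * v' x); split.
- exact: adjoin_poly_mul.
- exact: adjoin_poly_mul.
- by apply: filterS2 v0 v0' => x; exact: mulf_neq0.
apply: filterS3 (filterI v0 v0') fE gE => x [v0x v0'x] -> ->.
by field; rewrite v0x v0'x.
Qed.

Lemma adjoin_sign f : adjoin f -> evsign f.
Proof.
move=> [n [u [v [un vn v0 fE]]]]; apply: evsign_ext fE _; apply: evsignM.
  exact: adjoin_poly_sign un.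
by apply: evsignV; exact: adjoin_poly_sign vn.
Qed.

Lemma adjoin_inv f : adjoin f -> adjoin (fun x => (f x)^-1).
Proof.
move=> [n [u [v [un vn v0 fE]]]].
have [u0|u0] := evsign_neq0 (adjoin_poly_sign un).
  apply: adjoin_ext (adjoin_subset (hf_cst hK 0)).
  by apply: filterS2 fE u0 => x -> ->; rewrite mul0r invr0.
exists n, v, u; split=> //; apply: filterS fE => x ->.
by rewrite invfM invrK mulrC.
Qed.

Lemma adjoin_der f : adjoin f -> exists2 f', adjoin f' & evder f f'.
Proof.
move=> [n [u [v [un vn v0 fE]]]].
have [u' u'n du] := adjoin_poly_der un; have [v' v'n dv] := adjoin_poly_der vn.
pose w x := u' x * v x + u x * (v' x * (-1)).
exists (fun x => w x / (v x * v x)).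
  exists (n + n)%N, w, (fun x => v x * v x); split.
  - apply: adjoin_poly_add; apply: adjoin_poly_mul => //; apply: adjoin_poly_mulK => //.
    exact: hf_cst.
  - exact: adjoin_poly_mul.
  - by apply: filterS v0 => x v0; exact: mulf_neq0.
  - exact: nearW.
apply: evder_ext fE _; apply: filterS3 du dv v0 => x dux dvx v0.
by apply: derE (derM dux (der_inv v0 dvx)); rewrite /w; field.
Qed.

Lemma hardy_adjoin : hardy adjoin.
Proof.
split; [exact: adjoin_ext| |exact: adjoin_add|exact: adjoin_mul|exact: adjoin_inv
  |exact: adjoin_der|exact: adjoin_sign].
by move=> c; apply: adjoin_subset; exact: hf_cst.
Qed.

End Adjoin.

Lemma hardy_adjoin_prim K y b : hardy K -> K b -> evder y b ->
  exists K', [/\ hardy K', K `<=` K' & K' y].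
Proof.
move=> hK Kb dy.
have K0 := hf_cst hK 0.
have dy' : evder y (fun x => 0 * y x + b x).
  by apply: filterS dy => x; apply: derE; rewrite mul0r add0r.
exists (adjoin K y); split; [|exact: adjoin_subset|exact: adjoin_gen].
by apply: (hardy_adjoin hK K0 Kb dy'); right; exact: nearW.
Qed.

Lemma hardy_adjoin_exp K g : hardy K -> K g ->
  exists K', [/\ hardy K', K `<=` K' & K' (fun x => expR (g x))].
Proof.
move=> hK Kg; have [g' Kg' dg] := hf_der hK Kg.
have K0 := hf_cst hK 0.
have dy' : evder (fun x => expR (g x)) (fun x => g' x * expR (g x) + 0).
  by apply: filterS dg => x /der_exp; apply: derE; rewrite addr0.
exists (adjoin K (fun x => expR (g x))).
split; [|exact: adjoin_subset|exact: adjoin_gen].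
apply: (hardy_adjoin hK Kg' K0 dy'); left; split; apply: nearW => // x.
exact: expR_gt0.
Qed.

Lemma hardy_adjoin_ln K g : hardy K -> K g -> (\forall x \near +oo_R, 0 < g x) ->
  exists K', [/\ hardy K', K `<=` K' & K' (fun x => ln (g x))].
Proof.
move=> hK Kg g0; have [g' Kg' dg] := hf_der hK Kg.
apply: (hardy_adjoin_prim hK (hf_mul hK Kg' (hf_inv hK Kg))).
by apply: filterS2 g0 dg => x; exact: der_ln.
Qed.

End Hardy.

(** * The ultrapower of the real field at infinity *)

Section Ultrapower.
Variables (R : realType) (U : set_system R) (UU : UltraFilter U).
Implicit Types f g h : R -> R.

(* The dummy argument makes the type determine the proof used by the instances. *)
Definition ultrapower_of (_ : UltraFilter U) : Type :=
  {A : set (R -> R) | exists f, A = [set g | \forall x \near U, g x = f x]}.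
Local Notation K := (ultrapower_of UU).
Implicit Types a b c : K.

HB.instance Definition _ := gen_eqMixin K.
HB.instance Definition _ := gen_choiceMixin K.

Definition germ f : K := exist _ _ (ex_intro _ f erefl).

Definition germ_repr a : R -> R := proj1_sig (cid (proj2_sig a)).

Lemma near_or_near_not (P : R -> Prop) :
  (\forall x \near U, P x) \/ \forall x \near U, ~ P x.
Proof. exact: in_ultra_setVsetC. Qed.

Lemma near_ex2 (P Q : R -> Prop) :
  (\forall x \near U, P x) -> (\forall x \near U, Q x) -> exists x, P x /\ Q x.
Proof. by move=> UP UQ; apply: (@filter_ex _ U); exact: filterI. Qed.

Lemma germ_reprK a : germ (germ_repr a) = a.
Proof.
rewrite /germ_repr; case: a => A PA; case: (cid _) => f /= fA.
by apply: eq_exist => /=; rewrite fA.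
Qed.

Lemma germ_eq f g : germ f = germ g <-> \forall x \near U, f x = g x.
Proof.
split=> [/(congr1 sval)/= fg|fg].
  have : [set h | \forall x \near U, h x = f x] f by exact: nearW.
  by rewrite fg.
apply: eq_exist; apply/seteqP; split=> h /= hf; apply: filterS2 hf fg => x -> //.
Qed.

Lemma germ_surj a : exists f, a = germ f.
Proof. by exists (germ_repr a); rewrite germ_reprK. Qed.

Lemma germ_repr_near f : \forall x \near U, germ_repr (germ f) x = f x.
Proof. by apply/germ_eq; rewrite germ_reprK. Qed.

Definition germ_map (o : R -> R) a := germ (fun x => o (germ_repr a x)).
Definition germ_map2 (o : R -> R -> R) a b :=
  germ (fun x => o (germ_repr a x) (germ_repr b x)).

Lemma germ_mapE o f : germ_map o (germ f) = germ (fun x => o (f x)).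
Proof. by apply/germ_eq; apply: filterS (germ_repr_near f) => x ->. Qed.

Lemma germ_map2E o f g :
  germ_map2 o (germ f) (germ g) = germ (fun x => o (f x) (g x)).
Proof.
by apply/germ_eq; apply: filterS2 (germ_repr_near f) (germ_repr_near g) => x -> ->.
Qed.

Definition germ_add := germ_map2 +%R.
Definition germ_mul := germ_map2 *%R.
Definition germ_opp := germ_map -%R.
Definition germ_inv := germ_map GRing.inv.

Ltac pointwise := repeat (let a := fresh "a" in let f := fresh "f" in
    intro a; have [f ->] := germ_surj a);
  rewrite /germ_add /germ_mul /germ_opp /germ_inv ?(germ_map2E, germ_mapE);
  apply/germ_eq; apply: nearW => x.

Fact germ_addA : associative germ_add. Proof. by pointwise; rewrite addrA. Qed.
Fact germ_addC : commutative germ_add. Proof. by pointwise; rewrite addrC. Qed.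
Fact germ_add0 : left_id (germ (fun=> 0)) germ_add.
Proof. by pointwise; rewrite add0r. Qed.
Fact germ_addN : left_inverse (germ (fun=> 0)) germ_opp germ_add.
Proof. by pointwise; rewrite addNr. Qed.
HB.instance Definition _ :=
  GRing.isZmodule.Build K germ_addA germ_addC germ_add0 germ_addN.

Fact germ_mulA : associative germ_mul. Proof. by pointwise; rewrite mulrA. Qed.
Fact germ_mulC : commutative germ_mul. Proof. by pointwise; rewrite mulrC. Qed.
Fact germ_mul1 : left_id (germ (fun=> 1)) germ_mul.
Proof. by pointwise; rewrite mul1r. Qed.
Fact germ_mulDl : left_distributive germ_mul germ_add.
Proof. by pointwise; rewrite mulrDl. Qed.
Fact germ_one_neq0 : germ (fun=> 1) != 0.
Proof. by apply/eqP => /germ_eq/filter_ex[x /eqP]; rewrite oner_eq0. Qed.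
HB.instance Definition _ := GRing.Zmodule_isComNzRing.Build K
  germ_mulA germ_mulC germ_mul1 germ_mulDl germ_one_neq0.

Fact germ_mulV a : a != 0 -> germ_mul (germ_inv a) a = 1.
Proof.
have [f ->] := germ_surj a => /eqP f0.
rewrite /germ_mul /germ_inv germ_mapE germ_map2E; apply/germ_eq.
have [f_eq0|] := near_or_near_not (fun x => f x = 0).
  by case: f0; apply/germ_eq.
by apply: filterS => x /eqP fx; rewrite mulVf.
Qed.
Fact germ_inv0 : germ_inv 0 = 0.
Proof.
by rewrite /germ_inv [LHS]germ_mapE; apply/germ_eq/nearW => x; rewrite invr0.
Qed.
HB.instance Definition _ := GRing.ComNzRing_isField.Build K germ_mulV germ_inv0.

Lemma germD f g : germ f + germ g = germ (fun x => f x + g x).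
Proof. exact: germ_map2E. Qed.
Lemma germM f g : germ f * germ g = germ (fun x => f x * g x).
Proof. exact: germ_map2E. Qed.
Lemma germN f : - germ f = germ (fun x => - f x).
Proof. exact: germ_mapE. Qed.
Lemma germV f : (germ f)^-1 = germ (fun x => (f x)^-1).
Proof. exact: germ_mapE. Qed.

Definition germ_leb : rel K :=
  fun a b => `[< \forall x \near U, germ_repr a x <= germ_repr b x >].
Definition germ_ltb : rel K := fun a b => (b != a) && germ_leb a b.

Fact germ_lebP f g : germ_leb (germ f) (germ g) <-> \forall x \near U, f x <= g x.
Proof.
split=> [/asboolP|] fg; last apply/asboolP.
  by apply: filterS3 fg (germ_repr_near f) (germ_repr_near g) => x fg <- <-.
by apply: filterS3 fg (germ_repr_near f) (germ_repr_near g) => x fg -> ->.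
Qed.

Fact germ_leb0_add a b : germ_leb 0 a -> germ_leb 0 b -> germ_leb 0 (a + b).
Proof.
have [f ->] := germ_surj a; have [g ->] := germ_surj b.
move=> /germ_lebP f0 /germ_lebP g0; rewrite germD; apply/germ_lebP.
by apply: filterS2 f0 g0 => x; exact: addr_ge0.
Qed.
Fact germ_leb0_mul a b : germ_leb 0 a -> germ_leb 0 b -> germ_leb 0 (a * b).
Proof.
have [f ->] := germ_surj a; have [g ->] := germ_surj b.
move=> /germ_lebP f0 /germ_lebP g0; rewrite germM; apply/germ_lebP.
by apply: filterS2 f0 g0 => x; exact: mulr_ge0.
Qed.
Fact germ_leb0_anti a : germ_leb 0 a -> germ_leb a 0 -> a = 0.
Proof.
have [f ->] := germ_surj a => /germ_lebP f_ge0 /germ_lebP f_le0; apply/germ_eq.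
by apply: filterS2 f_ge0 f_le0 => x ? ?; apply: le_anti; apply/andP.
Qed.
Fact germ_subr_ge0 a b : germ_leb 0 (b - a) = germ_leb a b.
Proof.
have [f ->] := germ_surj a; have [g ->] := germ_surj b; rewrite germN germD.
apply/idP/idP => /germ_lebP fg; apply/germ_lebP; apply: filterS fg => x;
  by rewrite subr_ge0.
Qed.
Fact germ_leb0_total a : germ_leb 0 a || germ_leb a 0.
Proof.
have [f ->] := germ_surj a; apply/orP.
have [f_ge0|f_lt0] := near_or_near_not (fun x => 0 <= f x); [left|right].
  exact/germ_lebP.
by apply/germ_lebP; apply: filterS f_lt0 => x /negP; rewrite -ltNge => /ltW.
Qed.
Fact germ_normN a : germ_map Num.norm (- a) = germ_map Num.norm a.
Proof.
have [f ->] := germ_surj a; rewrite germN !germ_mapE; apply/germ_eq/nearW => x.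
by rewrite normrN.
Qed.
Fact germ_ge0_norm a : germ_leb 0 a -> germ_map Num.norm a = a.
Proof.
have [f ->] := germ_surj a => /germ_lebP f0; rewrite !germ_mapE; apply/germ_eq.
by apply: filterS f0 => x; exact: ger0_norm.
Qed.
HB.instance Definition _ := Num.IntegralDomain_isLeReal.Build K
  germ_leb0_add germ_leb0_mul germ_leb0_anti germ_subr_ge0 germ_leb0_total
  germ_normN germ_ge0_norm (fun _ _ => erefl (germ_ltb _ _)).

Lemma germ_le f g : germ f <= germ g <-> \forall x \near U, f x <= g x.
Proof. exact: germ_lebP. Qed.

Lemma germ_lt f g : germ f < germ g <-> \forall x \near U, f x < g x.
Proof.
rewrite ltNge; split=> [/negP nfg|fg].
  have [gf|] := near_or_near_not (fun x => g x <= f x); first by case: nfg; apply/germ_le.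
  by apply: filterS => x /negP; rewrite -ltNge.
apply/negP => /germ_le gf; have [x [fgx gfx]] := near_ex2 fg gf.
by move: fgx; rewrite ltNge => /negP[].
Qed.

Lemma germ_norm f : `|germ f| = germ (fun x => `|f x|).
Proof. exact: germ_mapE. Qed.

Lemma germ_nat n : n%:R = germ (fun=> n%:R).
Proof. by elim: n => [//|n IH]; rewrite -natr1 IH -natr1 [LHS]germD. Qed.

Lemma germX f n : germ f ^+ n = germ (fun x => f x ^+ n).
Proof.
elim: n => [//|n IH]; rewrite exprS IH germM; congr germ; apply/funext => x.
by rewrite exprS.
Qed.

Lemma germ_sum n (F : nat -> R -> R) :
  \sum_(i < n) germ (F i) = germ (fun x => \sum_(i < n) F i x).
Proof.
elim: n => [|n IH].
  by rewrite big_ord0; congr germ; apply/funext => x; rewrite big_ord0.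
by rewrite big_ord_recr /= IH germD; congr germ; apply/funext => x; rewrite big_ord_recr.
Qed.

Hypothesis U_pinfty : +oo_R `<=` U.

Definition germ_exp := germ_map (@expR R).
Definition germ_ln := germ_map (@ln R).

Fact germ_exp_gt0 a : 0 < germ_exp a.
Proof.
have [f ->] := germ_surj a; rewrite /germ_exp germ_mapE; apply/germ_lt/nearW => x.
exact: expR_gt0.
Qed.
Fact germ_expD a b : germ_exp (a + b) = germ_exp a * germ_exp b.
Proof.
have [f ->] := germ_surj a; have [g ->] := germ_surj b.
rewrite germD /germ_exp !germ_mapE germM; apply/germ_eq/nearW => x.
exact: expRD.
Qed.
Fact germ_exp_ge a : 1 + a <= germ_exp a.
Proof.
have [f ->] := germ_surj a; rewrite /germ_exp germ_mapE [_ + _]germD.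
by apply/germ_le/nearW => x; exact: expR_ge1Dx.
Qed.
Fact germ_expK a : germ_ln (germ_exp a) = a.
Proof.
have [f ->] := germ_surj a; rewrite /germ_exp /germ_ln !germ_mapE.
by apply/germ_eq/nearW => x; rewrite expRK.
Qed.
Fact germ_lnK a : 0 < a -> germ_exp (germ_ln a) = a.
Proof.
have [f ->] := germ_surj a => /germ_lt f0; rewrite /germ_exp /germ_ln !germ_mapE.
by apply/germ_eq; apply: filterS f0 => x f0; rewrite lnK.
Qed.
Fact germ_id_gt_nat n : n%:R < germ id.
Proof.
by rewrite germ_nat; apply/germ_lt; apply: U_pinfty; exact: nbhs_pinfty_gt (num_real _).
Qed.

Definition ultrapower : exp_field :=
  ExpField germ_exp_gt0 germ_expD germ_exp_ge germ_expK germ_lnK germ_id_gt_nat.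

Lemma ef_exp_germ f : ef_exp (germ f : ultrapower) = germ (fun x => expR (f x)).
Proof. exact: germ_mapE. Qed.

Lemma ef_ln_germ f : ef_ln (germ f : ultrapower) = germ (fun x => ln (f x)).
Proof. exact: germ_mapE. Qed.

Definition germ_cst (r : R) : ultrapower := germ (fun=> r).

Fact germ_cst_is_zmod_morphism : zmod_morphism germ_cst.
Proof. by move=> r s; rewrite /germ_cst germN germD. Qed.
Fact germ_cst_is_monoid_morphism : monoid_morphism germ_cst.
Proof. by split=> // r s; rewrite /germ_cst germM. Qed.
HB.instance Definition _ :=
  GRing.isZmodMorphism.Build R ultrapower germ_cst germ_cst_is_zmod_morphism.
HB.instance Definition _ :=
  GRing.isMonoidMorphism.Build R ultrapower germ_cst germ_cst_is_monoid_morphism.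
Local Notation cst := (germ_cst : {rmorphism R -> ultrapower}).

Lemma germ_cst_le : {mono germ_cst : x y / x <= y}.
Proof.
move=> r s; apply/idP/idP => [/germ_le/filter_ex[]//|rs].
exact/germ_le/nearW.
Qed.

Lemma germ_cst_exp r : ef_exp (germ_cst r) = germ_cst (expR r).
Proof. exact: ef_exp_germ. Qed.

Definition analytic_germ : set ultrapower :=
  [set a | exists d g, [/\ 0 < d, analytic_on 0 d g & a = germ (fun x => g x^-1)]].

Lemma near_inv_small (d : R) : 0 < d -> \forall x \near U, 0 < x^-1 < d.
Proof.
move=> d0; apply: U_pinfty; apply: filterS (nbhs_pinfty_gt (num_real d^-1)) => x dx.
have x0 : 0 < x by apply: lt_trans dx; rewrite invr_gt0.
by rewrite invr_gt0 x0 /= -[ltRHS]invrK ltf_pV2 ?posrE ?invr_gt0.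
Qed.

Lemma germ_inv_eq d f g : 0 < d -> (forall t, 0 < t < d -> f t = g t) ->
  germ (fun x => f x^-1) = germ (fun x => g x^-1).
Proof.
by move=> /near_inv_small d0 fg; apply/germ_eq; apply: filterS d0 => x; exact: fg.
Qed.

Lemma ef_X_inv : (ef_X ultrapower)^-1 = germ (fun x => x^-1).
Proof. exact: germV. Qed.

Lemma analytic_germ_common a b : analytic_germ a -> analytic_germ b ->
  exists d f g, [/\ 0 < d, analytic_on 0 d f, analytic_on 0 d g,
    a = germ (fun x => f x^-1) & b = germ (fun x => g x^-1)].
Proof.
move=> [d [f [d0 af ->]]] [e [g [e0 ag ->]]].
exists (Num.min d e), f, g; split=> //; first by rewrite lt_min d0.
  by apply: analytic_on_sub af => //; rewrite ge_min lexx.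
by apply: analytic_on_sub ag => //; rewrite ge_min lexx orbT.
Qed.

Lemma analytic_germ_cst r : analytic_germ (germ_cst r).
Proof. by exists 1, (fun=> r); split=> //; exact: analytic_on_cst. Qed.

Lemma analytic_germ_XV : analytic_germ (ef_X ultrapower)^-1.
Proof. by exists 1, id; split=> //; [exact: analytic_on_id|exact: ef_X_inv]. Qed.

Lemma analytic_germ_add a b :
  analytic_germ a -> analytic_germ b -> analytic_germ (a + b).
Proof.
move=> ha hb; have [d [f [g [d0 af ag -> ->]]]] := analytic_germ_common ha hb.
exists d, (fun x => f x + g x).
by split=> //; [exact: analytic_on_add|rewrite germD].
Qed.

Lemma analytic_germ_mul a b :
  analytic_germ a -> analytic_germ b -> analytic_germ (a * b).
Proof.
move=> ha hb; have [d [f [g [d0 af ag -> ->]]]] := analytic_germ_common ha hb.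
exists d, (fun x => f x * g x).
by split=> //; [exact: analytic_on_mul|rewrite germM].
Qed.

Lemma analytic_germ_exp (a : ultrapower) : analytic_germ a -> analytic_germ (ef_exp a).
Proof.
move=> [d [f [d0 af ->]]]; exists d, (fun x => expR (f x)).
by split=> //; [exact: analytic_on_exp|rewrite ef_exp_germ].
Qed.

Lemma analytic_germ_ln (a : ultrapower) :
  analytic_germ a -> 1 <= a -> analytic_germ (ef_ln a).
Proof.
move=> [d [f [d0 af ->]]] /germ_le f1; have [|e e0 ae] := analytic_on_ln0 d0 af.
  by move=> e /near_inv_small/(near_ex2 f1)[x [fx xe]]; exists x^-1.
by exists e, (fun x => ln (f x)); split=> //; rewrite ef_ln_germ.
Qed.

Lemma analytic_germ_isO1 a : analytic_germ a -> isO (1 : ultrapower) a.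
Proof.
move=> [d [f [/near_inv_small d0 af ->]]]; have [N fN] := analytic_on_bounded af.
exists N; rewrite mulr1 germ_nat germ_norm; apply/germ_le.
by apply: filterS d0 => x; exact: fN.
Qed.

Lemma analytic_germ_div a : analytic_germ a -> exists r a',
  analytic_germ a' /\ a = germ_cst r + (ef_X ultrapower)^-1 * a'.
Proof.
move=> [d [f [d0 af ->]]]; have [r [h [ah fE]]] := analytic_on_div0 d0 af.
exists r, (germ (fun x => h x^-1)); split; first by exists d, h.
by rewrite (germ_inv_eq d0 fE) ef_X_inv germM germD.
Qed.

Lemma analytic_germ_order a : analytic_germ a -> a = 0 \/ exists (k : nat) r a',
  [/\ r != 0, analytic_germ a' &
      a = ef_X ultrapower ^- k * (germ_cst r + (ef_X ultrapower)^-1 * a')].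
Proof.
move=> [d [f [d0 af ->]]].
have [[e e0 fe]|[k [r [h [r0 ah fE]]]]] := analytic_on_order0 d0 af; [left|right].
  exact: (germ_inv_eq e0 fe).
exists k, r, (germ (fun x => h x^-1)); split=> //; first by exists d, h.
rewrite (germ_inv_eq d0 fE) -exprVn ef_X_inv germX (germM (fun x => x^-1)).
by rewrite [germ_cst r + _]germD germM.
Qed.

Lemma taylor_germ (phi : ultrapower -> ultrapower) (psi : R -> R) :
  (forall f, phi (germ f) = germ (fun x => psi (f x))) ->
  has_taylor0 psi -> taylor cst phi.
Proof.
move=> phiE psiT n; have [c [C cC]] := psiT n; exists c, C => e.
have [f ->] := germ_surj e; rewrite germ_norm phiE germX 2!germ_nat germV.
move=> /germ_le fe.
rewrite (eq_bigr (fun i : 'I_n => germ (fun x => c i * f x ^+ i))); last first.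
  by move=> i _; rewrite germX germM.
rewrite (@germ_sum n (fun i x => c i * f x ^+ i)) germN germD germ_norm germM.
by apply/germ_le; apply: filterS fe => x; exact: cC.
Qed.

Theorem ultrapower_gap (p q : ultrapower) : tame p -> tame q ->
  isO q p \/ isO p (q * ef_X ultrapower).
Proof.
apply: (tame_gap germ_cst_le germ_cst_exp analytic_germ_cst analytic_germ_XV
  analytic_germ_add analytic_germ_mul analytic_germ_exp analytic_germ_ln
  analytic_germ_isO1 analytic_germ_div analytic_germ_order).
- apply: (@taylor_germ _ (@expR R)); [exact: ef_exp_germ|exact: has_taylor0_expR].
- apply: (@taylor_germ _ (fun t => ln (1 + t))); last exact: has_taylor0_ln1.
  by move=> f; rewrite [1 + _]germD ef_ln_germ.
Qed.

End Ultrapower.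

(** * Skolem functions as real functions *)

Section SkolemFunctions.
Variable R : realType.
Implicit Types f g : pfun R.

Definition extend f (x : R) : R :=
  if pselect (0 < x) is left x_gt0 then (f (PosNum x_gt0))%:num else 1.

Lemma extendE f (x : {posnum R}) : extend f x%:num = (f x)%:num.
Proof.
rewrite /extend; case: pselect => [x0|]; last by case; exact: gt0.
by congr ((f _)%:num); apply: val_inj.
Qed.

Lemma gt0_posnum (x : R) : 0 < x -> exists y : {posnum R}, x = y%:num.
Proof. by move=> x0; exists (PosNum x0). Qed.

Lemma extend_gt0 f x : 0 < extend f x.
Proof. by rewrite /extend; case: pselect. Qed.
Hint Resolve extend_gt0 : core.

Lemma extend_one x : extend (fun=> 1%:pos) x = 1.
Proof. by rewrite /extend; case: pselect. Qed.

Lemma extend_id x : 0 < x -> extend (fun y => y) x = x.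
Proof. by move=> /gt0_posnum[y ->]; rewrite extendE. Qed.

Lemma extend_add f g x : 0 < x ->
  extend (fun y => ((f y)%:num + (g y)%:num)%:pos) x = extend f x + extend g x.
Proof. by move=> /gt0_posnum[y ->]; rewrite !extendE. Qed.

Lemma extend_mul f g x : 0 < x ->
  extend (fun y => ((f y)%:num * (g y)%:num)%:pos) x = extend f x * extend g x.
Proof. by move=> /gt0_posnum[y ->]; rewrite !extendE. Qed.

Lemma extend_pow f g x : 0 < x ->
  extend (fun y => ((f y)%:num `^ (g y)%:num)%:pos) x =
  expR (extend g x * ln (extend f x)).
Proof.
move=> /gt0_posnum[y ->]; rewrite !extendE /= /powR ifF//.
by apply/negbTE; rewrite lt0r_neq0.
Qed.

Lemma near_pinfty_gt0 : \forall x \near +oo_R, 0 < x.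
Proof. exact: nbhs_pinfty_gt. Qed.

Lemma pfun_ltE f g : pfun_lt f g <-> \forall x \near +oo_R, extend f x < extend g x.
Proof.
split=> [[M fg]|[M [_ fg]]].
  apply: filterS2 near_pinfty_gt0 (nbhs_pinfty_gt (num_real M)).
  by move=> x /gt0_posnum[y ->] My; rewrite !extendE; exact: fg.
by exists M => x /fg; rewrite !extendE.
Qed.

Lemma pfun_ltxx f : ~ pfun_lt f f.
Proof. by move=> /pfun_ltE/filter_ex[x]; rewrite ltxx. Qed.

Definition hardy_extendable f := forall K, hardy K -> exists K',
  [/\ hardy K', K `<=` K', K' (extend f) & K' (fun x => ln (extend f x))].

Lemma hardy_extendable2 f g K : hardy_extendable f -> hardy_extendable g ->
  hardy K -> exists K', [/\ hardy K', K `<=` K',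
    K' (extend f) /\ K' (fun x => ln (extend f x)) &
    K' (extend g) /\ K' (fun x => ln (extend g x))].
Proof.
move=> hf hg hK; have [K1 [hK1 KK1 K1f K1lf]] := hf K hK.
have [K2 [hK2 K12 K2g K2lg]] := hg K1 hK1.
exists K2; split=> //; first exact: subset_trans K12.
by split; apply: K12.
Qed.

Lemma hardy_extendable_one : hardy_extendable (fun=> 1%:pos).
Proof.
move=> K hK; exists K; split=> //.
  by apply: (hf_ext hK) (hf_cst hK 1); apply: nearW => x; exact: extend_one.
by apply: (hf_ext hK) (hf_cst hK 0); apply: nearW => x; rewrite extend_one ln1.
Qed.

Lemma hardy_extendable_id : hardy_extendable (fun x => x).
Proof.
move=> K hK.
have der_x : evder (fun x : R => x) (fun=> 1) by apply: nearW => x; exact: der_id.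
have [K1 [hK1 KK1 K1x]] := hardy_adjoin_prim hK (hf_cst hK 1) der_x.
have [K2 [hK2 K12 K2lx]] := hardy_adjoin_ln hK1 K1x near_pinfty_gt0.
exists K2; split=> //; first exact: subset_trans K12.
  apply: (hf_ext hK2) (K12 _ K1x); apply: filterS near_pinfty_gt0 => x.
  exact: extend_id.
by apply: (hf_ext hK2) K2lx; apply: filterS near_pinfty_gt0 => x x0; rewrite extend_id.
Qed.

Lemma hardy_extendable_add f g : hardy_extendable f -> hardy_extendable g ->
  hardy_extendable (fun x => ((f x)%:num + (g x)%:num)%:pos).
Proof.
move=> hf hg K hK; have [K1 [hK1 KK1 [K1f _] [K1g _]]] := hardy_extendable2 hf hg hK.
have K1fg := hf_add hK1 K1f K1g.
have [|K2 [hK2 K12 K2l]] := hardy_adjoin_ln hK1 K1fg.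
  by apply: nearW => x; rewrite addr_gt0.
exists K2; split=> //; first exact: subset_trans K12.
  apply: (hf_ext hK2) (K12 _ K1fg); apply: filterS near_pinfty_gt0 => x.
  exact: extend_add.
by apply: (hf_ext hK2) K2l; apply: filterS near_pinfty_gt0 => x x0; rewrite extend_add.
Qed.

Lemma hardy_extendable_mul f g : hardy_extendable f -> hardy_extendable g ->
  hardy_extendable (fun x => ((f x)%:num * (g x)%:num)%:pos).
Proof.
move=> hf hg K hK.
have [K1 [hK1 KK1 [K1f K1lf] [K1g K1lg]]] := hardy_extendable2 hf hg hK.
exists K1; split=> //.
  apply: (hf_ext hK1) (hf_mul hK1 K1f K1g); apply: filterS near_pinfty_gt0 => x.
  exact: extend_mul.
apply: (hf_ext hK1) (hf_add hK1 K1lf K1lg); apply: filterS near_pinfty_gt0 => x x0.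
by rewrite extend_mul// lnM ?posrE.
Qed.

Lemma hardy_extendable_pow f g : hardy_extendable f -> hardy_extendable g ->
  hardy_extendable (fun x => ((f x)%:num `^ (g x)%:num)%:pos).
Proof.
move=> hf hg K hK.
have [K1 [hK1 KK1 [_ K1lf] [K1g _]]] := hardy_extendable2 hf hg hK.
have K1e := hf_mul hK1 K1g K1lf.
have [K2 [hK2 K12 K2e]] := hardy_adjoin_exp hK1 K1e.
exists K2; split=> //; first exact: subset_trans K12.
  by apply: (hf_ext hK2) K2e; apply: filterS near_pinfty_gt0 => x; exact: extend_pow.
apply: (hf_ext hK2) (K12 _ K1e); apply: filterS near_pinfty_gt0 => x x0.
by rewrite extend_pow// expRK.
Qed.

Lemma skolem_hardy_extendable f : Skolem f -> hardy_extendable f.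
Proof.
elim=> {f} [||f g _ hf _ hg|f g _ hf _ hg|f g _ hf _ hg].
- exact: hardy_extendable_one.
- exact: hardy_extendable_id.
- exact: hardy_extendable_add.
- exact: hardy_extendable_mul.
- exact: hardy_extendable_pow.
Qed.

Lemma skolem_evsign f g (c : R) : Skolem f -> Skolem g ->
  evsign (fun x => extend f x - c * extend g x).
Proof.
move=> /skolem_hardy_extendable hf /skolem_hardy_extendable hg.
have [K [hK _ [Kf _] [Kg _]]] := hardy_extendable2 hf hg (hardy_cst R).
apply: (hf_sign hK); apply: (hf_add hK) => //.
by apply: (hf_opp hK); apply: (hf_mul hK) => //; exact: hf_cst.
Qed.

Definition ln_analytic_on (a b : R) f :=
  analytic_on a b (extend f) /\ analytic_on a b (fun x => ln (extend f x)).

Definition locally_ln_analytic f := forall c, 0 < c -> exists a b,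
  [/\ 0 <= a, a < c < b & ln_analytic_on a b f].

Lemma locally_ln_analytic2 f g (c : R) :
  locally_ln_analytic f -> locally_ln_analytic g -> 0 < c -> exists a b,
  [/\ 0 <= a, a < c < b, ln_analytic_on a b f & ln_analytic_on a b g].
Proof.
move=> af ag c0; have [a [b [a0 /andP[ac cb] [fa lfa]]]] := af c c0.
have [a' [b' [_ /andP[a'c cb'] [ga lga]]]] := ag c c0.
exists (Num.max a a'), (Num.min b b').
have a_max : a <= Num.max a a' by rewrite le_max lexx.
have a'_max : a' <= Num.max a a' by rewrite le_max lexx orbT.
have min_b : Num.min b b' <= b by rewrite ge_min lexx.
have min_b' : Num.min b b' <= b' by rewrite ge_min lexx orbT.
split; first exact: le_trans a_max.
- by rewrite gt_max lt_min ac a'c cb.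
- by split; [exact: analytic_on_sub fa|exact: analytic_on_sub lfa].
- by split; [exact: analytic_on_sub ga|exact: analytic_on_sub lga].
Qed.

Lemma locally_ln_analytic_one : locally_ln_analytic (fun=> 1%:pos).
Proof.
move=> c c0; exists 0, (c + 1); split=> //; first by rewrite c0 ltrDl ltr01.
split.
  by apply: analytic_on_ext (analytic_on_cst _ _ 1) => x _; rewrite extend_one.
by apply: analytic_on_ext (analytic_on_cst _ _ 0) => x _; rewrite extend_one ln1.
Qed.

Lemma locally_ln_analytic_id : locally_ln_analytic (fun x => x).
Proof.
move=> c c0; have c2 : 0 < c / 2 by lra.
have idE x : c / 2 < x < c + 1 -> x = extend (fun y => y) x.
  by move=> xc; rewrite extend_id//; lra.
have a_id := analytic_on_ext idE (analytic_on_id _ _).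
exists (c / 2), (c + 1); split; [exact: ltW|by apply/andP; split; lra|split=> //].
by apply: (analytic_on_ln c2) => // x xc; rewrite -idE//; lra.
Qed.

Section IntervalAnalytic.
Variables (a b : R) (f g : pfun R).
Hypotheses (a_ge0 : 0 <= a) (af : ln_analytic_on a b f) (ag : ln_analytic_on a b g).

Let x_gt0 (x : R) : a < x < b -> 0 < x.
Proof. by move=> /andP[ax _]; exact: le_lt_trans ax. Qed.

Lemma ln_analytic_on_add :
  ln_analytic_on a b (fun x => ((f x)%:num + (g x)%:num)%:pos).
Proof.
case: af ag => fa lfa [ga _].
have fga : analytic_on a b (extend (fun x => ((f x)%:num + (g x)%:num)%:pos)).
  by apply: analytic_on_ext (analytic_on_add fa ga) => x /x_gt0 x0; rewrite extend_add.
split=> //; have [N lN] := analytic_on_bounded lfa.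
apply: (@analytic_on_ln _ _ _ _ (expR (- N%:R)) (expR_gt0 _)) fga => x xab.
rewrite extend_add; last exact: x_gt0 xab.
have := lN x xab; rewrite ler_norml => /andP[lnf_ge _].
apply: le_trans (_ : extend f x <= _); last by rewrite lerDl ltW.
by rewrite -(lnK (_ : extend f x \is Num.pos)) ?posrE// ler_expR.
Qed.

Lemma ln_analytic_on_mul :
  ln_analytic_on a b (fun x => ((f x)%:num * (g x)%:num)%:pos).
Proof.
case: af ag => fa lfa [ga lga]; split.
  by apply: analytic_on_ext (analytic_on_mul fa ga) => x /x_gt0 x0; rewrite extend_mul.
apply: analytic_on_ext (analytic_on_add lfa lga) => x /x_gt0 x0.
by rewrite extend_mul ?lnM ?posrE.
Qed.

Lemma ln_analytic_on_pow :
  ln_analytic_on a b (fun x => ((f x)%:num `^ (g x)%:num)%:pos).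
Proof.
case: af ag => _ lfa [ga _]; have glfa := analytic_on_mul ga lfa; split.
  by apply: analytic_on_ext (analytic_on_exp glfa) => x /x_gt0 x0; rewrite extend_pow.
by apply: analytic_on_ext glfa => x /x_gt0 x0; rewrite extend_pow ?expRK.
Qed.

End IntervalAnalytic.

Lemma skolem_locally_ln_analytic f : Skolem f -> locally_ln_analytic f.
Proof.
elim=> {f} [||f g _ af _ ag c c0|f g _ af _ ag c c0|f g _ af _ ag c c0].
- exact: locally_ln_analytic_one.
- exact: locally_ln_analytic_id.
all: have [a [b [a0 cab fa ga]]] := locally_ln_analytic2 af ag c0.
all: exists a, b; split=> //.
- exact: ln_analytic_on_add.
- exact: ln_analytic_on_mul.
- exact: ln_analytic_on_pow.
Qed.

Lemma skolem_eq_near f g : Skolem f -> Skolem g ->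
  (\forall x \near +oo_R, extend f x = extend g x) -> f = g.
Proof.
move=> /skolem_locally_ln_analytic af /skolem_locally_ln_analytic ag fg.
have fg0 x : 0 < x -> extend f x - extend g x = 0.
  apply: (@analytic_on_identity _ (fun x => extend f x - extend g x)) => [c c0|].
    have [a [b [_ cab [fa _] [ga _]]]] := locally_ln_analytic2 af ag c0.
    by exists a, b; split=> //; exact: analytic_on_add (analytic_on_opp _).
  by apply: filterS fg => {}x ->; rewrite subrr.
apply/funext => x; apply: val_inj => /=.
have /fg0/eqP : 0 < x%:num by [].
by rewrite !extendE subr_eq0 => /eqP.
Qed.

Lemma skolem_total f g : Skolem f -> Skolem g -> f = g \/ pfun_lt f g \/ pfun_lt g f.
Proof.
move=> Sf Sg; have [fg|[fg|fg]] := skolem_evsign 1 Sf Sg.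
- left; apply: skolem_eq_near => //; apply: filterS fg => x /eqP.
  by rewrite mul1r subr_eq0 => /eqP.
- by right; right; apply/pfun_ltE; apply: filterS fg => x; rewrite mul1r subr_gt0.
- by right; left; apply/pfun_ltE; apply: filterS fg => x; rewrite mul1r subr_lt0.
Qed.

Lemma arch_leE f g : arch_le f g <->
  exists n : nat, \forall x \near +oo_R, extend f x <= n%:R * extend g x.
Proof.
have mulE n h (y : {posnum R}) : extend (fun x => (n.+1%:R * (h x)%:num)%:pos) y%:num
    = n.+1%:R * extend h y%:num by rewrite !extendE.
split=> [[n [->|/pfun_ltE fg]]|[n fg]].
- by exists n.+1; apply: filterS near_pinfty_gt0 => x /gt0_posnum[y ->]; rewrite mulE.
- exists n.+1; apply: filterS2 near_pinfty_gt0 fg => x /gt0_posnum[y ->].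
  by rewrite mulE => /ltW.
- exists n; right; apply/pfun_ltE.
  apply: filterS2 near_pinfty_gt0 fg => x /gt0_posnum[y ->] fgy.
  by rewrite mulE; apply: le_lt_trans fgy _; rewrite ltr_pM2r// ltr_nat.
Qed.

Lemma arch_le_refl f : arch_le f f.
Proof. by apply/arch_leE; exists 1%N; apply: nearW => x; rewrite mul1r. Qed.

Lemma arch_le_trans f g h : arch_le f g -> arch_le g h -> arch_le f h.
Proof.
move=> /arch_leE[n fg] /arch_leE[m gh]; apply/arch_leE; exists (n * m)%N.
apply: filterS2 fg gh => x fg gh; apply: le_trans fg _.
by rewrite natrM -mulrA; apply: ler_wpM2l.
Qed.

Lemma pfun_lt_arch_le f g : pfun_lt f g -> arch_le f g.
Proof.
move=> /pfun_ltE fg; apply/arch_leE; exists 1%N; apply: filterS fg => x /ltW.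
by rewrite mul1r.
Qed.

Lemma arch_eq_sym f g : arch_eq f g -> arch_eq g f. Proof. by case. Qed.

Lemma arch_eq_trans f g h : arch_eq f g -> arch_eq g h -> arch_eq f h.
Proof.
move=> [fg gf] [gh hg].
by split; [exact: arch_le_trans gh|exact: arch_le_trans gf].
Qed.

Definition arch_gt f g :=
  forall n : nat, \forall x \near +oo_R, n%:R * extend g x < extend f x.

Lemma arch_le_or_gt f g : Skolem f -> Skolem g -> arch_le f g \/ arch_gt f g.
Proof.
move=> Sf Sg; have [|nfg] := pselect (arch_le f g); [by left|right=> n].
have [fg|[fg|fg]] := skolem_evsign n%:R Sf Sg.
- case: nfg; apply/arch_leE; exists n; apply: filterS fg => x /eqP.
  by rewrite subr_eq0 => /eqP->.
- by apply: filterS fg => x; rewrite subr_gt0.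
- case: nfg; apply/arch_leE; exists n; apply: filterS fg => x.
  by rewrite subr_lt0 => /ltW.
Qed.

Lemma arch_gt_lt f g f' g' : arch_gt f g -> arch_le f f' -> arch_le g' g -> pfun_lt g' f'.
Proof.
move=> fg /arch_leE[n ff'] /arch_leE[m gg']; apply/pfun_ltE.
apply: filterS3 (fg (n * m)%N) ff' gg' => x fgx ff'x gg'x.
have nfg' : n%:R * extend g' x < n%:R * extend f' x.
  apply: lt_le_trans ff'x; apply: le_lt_trans fgx.
  by rewrite natrM -mulrA; apply: ler_wpM2l.
by rewrite ltNge; apply/negP => /(ler_wpM2l (ler0n R n)); rewrite leNgt nfg'.
Qed.

Section ArchClasses.
Variable A : set (pfun R).
Hypothesis A_skolem : A `<=` @Skolem R.
Implicit Types C D : set (pfun R).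

Lemma arch_class_eq f g : arch_eq f g -> arch_class A f = arch_class A g.
Proof.
move=> fg; apply/seteqP; split=> h [Ah fh]; split=> //.
  exact: arch_eq_trans (arch_eq_sym fg) fh.
exact: arch_eq_trans fg fh.
Qed.

Lemma arch_gt_class_lt f g : arch_gt f g ->
  arch_class_lt (arch_class A g) (arch_class A f).
Proof. by move=> fg g' f' [_ [_ gg']] [_ [ff' _]]; exact: arch_gt_lt fg ff' gg'. Qed.

Lemma arch_classes_total C D : arch_classes A C -> arch_classes A D ->
  C = D \/ arch_class_lt C D \/ arch_class_lt D C.
Proof.
move=> [f Af <-] [g Ag <-]; have [Sf Sg] := (A_skolem Af, A_skolem Ag).
have [fg|/arch_gt_class_lt] := arch_le_or_gt Sf Sg; last by right; right.
have [gf|/arch_gt_class_lt] := arch_le_or_gt Sg Sf; last by right; left.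
by left; exact: arch_class_eq.
Qed.

Definition class_repr C : pfun R := xget (fun=> 1%:pos) C.

Lemma class_reprP C : arch_classes A C -> C (class_repr C) /\ A (class_repr C).
Proof.
move=> [f Af <-]; have : arch_class A f (class_repr (arch_class A f)).
  by apply: xgetPex; exists f; do 2![split=> //]; exact: arch_le_refl.
by move=> Cr; split=> //; case: Cr.
Qed.

Lemma class_repr_lt C D : arch_classes A C -> arch_classes A D ->
  arch_class_lt C D -> arch_gt (class_repr D) (class_repr C).
Proof.
move=> hC hD CD; have [[Cr Ar] [Dr Ar']] := (class_reprP hC, class_reprP hD).
have [DC|//] := arch_le_or_gt (A_skolem Ar') (A_skolem Ar).
have CD_le := pfun_lt_arch_le (CD _ _ Cr Dr).
case: (@pfun_ltxx (class_repr D)); apply: CD => //.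
move: hC Cr CD_le DC => [f Af <-] [_ fC] CD_le DC; split=> //.
exact: arch_eq_trans fC _.
Qed.

End ArchClasses.

Section Embedding.
Variables (U : set_system R) (UU : UltraFilter U).
Hypothesis U_pinfty : +oo_R `<=` U.
Local Notation K := (ultrapower UU U_pinfty).

Definition embed f : K := germ UU (extend f).

Let near_gt0 : \forall x \near U, 0 < x. Proof. exact: U_pinfty near_pinfty_gt0. Qed.

Lemma skolem_elt_embed f : Skolem f -> skolem_elt (embed f).
Proof.
rewrite /embed; elim=> {f} [||f g _ Sf _ Sg|f g _ Sf _ Sg|f g _ Sf _ Sg].
- have -> : germ UU (extend (fun=> 1%:pos)) = 1 :> K.
    by apply/germ_eq/nearW => x; exact: extend_one.
  exact: skolem_elt_one.
- have -> : germ UU (extend (fun x => x)) = ef_X K.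
    by apply/germ_eq; apply: filterS near_gt0 => x; exact: extend_id.
  exact: skolem_elt_X.
- have := skolem_elt_add Sf Sg; rewrite [_ + _]germD; congr skolem_elt.
  by apply/germ_eq; apply: filterS near_gt0 => x x0; rewrite extend_add.
- have := skolem_elt_mul Sf Sg; rewrite [_ * _]germM; congr skolem_elt.
  by apply/germ_eq; apply: filterS near_gt0 => x x0; rewrite extend_mul.
- have := skolem_elt_pow Sf Sg; rewrite ef_ln_germ [_ * _]germM ef_exp_germ.
  congr skolem_elt.
  by apply/germ_eq; apply: filterS near_gt0 => x x0; rewrite extend_pow.
Qed.

Lemma skolem_elt_below_embed n f :
  Skolem_below (@two_pow_pow R n) f -> skolem_elt_below n (embed f).
Proof.
move=> [/skolem_elt_embed Sf /pfun_ltE/U_pinfty fn]; split=> //.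
rewrite /embed ef_ln_germ [n.+1%:R]germ_nat [2]germ_nat !ef_ln_germ.
have -> : ef_X K * germ UU (fun=> ln n.+1%:R) = germ UU (fun x => x * ln n.+1%:R).
  exact: germM.
rewrite ef_exp_germ [_ * _]germM; apply/germ_lt.
apply: filterS2 near_gt0 fn => x /gt0_posnum[y ->].
rewrite extendE [extend (two_pow_pow _) _]extendE /= => fy.
have : ln (f y)%:num < ln (2 `^ (n.+1%:R `^ y%:num)) by rewrite ltr_ln ?posrE.
by rewrite ln_powR /powR ifF// pnatr_eq0.
Qed.

Lemma embed_lt f g : pfun_lt f g -> embed f < embed g.
Proof. by move=> /pfun_ltE/U_pinfty fg; apply/germ_lt. Qed.

Lemma embed_arch_lt f g : arch_gt g f -> arch_lt (embed f) (embed g).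
Proof.
move=> gf n; rewrite [n%:R]germ_nat [_ * _]germM; apply/germ_lt.
exact: U_pinfty (gf n).
Qed.

Let ultrapower_embeds := skolem_elt_below_embeds (@ultrapower_gap R U UU U_pinfty).

Lemma skolem_below_order_type n : (0 < n)%N ->
  order_type_le (@pfun_lt R) (Skolem_below (@two_pow_pow R n)) (omega_tower n.+2).
Proof.
move=> /ultrapower_embeds[[e eP] _].
apply: (@order_type_le_homo _ _ _ _ _ (fun f => e (embed f))).
  by move=> f g [Sf _] [Sg _]; exact: skolem_total.
move=> f g /skolem_elt_below_embed fn /skolem_elt_below_embed gn fg.
by apply: eP => //; exact: embed_lt.
Qed.

Lemma skolem_below_arch_order_type n : (0 < n)%N ->
  order_type_le (@arch_class_lt R) (arch_classes (Skolem_below (@two_pow_pow R n)))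
    (omega_tower n.+1).
Proof.
move=> /ultrapower_embeds[_ [e eP]].
set A := Skolem_below _; have A_skolem : A `<=` @Skolem R by move=> f [].
apply: (@order_type_le_homo _ _ _ _ _ (fun C => e (embed (class_repr C)))).
  by move=> C D; exact: arch_classes_total.
move=> C D hC hD CD; have [[_ AC] [_ AD]] := (class_reprP hC, class_reprP hD).
apply: eP; [exact: skolem_elt_below_embed|exact: skolem_elt_below_embed|].
exact/embed_arch_lt/(class_repr_lt A_skolem).
Qed.

End Embedding.
End SkolemFunctions.

Theorem mainTheorem2 (R : realType) (n : nat) (hn : (1 <= n)%N) :
  order_type_le (@pfun_lt R) (Skolem_below (@two_pow_pow R n))
    (omega_tower n.+2) /\
  order_type_le (@arch_class_lt R)
    (arch_classes (Skolem_below (@two_pow_pow R n)))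
    (omega_tower n.+1).
Proof.
have [U [UU U_pinfty]] := ultraFilterLemma (@proper_pinfty_nbhs R).
split; first exact: (skolem_below_order_type UU U_pinfty).
exact: (skolem_below_arch_order_type UU U_pinfty).
Qed.
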